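(* The following conditions are equivalent: (i) For every subspace $L\in\mathcal{S}(\partial g)(\bar y,\bar y^* )$: if $\nabla F(\bar x)^T v^*=0$ and $(0,v^* )\in L$, then $v^*=0$. (ii) For every $q\in \mathrm{quad}\, g(\bar y,\bar y^* )$: if $\nabla F(\bar x)^T v^*=0$ and $v^*\in\partial q(0)$, then $v^*=0$. (iii) If $\nabla F(\bar x)^T v^*=0$ and $v^*\in D^*(\partial g)(\bar y,\bar y^* )(0)$, then $v^*=0$. (iv) If $\nabla F(\bar x)^T v^*=0$ and $v^*\in D_*(\partial g)(\bar y,\bar y^* )(0)$, then $v^*=0$. (v) The mapping $\Psi:\mathbb{R}^n\times\mathbb{R}^m\rightrightarrows\mathbb{R}^m$, $\Psi(x,y^* )=(\partial g)^{-1}(y^* )-F(x)$, is metrically regular around $((\bar x,\bar y^* ),0)$. (vi) The multiplier mapping $M_{\bar x}:\mathbb{R}^n\times\mathbb{R}^m\rightrightarrows\mathbb{R}^m$, $M_{\bar x}(x^*,b)=\{y^*\in\partial g(\bar y+b)\mid \nabla F(\bar x)^Ty^*=x^*\}$, has a graphical localization around $((\bar x^*,0),\bar y^* )$ which is single-valued and Lipschitzian relative to its domain.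
   Context: Standing assumptions: $F:\mathbb{R}^n\to\mathbb{R}^m$ is continuously differentiable around $\bar x\in\mathbb{R}^n$; $g:\mathbb{R}^m\to\mathbb{R}\cup\{\infty\}$ is a lower semicontinuous convex function with $\bar y:=F(\bar x)\in\operatorname{dom} g$; $\bar y^*\in\partial g(\bar y)$ is a given subgradient and $\bar x^*:=\nabla F(\bar x)^T\bar y^*$. Notation: for a set-valued map $S$ and $(x,y)\in\operatorname{gph}S$, $D^*S(x,y)$ is the limiting (Mordukhovich) coderivative, $\operatorname{gph}D^*S(x,y)=\{(y^*,x^* )\mid (x^*,-y^* )\in N_{\operatorname{gph}S}(x,y)\}$ with $N$ the limiting normal cone; $D_*S(x,y)$ is the strict graphical derivative, whose graph is the paratingent cone $\operatorname{Limsup}_{z\to(x,y),\,z\in\operatorname{gph}S,\,t\downarrow0}(\operatorname{gph}S-z)/t$. $\mathcal{S}(\partial g)(\bar y,\bar y^* )$ (SC derivative) is the set of all $m$-dimensional subspaces $L\subset\mathbb{R}^m\times\mathbb{R}^m$ that are limits (in the metric $d(L_1,L_2)=\|P_{L_1}-P_{L_2}\|$ of orthogonal projections) of tangent cones $T_{\operatorname{gph}\partial g}(y_k,y_k^* )$ along sequences $(y_k,y_k^* )\to(\bar y,\bar y^* )$ in $\operatorname{gph}\partial g$ at which these tangent cones are $m$-dimensional subspaces. $\mathrm{quad}\, g(\bar y,\bar y^* )$ (Rockafellar's quadratic bundle) is the collection of generalized quadratic forms $q$ (i.e. $q(0)=0$ and $\operatorname{gph}\partial q$ is a subspace) that are epigraphical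 limits of $\tfrac12\mathrm{d}^2 g(y_k,y_k^* )$ along sequences $(y_k,y_k^* )\to(\bar y,\bar y^* )$ at which $g$ is twice epi-differentiable with second subderivative a generalized quadratic form. Metric regularity of $\Psi$ around $(\bar z,\bar w)$ means $\operatorname{dist}(z,\Psi^{-1}(w))\le\kappa\,\operatorname{dist}(w,\Psi(z))$ for all $(z,w)$ near $(\bar z,\bar w)$, for some $\kappa\ge0$. *)

(* Defs.v *)
(* R : realType, R^k rendered as 'rV[R]_k;
   products R^a x R^b are rendered as 'rV[R]_(a+b) via row_mx / lsubmx / rsubmx. *)
From HB Require Import structures.
From mathcomp Require Import all_boot all_order all_algebra.
From mathcomp Require Import all_classical all_reals all_analysis.
Set Implicit Arguments. Unset Strict Implicit. Unset Printing Implicit Defensive.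
Import Order.TTheory GRing.Theory Num.Theory.
Import numFieldNormedType.Exports.
Local Open Scope classical_set_scope.
Local Open Scope ring_scope.

Section VarAnalysis.
Variable R : realType.
Local Notation V k := 'rV[R]_k.

Definition dot k (u v : V k) : R := (u *m v^T) 0 0.
Definition enorm k (u : V k) : R := Num.sqrt (dot u u).

(* distance from a point to a set (+oo for the empty set) *)
Definition edist k (z : V k) (A : set (V k)) : \bar R :=
  ereal_inf [set (enorm (z - a))%:E | a in A].

Definition gph a b (S : V a -> set (V b)) : set (V (a + b)) :=
  [set z | S (lsubmx z) (rsubmx z)].

Definition to0p (t : nat -> R) := (forall k, 0 < t k) /\ t @ \oo --> 0.

Definition tangent_cone k (C : set (V k)) (z : V k) : set (V k) :=
  [set w | exists (t : nat -> R) (w_ : nat -> V k),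
     to0p t /\ w_ @ \oo --> w /\ forall j, C (z + t j *: w_ j)].

Definition paratingent_cone k (C : set (V k)) (z : V k) : set (V k) :=
  [set w | exists (z_ : nat -> V k) (t : nat -> R) (w_ : nat -> V k),
     (forall j, C (z_ j)) /\ z_ @ \oo --> z /\ to0p t /\ w_ @ \oo --> w /\
     forall j, C (z_ j + t j *: w_ j)].

Definition regular_normal_cone k (C : set (V k)) (z : V k) : set (V k) :=
  [set v | forall e : R, 0 < e -> exists d : R, 0 < d /\
     forall z', C z' -> enorm (z' - z) < d -> dot v (z' - z) <= e * enorm (z' - z)].

Definition limiting_normal_cone k (C : set (V k)) (z : V k) : set (V k) :=
  [set v | exists (z_ v_ : nat -> V k),
     (forall j, C (z_ j)) /\ z_ @ \oo --> z /\ v_ @ \oo --> v /\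
     forall j, regular_normal_cone C (z_ j) (v_ j)].

Definition coderivative a b (S : V a -> set (V b)) (x : V a) (y : V b)
  (ys : V b) : set (V a) :=
  [set xs | limiting_normal_cone (gph S) (row_mx x y) (row_mx xs (- ys))].

Definition strict_derivative a b (S : V a -> set (V b)) (x : V a) (y : V b)
  (u : V a) : set (V b) :=
  [set v | paratingent_cone (gph S) (row_mx x y) (row_mx u v)].

Definition is_subspace k (L : set (V k)) :=
  exists A : 'M[R]_k, forall z, L z <-> (z <= A)%MS.
Definition is_subspace_dim k (L : set (V k)) (d : nat) :=
  exists A : 'M[R]_k, \rank A = d /\ forall z, L z <-> (z <= A)%MS.

Definition orth_proj k (L : set (V k)) (P : 'M[R]_k) :=
  P^T = P /\ P *m P = P /\ forall z, L z <-> z *m P = z.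

Definition SC_derivative m (S : V m -> set (V m)) (y ys : V m)
  : set (set (V (m + m))) :=
  [set L | is_subspace_dim L m /\
     exists (y_ ys_ : nat -> V m) (P_ : nat -> 'M[R]_(m + m)) (P : 'M[R]_(m + m)),
       (forall j, S (y_ j) (ys_ j)) /\ y_ @ \oo --> y /\ ys_ @ \oo --> ys /\
       (forall j, is_subspace_dim (tangent_cone (gph S) (row_mx (y_ j) (ys_ j))) m /\
                  orth_proj (tangent_cone (gph S) (row_mx (y_ j) (ys_ j))) (P_ j)) /\
       orth_proj L P /\ P_ @ \oo --> P].

Local Open Scope ereal_scope.

(* extended-real-valued convexity (for functions never equal to -oo) *)
Definition econvex k (f : V k -> \bar R) :=
  forall x y (t : R), (0 < t < 1)%R ->
    f (t *: x + (1 - t) *: y)%R <= t%:E * f x + (1 - t)%:E * f y.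

Definition csubdiff k (f : V k -> \bar R) (y : V k) : set (V k) :=
  [set ys | f y \is a fin_num /\ forall z, f y + (dot ys (z - y))%:E <= f z].

Definition regular_subdiff k (f : V k -> \bar R) (x : V k) : set (V k) :=
  [set v | f x \is a fin_num /\ forall e : R, (0 < e)%R -> exists d : R, (0 < d)%R /\
     forall x', (enorm (x' - x) < d)%R ->
       f x + (dot v (x' - x) - e * enorm (x' - x))%:E <= f x'].
Definition limiting_subdiff k (f : V k -> \bar R) (x : V k) : set (V k) :=
  [set v | f x \is a fin_num /\ exists (x_ v_ : nat -> V k),
     x_ @ \oo --> x /\ v_ @ \oo --> v /\
     (forall j, regular_subdiff f (x_ j) (v_ j)) /\
     (fun j => fine (f (x_ j))) @ \oo --> fine (f x)].

Definition gen_quad_form k (q : V k -> \bar R) :=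
  q 0%R = 0 /\ is_subspace (gph (limiting_subdiff q)).

Definition epi_cvg k (f_ : nat -> V k -> \bar R) (f : V k -> \bar R) :=
  forall x,
    (forall x_ : nat -> V k, x_ @ \oo --> x -> forall a : R, a%:E < f x ->
       exists N, forall j, (N <= j)%N -> a%:E < f_ j (x_ j)) /\
    (exists x_ : nat -> V k, x_ @ \oo --> x /\ forall b : R, f x < b%:E ->
       exists N, forall j, (N <= j)%N -> f_ j (x_ j) < b%:E).

Definition sdq k (f : V k -> \bar R) (y ys : V k) (t : R) (w : V k) : \bar R :=
  (f (y + t *: w)%R - f y - (t * dot ys w)%:E) * (2 / t ^+ 2)%:E.

Definition twice_epi_diff_gqf k (f : V k -> \bar R) (y ys : V k)
  (h : V k -> \bar R) :=
  gen_quad_form h /\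
  forall t : nat -> R, to0p t -> epi_cvg (fun j => sdq f y ys (t j)) h.

Definition quad_bundle k (f : V k -> \bar R) (y ys : V k) : set (V k -> \bar R) :=
  [set q | gen_quad_form q /\
     exists (y_ ys_ : nat -> V k) (h_ : nat -> V k -> \bar R),
       (forall j, csubdiff f (y_ j) (ys_ j)) /\
       y_ @ \oo --> y /\ ys_ @ \oo --> ys /\
       (forall j, twice_epi_diff_gqf f (y_ j) (ys_ j) (h_ j)) /\
       epi_cvg (fun j w => (2^-1)%:E * h_ j w) q].

Local Close Scope ereal_scope.

(* metric regularity of Psi around (z0, w0); kappa > 0 w.l.o.g. (avoids 0 * oo) *)
Definition metric_regular a b (Psi : V a -> set (V b)) (z0 : V a) (w0 : V b) :=
  exists kappa : R, 0 < kappa /\ exists d : R, 0 < d /\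
    forall z w, enorm (z - z0) < d -> enorm (w - w0) < d ->
      (edist z [set z' | Psi z' w] <= kappa%:E * edist w (Psi z))%E.

Definition sv_lip_localization a b (S : V a -> set (V b)) (p0 : V a) (v0 : V b) :=
  exists (U : set (V a)) (W : set (V b)), nbhs p0 U /\ nbhs v0 W /\
    let loc p v := [/\ S p v, U p & W v] in
    (forall p v v', loc p v -> loc p v' -> v = v') /\
    exists kappa : R, 0 <= kappa /\
      forall p p' v v', loc p v -> loc p' v' -> enorm (v - v') <= kappa * enorm (p - p').

End VarAnalysis.

(* Main.v *)
(* Condition (iv) is the pivot. Put S = the subdifferential of g. Since S is maximal
   monotone, u |-> (P u, u - P u), with P the proximal resolvent of g, parametrizes gph S
   by R^m. At a point u where P is differentiable, with Jacobian B, the tangent cone of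
   gph S is the range of v |-> (v B, v - v B), and g has at (P u, u - P u) the second
   subderivative <v - v B, v B> at v B, because the Moreau envelope has the gradient
   u - P u. If (0, vs) is a strict derivative of S, then some difference quotients of P in
   directions close to vs are close to 0. By Rademacher's theorem there are points of
   differentiability of P where <vs, vs B> is small, and as B is firmly nonexpansive a
   limit of the Jacobians satisfies vs B = 0. It yields a subspace L in the SC derivative
   containing (0, vs) and a form in the quadratic bundle with vs as subgradient at 0:
   (i) and (ii) each imply (iv). For the converses, an element of L is a limit of tangent
   vectors, and epi-convergence of second difference quotients carries over to their
   proximal minimizers. Monotonicity of S on L makes (vs, 0) normal to L whenever (0, vs)
   lies in L, so (iii) implies (i).

   By compactness (iv) amounts to a Lipschitz estimate on pairs of points of gph S near
   (yb, ysb), and this estimate is (vi). It also gives (v): minimizing the perturbed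
   residual |P u - F x - w| + eps |(x, u) - (x0, u0)| over a small box, a nonzero residual
   at the minimizer would be a direction nearly annihilated by the transposed Jacobian of
   F and along which P hardly moves, contradicting the estimate. Finally (v) implies (iii),
   by testing regular normals of gph S on the solutions provided by metric regularity. *)
Require Import Defs.
From HB Require Import structures.
From mathcomp Require Import all_boot all_order all_algebra.
From mathcomp Require Import all_classical all_reals all_analysis measurable_realfun.
From mathcomp Require Import ring lra.
Import Order.TTheory GRing.Theory Num.Theory.
Import numFieldNormedType.Exports.
Local Open Scope classical_set_scope.
Local Open Scope ring_scope.
Set Implicit Arguments. Unset Strict Implicit. Unset Printing Implicit Defensive.

(** The obstacle is to reach points of differentiability. A strict derivative only says that the
    resolvent moves little over short segments, and a segment is a null set on which
    differentiability may fail everywhere. The segment is therefore thickened to a thin tube,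
    parametrized by the unit cube of R^(1+m) so that [vs] becomes a coordinate direction.
    Monotonicity of the resolvent makes its product with [vs] nondecreasing along that coordinate,
    Markov's inequality on each line bounds the part of the tube with too large a slope by one half,
    and Rademacher's theorem supplies a good point in the rest. Measure theory thus enters through
    two facts only: almost everywhere slopes of Lipschitz functions on the line, and a bound on
    measure by sections along one coordinate. Rademacher's theorem is built on them one coordinate
    at a time; the distance function of the set already handled serves as a Lipschitz function whose
    slope must vanish on that set. On the second-order side, the subgradient inequality of the
    Moreau envelope and Riemann sums replace twofold differentiation and also give the symmetry of
    the Jacobians. *)

Lemma mx_entry_le_norm (R : realType) m n (x : 'M[R]_(m, n)) i j : `|x i j| <= `|x|.
Proof.
rewrite [`|x|]mx_normrE.
by apply: (le_bigmax_cond _ (fun ij : 'I_m * 'I_n => `|x ij.1 ij.2|) (j := (i, j))).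
Qed.

Lemma mx_norm_le (R : realType) m n (x : 'M[R]_(m, n)) e :
  0 <= e -> (forall i j, `|x i j| <= e) -> `|x| <= e.
Proof.
move=> e0 H; rewrite [`|x|]mx_normrE; apply/bigmax_leP; split => // -[i j] _ /=.
Qed.

(** * Euclidean product, Euclidean norm and comparison with the max norm *)

Lemma dotE (R : realType) k (u v : 'rV[R]_k) : dot u v = \sum_i u 0 i * v 0 i.
Proof. by rewrite /dot mxE; apply: eq_bigr => i _; rewrite mxE. Qed.

Lemma dotC (R : realType) k (u v : 'rV[R]_k) : dot u v = dot v u.
Proof. by rewrite !dotE; apply: eq_bigr => i _; rewrite mulrC. Qed.

Lemma dotDl (R : realType) k (u v w : 'rV[R]_k) : dot (u + v) w = dot u w + dot v w.
Proof. by rewrite /dot mulmxDl mxE. Qed.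

Lemma dotDr (R : realType) k (u v w : 'rV[R]_k) : dot w (u + v) = dot w u + dot w v.
Proof. by rewrite dotC dotDl !(dotC _ w). Qed.

Lemma dotNl (R : realType) k (u w : 'rV[R]_k) : dot (- u) w = - dot u w.
Proof. by rewrite /dot mulNmx mxE. Qed.

Lemma dotNr (R : realType) k (u w : 'rV[R]_k) : dot w (- u) = - dot w u.
Proof. by rewrite dotC dotNl dotC. Qed.

Lemma dotBl (R : realType) k (u v w : 'rV[R]_k) : dot (u - v) w = dot u w - dot v w.
Proof. by rewrite dotDl dotNl. Qed.

Lemma dotBr (R : realType) k (u v w : 'rV[R]_k) : dot w (u - v) = dot w u - dot w v.
Proof. by rewrite dotDr dotNr. Qed.

Lemma dotZl (R : realType) k a (u w : 'rV[R]_k) : dot (a *: u) w = a * dot u w.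
Proof. by rewrite /dot -scalemxAl mxE. Qed.

Lemma dotZr (R : realType) k a (u w : 'rV[R]_k) : dot w (a *: u) = a * dot w u.
Proof. by rewrite dotC dotZl dotC. Qed.

Lemma dot0l (R : realType) k (w : 'rV[R]_k) : dot 0 w = 0.
Proof. by rewrite /dot mul0mx mxE. Qed.

Lemma dot0r (R : realType) k (w : 'rV[R]_k) : dot w 0 = 0.
Proof. by rewrite dotC dot0l. Qed.

Lemma dot_mulmx (R : realType) k l (u : 'rV[R]_k) (A : 'M[R]_(k, l)) (w : 'rV[R]_l) :
  dot (u *m A) w = dot u (w *m A^T).
Proof. by rewrite /dot trmx_mul trmxK mulmxA. Qed.

Lemma dot_row_mx (R : realType) k l (u u' : 'rV[R]_k) (w w' : 'rV[R]_l) :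
  dot (row_mx u w) (row_mx u' w') = dot u u' + dot w w'.
Proof. by rewrite /dot tr_row_mx mul_row_col mxE. Qed.

Definition dotD := (dotDl, dotDr, dotNl, dotNr, dotZl, dotZr).

Lemma dot_ge0 (R : realType) k (u : 'rV[R]_k) : 0 <= dot u u.
Proof. by rewrite dotE; apply: sumr_ge0 => i _; rewrite -expr2 sqr_ge0. Qed.

Lemma dot_eq0 (R : realType) k (u : 'rV[R]_k) : dot u u = 0 -> u = 0.
Proof.
rewrite dotE => /eqP; rewrite psumr_eq0 => [/allP H|i _]; last first.
  by rewrite -expr2 sqr_ge0.
apply/rowP => i; rewrite mxE; apply/eqP.
by have := H i (mem_index_enum _); rewrite -expr2 sqrf_eq0.
Qed.

Lemma enorm_ge0 (R : realType) k (u : 'rV[R]_k) : 0 <= enorm u.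
Proof. exact: sqrtr_ge0. Qed.

Lemma enorm_sqr (R : realType) k (u : 'rV[R]_k) : enorm u ^+ 2 = dot u u.
Proof. by rewrite sqr_sqrtr ?dot_ge0. Qed.

Lemma enorm0 (R : realType) k : enorm (0 : 'rV[R]_k) = 0.
Proof. by rewrite /enorm dot0l sqrtr0. Qed.

Lemma enorm_eq0 (R : realType) k (u : 'rV[R]_k) : enorm u = 0 -> u = 0.
Proof. by move=> u0; apply: dot_eq0; rewrite -enorm_sqr u0 expr0n. Qed.

Lemma enormN (R : realType) k (u : 'rV[R]_k) : enorm (- u) = enorm u.
Proof. by rewrite /enorm dotNl dotNr opprK. Qed.

Lemma enormZ (R : realType) k a (u : 'rV[R]_k) : enorm (a *: u) = `|a| * enorm u.
Proof.
by rewrite /enorm dotZl dotZr mulrA -expr2 sqrtrM ?sqr_ge0// sqrtr_sqr.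
Qed.

Lemma cauchy_schwarz (R : realType) k (u v : 'rV[R]_k) : dot u v <= enorm u * enorm v.
Proof.
have := enorm_ge0 u; rewrite le_eqVlt => /predU1P[u0|u0].
  by rewrite -u0 mul0r (enorm_eq0 (esym u0)) dot0l.
have := enorm_ge0 v; rewrite le_eqVlt => /predU1P[v0|v0].
  by rewrite -v0 mulr0 (enorm_eq0 (esym v0)) dot0r.
have := dot_ge0 (enorm v *: u - enorm u *: v).
rewrite dotBl !dotBr !dotZl !dotZr (dotC v u) -!enorm_sqr.
move: (enorm u) (enorm v) (dot u v) u0 v0 => a b c; clear => a0 b0 H.
have : 0 <= (a * b) * (a * b - c) by nra.
by rewrite pmulr_rge0 ?mulr_gt0// subr_ge0.
Qed.

Lemma enormD (R : realType) k (u v : 'rV[R]_k) : enorm (u + v) <= enorm u + enorm v.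
Proof.
rewrite -(@ler_pXn2r _ 2) ?nnegrE ?addr_ge0 ?enorm_ge0//.
rewrite enorm_sqr dotDl !dotDr (dotC v u) -!enorm_sqr.
have := cauchy_schwarz u v; move: (enorm u) (enorm v) (dot u v) => a b c; clear => H.
by nra.
Qed.

Lemma enormB (R : realType) k (u v : 'rV[R]_k) : enorm (u - v) = enorm (v - u).
Proof. by rewrite -enormN opprB. Qed.

Lemma norm_le_enorm (R : realType) k (u : 'rV[R]_k) : `|u| <= enorm u.
Proof.
apply: mx_norm_le (enorm_ge0 u) _ => i j.
rewrite -(@ler_pXn2r _ 2) ?nnegrE ?enorm_ge0// enorm_sqr dotE ord1 real_normK ?num_real//.
rewrite (bigD1 j)//= -expr2 lerDl; apply: sumr_ge0 => l _.
by rewrite -expr2 sqr_ge0.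
Qed.

Lemma enorm_le_norm (R : realType) k (u : 'rV[R]_k) : enorm u <= k%:R * `|u|.
Proof.
rewrite -(@ler_pXn2r _ 2) ?nnegrE ?enorm_ge0 ?mulr_ge0// enorm_sqr dotE.
have H i : u 0 i * u 0 i <= `|u| ^+ 2.
  by rewrite -expr2 -(real_normK (num_real _)) ler_pXn2r ?nnegrE// mx_entry_le_norm.
apply: (@le_trans _ _ (\sum_(i < k) `|u| ^+ 2)); first exact: ler_sum.
rewrite sumr_const card_ord -[leLHS]mulr_natl exprMn; apply: ler_wpM2r; first exact: sqr_ge0.
by rewrite -natrX ler_nat; case: (k) => // n; rewrite expnS leq_pmulr.
Qed.

Lemma norm_mulmx_le (R : realType) k l (u : 'rV[R]_k) (A : 'M[R]_(k, l)) :
  `|u *m A| <= k%:R * `|u| * `|A|.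
Proof.
apply: mx_norm_le => [|i j]; first by rewrite !mulr_ge0.
rewrite mxE; apply: le_trans (ler_norm_sum _ _ _) _.
apply: (@le_trans _ _ (\sum_(i < k) `|u| * `|A|)).
  by apply: ler_sum => s _; rewrite normrM ler_pM// mx_entry_le_norm.
by rewrite sumr_const card_ord -[leLHS]mulr_natl mulrA.
Qed.

Lemma norm_dot_le (R : realType) k (u v : 'rV[R]_k) :
  `|dot u v| <= k%:R * `|u| * `|v|.
Proof.
rewrite dotE; apply: le_trans (ler_norm_sum _ _ _) _.
apply: (@le_trans _ _ (\sum_(i < k) `|u| * `|v|)).
  by apply: ler_sum => s _; rewrite normrM ler_pM// mx_entry_le_norm.
by rewrite sumr_const card_ord -[leLHS]mulr_natl mulrA.
Qed.

Lemma near_norm (R : realType) (V : normedModType R) (x : V) (P : set V) :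
  nbhs x P <-> exists2 d : R, 0 < d & forall y, `|x - y| < d -> P y.
Proof.
split=> [/nbhs_ballP[d /= d0 H]|[d d0 H]].
  by exists d => // y xy; apply: H; rewrite -ball_normE.
by apply/nbhs_ballP; exists d => //= y; rewrite -ball_normE; exact: H.
Qed.

Lemma continuous_norm (R : realType) (V W : normedModType R) (f : V -> W) (x : V) :
  (forall e : R, 0 < e -> exists2 d : R, 0 < d &
     forall y, `|x - y| < d -> `|f x - f y| <= e) ->
  {for x, continuous f}.
Proof.
move=> H; apply/cvgrPdist_le => e e0.
by have [d d0 Hd] := H e e0; apply/near_norm; exists d.
Qed.

(** * Slopes of Lipschitz functions on the line *)

(** The Stieltjes measures of [G] and of [x - G x] add up to Lebesgue measure, so the first is
    dominated by it. The restriction to []-1, 2]] makes the measure finite and leaves room on both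
    sides of the unit interval. *)
Lemma monotone_lipschitz_measure (R : realType) (G : R -> R) :
  (forall x y, x <= y -> 0 <= G y - G x <= y - x) ->
  exists nu : {finite_measure set (measurableTypeR R) -> \bar R},
    nu `<< (@lebesgue_measure R) /\
    forall x y, -1 <= x -> x <= y -> y <= 2 -> nu `]x, y]%classic = (G y - G x)%:E.
Proof.
move=> HG.
have nd (H : R -> R) : (forall x y, x <= y -> 0 <= H y - H x <= y - x) ->
    {homo H : x y / x <= y}.
  by move=> HH x y xy; have := HH _ _ xy; lra.
have rc (H : R -> R) : (forall x y, x <= y -> 0 <= H y - H x <= y - x) ->
    right_continuous H.
  move=> HH; apply: right_continuousW => x.
  apply/cvgrPdist_le => e e0; near=> y.
  have : `|x - y| < e by near: y; apply: cvgr_dist_lt => //; exact: cvg_id.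
  have [xy|/ltW yx] := leP x y.
  - have := HH _ _ xy; rewrite ltr_norml ler_norml; lra.
  - have := HH _ _ yx; rewrite ltr_norml ler_norml; lra.
pose G2 x := x - G x.
have HG2 : forall x y, x <= y -> 0 <= G2 y - G2 x <= y - x.
  by move=> x y xy; have := HG _ _ xy; rewrite /G2; lra.
pose g : cumulative R R := HB.pack G (isCumulative.Build R _ R G (nd _ HG) (rc _ HG)).
pose g2 : cumulative R R := HB.pack G2 (isCumulative.Build R _ R G2 (nd _ HG2) (rc _ HG2)).
have lsE (h : cumulative R R) x y : x <= y ->
    lebesgue_stieltjes_measure h `]x, y]%classic = (h y - h x)%:E.
  move=> xy; rewrite /lebesgue_stieltjes_measure /= /measure_extension/=.
  by rewrite measurable_mu_extE/=; [rewrite wlength_itv_bnd|exact: is_ocitv].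
have ls0 (h : cumulative R R) : lebesgue_stieltjes_measure h set0 = 0%E.
  exact: measure0.
have le_lam A : measurable A ->
    (lebesgue_stieltjes_measure g A <= (@lebesgue_measure R) A)%E.
  move=> mA.
  rewrite (@lebesgue_measure_unique _ (measure_add
    (lebesgue_stieltjes_measure g) (lebesgue_stieltjes_measure g2))) //.
    by rewrite /measure_add/=/msum !big_ord_recl big_ord0/= adde0 leeDl.
  move=> _ [[x y] _ <-] /=.
  rewrite -[LHS]/(lebesgue_stieltjes_measure idfun `]x, y]%classic).
  rewrite [RHS]/(measure_add _ _ _)/=/msum !big_ord_recl big_ord0/= adde0.
  have [yx|xy] := ltP y x.
    by rewrite set_itv_ge ?bnd_simp -?leNgt ?ltW // !ls0 adde0.
  by rewrite !lsE// -EFinD; congr EFin; rewrite /= /G2; lra.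
have mD : @measurable _ (measurableTypeR R) `]-1, 2]%classic by exact: measurable_itv.
have foo : (lebesgue_stieltjes_measure g `](-1 : R)%R, (2 : R)%R]%classic < +oo)%E.
  by rewrite lsE ?ltry //; lra.
exists (mfrestr mD foo); split.
  move=> A nA B mB BA.
  rewrite /mfrestr /mrestr /=; apply/eqP; rewrite eq_le measure_ge0 andbT.
  apply: (@le_trans _ _ (lebesgue_stieltjes_measure g B)).
    by apply: le_measure; rewrite ?inE //; exact: measurableI.
  by rewrite (le_trans (le_lam _ mB)) // nA.
move=> x y x1 xy y2; rewrite -[LHS]/(lebesgue_stieltjes_measure g _).
have -> : `]x, y]%classic `&` `](-1), 2]%classic = `]x, y]%classic.
  by rewrite setIidl//; apply: subset_itv; rewrite bnd_simp.
by rewrite lsE.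
Unshelve. all: by end_near. Qed.

Definition has_slope (R : realType) (G : R -> R) (x c : R) :=
  forall e, 0 < e -> exists2 d, 0 < d &
    forall t, `|t| <= d -> `|G (x + t) - G x - t * c| <= e * `|t|.

Lemma derivable_has_slope (R : realType) (G : R -> R) (x c : R) :
  derivable G x 1 -> derive1 G x = c -> has_slope G x c.
Proof.
move=> dG dGc e e0.
have : (fun h => h^-1 *: (G (h *: 1 + x) - G x)) @ 0^' --> c.
  by rewrite -dGc derive1E; exact: dG.
move=> /cvgrPdist_le /(_ e e0) [d /= d0 H].
exists (d / 2); first by rewrite divr_gt0.
move=> t td; have [->|t0] := eqVneq t 0.
  by rewrite addr0 subrr mul0r subr0 normr0 mulr0.
have td2 : ball_ Num.norm 0 d t.
  by rewrite /ball_/= sub0r normrN; apply: le_lt_trans td _; rewrite ltr_pdivrMr// ltr_pMr ?ltr1n.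
have := H t td2 t0; rewrite /= [t *: 1]mulr1 => H'.
rewrite (addrC x).
have -> : G (t + x) - G x - t * c = - (t * (c - t^-1 *: (G (t + x) - G x))).
  by rewrite [_ *: _]mulrC; field.
by rewrite normrN normrM mulrC ler_wpM2r.
Qed.

(** The density comes from the Radon-Nikodym theorem, and Lebesgue differentiation of its primitive
    identifies it with the slope almost everywhere. *)
Lemma monotone_lipschitz_density (R : realType) (G : R -> R) :
  (forall x y, x <= y -> 0 <= G y - G x <= y - x) ->
  exists h : R -> R, [/\ (@lebesgue_measure R).-integrable setT (EFin \o h),
    (forall x, 0 <= h x),
    (forall x y, -1 <= x -> x <= y -> y <= 2 ->
      (\int[@lebesgue_measure R]_(t in `]x, y]%classic) (h t)%:E = (G y - G x)%:E)%E) &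
    {ae @lebesgue_measure R, forall x, 0 < x < 1 -> has_slope G x (h x)}].
Proof.
move=> HG.
have [nu [nuac nuE]] := monotone_lipschitz_measure HG.
have [f [f0 ffin fint fE]] := radon_nikodym_sigma_finite nuac.
pose h := fine \o f.
have hf : EFin \o h = f by apply/funext => x /=; rewrite fineK.
have hint : (@lebesgue_measure R).-integrable setT (EFin \o h) by rewrite hf.
have hE A : measurable A -> (\int[@lebesgue_measure R]_(t in A) (h t)%:E = nu A)%E.
  by move=> mA; rewrite fE//; apply: eq_integral => x _; rewrite /h/= fineK.
exists h; split => //.
- by move=> x; apply: fine_ge0.
- by move=> x y x1 xy y2; rewrite hE// nuE.
have hintA A : measurable A -> (@lebesgue_measure R).-integrable A (EFin \o h).
  by move=> mA; apply: (integrableS measurableT).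
have hloc : locally_integrable [set: R] h.
  split; [|exact: openT|].
    by apply/measurable_EFinP; exact: measurable_int hint.
  move=> K _ cK.
  have /integrableP[_ H] := hintA _ (compact_measurable cK).
  by apply: le_lt_trans H.
(* The fundamental theorem is applied to the primitive from minus infinity, which differs from [G]
   by a constant on [[-1, 2]] and so has the same slopes inside. *)
pose F (x : R) : R := (\int[@lebesgue_measure R]_(t in [set` `]-oo, x]]) (h t))%R.
have FE x : -1 <= x -> x <= 2 -> F x = F (-1) + G x - G (-1).
  move=> x1 x2.
  have E y : (F y)%:E = nu `]-oo, y]%classic.
    rewrite -hE// /F /Rintegral fineK//.
    have := hintA _ (measurable_itv `]-oo, y]).
    by move/integrable_fin_num; apply.
  suff : (F x)%:E = ((F (-1))%:E + (G x - G (-1))%:E)%E by case; lra.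
  rewrite !E -nuE// -measureU//.
  - congr (nu _); apply/seteqP; split => t /=; rewrite !in_itv/=; lra.
  - by apply/seteqP; split => t //=; rewrite !in_itv/=; lra.
have := FTC1Ny (fun y => hintA _ (measurable_itv `]-oo, y])) hloc.
apply: filterS; first exact: (ae_filter_ringOfSetsType (@lebesgue_measure R)).
move=> x [dF dFh] /andP[x0 x1].
move=> e e0; have [d d0 Hd] := derivable_has_slope dF dFh e0.
exists (Order.min d (Order.min x (1 - x))).
  by rewrite !lt_min d0 x0 subr_gt0.
move=> t; rewrite !le_min => /andP[td /andP[tx tx1]].
have := Hd t td; rewrite -/(F (x + t)) -/(F x).
move: tx tx1; rewrite !ler_norml => tx tx1.
have /and4P[A1 A2 A3 A4] : [&& -1 <= x, x <= 2, -1 <= x + t & x + t <= 2].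
  by clear -x0 x1 tx tx1; lra.
rewrite (FE _ A1 A2) (FE _ A3 A4).
set A := _ - _ - t * h x => HA.
have -> // : G (x + t) - G x - t * h x = A.
by rewrite /A; move: (F (-1)) (h x) => u v; clear; ring.
Qed.

(* Markov's inequality for the derivative, whose integral is the increment. *)
Lemma monotone_lipschitz_markov (R : realType) (G : R -> R) (e : R)
    (S : set (measurableTypeR R)) :
  (forall x y, x <= y -> 0 <= G y - G x <= y - x) -> 0 < e ->
  measurable S -> S `<=` `]0, 1[%classic ->
  (forall x, S x -> exists2 d, 0 < d & forall t, 0 <= t <= d ->
     e * t <= G (x + t) - G x) ->
  (lebesgue_measure S <= ((G 1 - G 0) / e)%:E)%E.
Proof.
move=> HG e0 mS S01 HS.
have [h [hint h0 hE hd]] := monotone_lipschitz_density HG.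
have mh A : measurable A -> measurable_fun A (EFin \o h).
  by move=> mA; apply: measurable_funS (measurable_int _ hint).
have H1 : (e%:E * lebesgue_measure S <= \int[@lebesgue_measure R]_(t in S) (h t)%:E)%E.
  rewrite -integral_cst//; apply: ae_ge0_le_integral => //.
  - by move=> x _; rewrite lee_fin ltW.
  - by move=> x _; rewrite lee_fin.
  - exact: mh.
  move: hd; apply: filterS; first exact: (ae_filter_ringOfSetsType (@lebesgue_measure R)).
  move=> x Hx Sx.
  have := S01 _ Sx; rewrite /= in_itv/= => /Hx hx.
  rewrite /= lee_fin; apply/ler_addgt0Pr => r r0.
  have [d d0 Hd] := HS _ Sx; have [d' d'0 Hd'] := hx _ r0.
  pose t := Order.min d d'.
  have t0 : 0 < t by rewrite lt_min d0 d'0.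
  have := Hd t; rewrite (ltW t0) ge_min lexx /= => /(_ isT).
  have := Hd' t; rewrite gtr0_norm// ge_min lexx orbT => /(_ isT).
  rewrite ler_norml => /andP[_ A] B.
  have : e * t <= (h x + r) * t by lra.
  by rewrite ler_pM2r.
have H2 : (\int[@lebesgue_measure R]_(t in S) (h t)%:E <= (G 1 - G 0)%:E)%E.
  rewrite -hE; [|lra..]; apply: ge0_subset_integral => //.
  - exact: mh.
  - by move=> x _; rewrite lee_fin.
  - by apply: subset_trans S01 _; apply: subset_itv; rewrite bnd_simp.
by rewrite EFinM lee_pdivlMr// muleC; exact: le_trans H1 H2.
Qed.

(** Averaging [x] with the rescaled function [f x / K] gives a nondecreasing 1-Lipschitz function,
    and its slopes determine those of [f]. *)
Lemma lipschitz_ae_slope (R : realType) (f : R -> R) (L : R) :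
  (forall x y, `|f x - f y| <= L * `|x - y|) ->
  {ae @lebesgue_measure R, forall x, 0 < x < 1 -> exists c, has_slope f x c}.
Proof.
move=> Lf.
pose K := `|L| + 1; have K0 : 0 < K by rewrite ltr_wpDl.
pose G x := (x + f x / K) / 2.
have HG x y : x <= y -> 0 <= G y - G x <= y - x.
  move=> xy; have H : `|f y - f x| <= K * (y - x).
    apply: le_trans (Lf y x) _; rewrite [`|y - x|]ger0_norm ?subr_ge0//.
    by rewrite ler_wpM2r ?subr_ge0// (le_trans (ler_norm L))// lerDl.
  have : `|(f y - f x) / K| <= y - x.
    by rewrite normrM normfV (gtr0_norm K0) ler_pdivrMr// mulrC.
  rewrite ler_norml /G; lra.
have [h [_ _ _]] := monotone_lipschitz_density HG.
apply: filterS; first exact: (ae_filter_ringOfSetsType (@lebesgue_measure R)).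
move=> x H x01; exists (K * (2 * h x - 1)) => e e0.
have e'0 : 0 < e / (2 * K) by rewrite divr_gt0// mulr_gt0.
have [d d0 Hd] := H x01 _ e'0.
exists d => // t td; have {Hd} := Hd t td; rewrite /G => Hd.
have -> : f (x + t) - f x - t * (K * (2 * h x - 1)) =
    (2 * K) * ((x + t + f (x + t) / K) / 2 - (x + f x / K) / 2 - t * h x).
  by field; rewrite gt_eqF.
rewrite normrM [`|2 * K|]gtr0_norm ?mulr_gt0//.
rewrite -ler_pdivlMl ?mulr_gt0//; apply: le_trans Hd _.
by rewrite le_eqVlt; apply/orP; left; apply/eqP; field; rewrite gt_eqF.
Qed.

(** * Rademacher's theorem *)

Definition borelV (R : realType) m := g_sigma_algebraType (@open 'rV[R]_m).

Definition upd (T : Type) m (x : 'rV[T]_m) (i : 'I_m) (s : T) : 'rV[T]_m :=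
  \row_j if j == i then s else x 0 j.

(** Measurability with respect to the Borel sets is checked on balls: the index set is countable,
    and the [if] empties the indices whose ball leaves [U]. *)
Lemma open_bigcup_rat_ball (R : realType) m (U : set 'rV[R]_m) : open U ->
  U = \bigcup_(p : 'rV[rat]_m * nat)
        (if `[< ball (map_mx ratr p.1 : 'rV[R]_m) p.2.+1%:R^-1 `<=` U >]
         then ball (map_mx ratr p.1 : 'rV[R]_m) p.2.+1%:R^-1 else set0).
Proof.
move=> oU; apply/seteqP; split => [x Ux|x [p _]]; last first.
  by case: ifP => // /asboolP; apply.
have /nbhs_ballP[e /= e0 He] : nbhs x U by apply: open_nbhs_nbhs.
have e20 : 0 < e / 2 by rewrite divr_gt0.
near \oo => k.
have ke : 2 * k.+1%:R^-1 < e.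
  rewrite -ltr_pdivlMl// mulrC.
  by near: k; exact: (near_infty_natSinv_lt (PosNum e20)).
have k0 : (0 : R) < k.+1%:R^-1 by rewrite invr_gt0.
have H j : exists q : rat, `|x 0 j - ratr q| < k.+1%:R^-1.
  have xk : x 0 j - k.+1%:R^-1 < x 0 j + k.+1%:R^-1 by rewrite ltrD2l gtrN.
  have [q] := rat_in_itvoo xk.
  rewrite in_itv/= => /andP[q1 q2]; exists q.
  rewrite distrC ltr_norml ltrBrDl q1 /=.
  by rewrite ltrBlDl.
have [q Hq] := choice H.
exists (\row_j q j, k) => //=.
have xb : ball (map_mx ratr (\row_j q j) : 'rV[R]_m) k.+1%:R^-1 x.
  by split=> // i j; rewrite !mxE ord1 /ball/= distrC.
rewrite ifT//; apply/asboolP => y yb; apply: He.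
apply: (@le_ball _ _ x (k.+1%:R^-1 + k.+1%:R^-1)).
  by rewrite -mulr2n -[_ *+ 2]mulr_natl; exact: ltW ke.
by apply: ball_triangle yb; exact: ball_sym.
Unshelve. all: by end_near. Qed.

(** A ball of the max norm is a product of balls, so its preimage is a measurable rectangle. *)
Lemma measurable_row_mx (R : realType) m :
  measurable_fun setT (fun z : borelV R m * measurableTypeR R =>
    (row_mx (z.2%:M : 'rV[R]_1) z.1 : borelV R (1 + m))).
Proof.
apply: (@measurability _ _ _ (borelV R (1 + m)) _ _
  (@open 'rV[R]_(1 + m) : set (set (borelV R (1 + m))))) => //.
move=> _ [U oU <-]; rewrite setTI (open_bigcup_rat_ball oU) preimage_bigcup.
apply: countable_bigcupT_measurable => // p.
case: ifP => _; last by rewrite preimage_set0.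
set c : 'rV[R]_(1 + m) := map_mx _ _; set e := _^-1.
have -> : (fun z : borelV R m * measurableTypeR R =>
    (row_mx (z.2%:M : 'rV[R]_1) z.1 : borelV R (1 + m))) @^-1` ball c e =
    (ball (rsubmx c) e : set (borelV R m)) `*` (ball (c 0 (lshift m ord0)) e : set R).
  have s11 (r : R) : (r%:M : 'rV[R]_1) 0 ord0 = r by rewrite mxE eqxx mulr1n.
  have e0 : 0 < e by rewrite invr_gt0.
  apply/seteqP; split => [[x s] /= [_ H]|[x s] /= [[_ H1] H2]].
    split; [split=> // i j|].
      by have := H 0 (rshift 1 j); rewrite row_mxEr ord1 [rsubmx c 0 j]mxE.
    by have := H 0 (lshift m ord0); rewrite row_mxEl s11.
  split=> // i j; rewrite ord1; case: (splitP j) => k jk.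
    have -> : j = lshift m k by apply: val_inj.
    by rewrite row_mxEl ord1 s11.
  have -> : j = rshift 1 k by apply: val_inj.
  by rewrite row_mxEr; have := H1 0 k; rewrite [rsubmx c 0 k]mxE.
apply: measurableX.
  by apply: sub_sigma_algebra; apply: ball_open; rewrite invr_gt0.
exact: measurable_ball.
Qed.

Lemma lebesgue_measure01 (R : realType) :
  (@lebesgue_measure R) `]0, 1[%classic = 1%E.
Proof. by rewrite lebesgue_measure_itv/= lte01 oppr0 adde0. Qed.

Definition unit_measure (R : realType) : set (measurableTypeR R) -> \bar R :=
  mrestr (@lebesgue_measure R) (measurable_itv `]0, 1[).
HB.instance Definition _ (R : realType) := Measure.on (@unit_measure R).

Lemma unit_measureE (R : realType) (A : set (measurableTypeR R)) :
  unit_measure A = @lebesgue_measure R (`]0%R, 1%R[%classic `&` A).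
Proof. by rewrite /unit_measure /mrestr setIC. Qed.

Lemma unit_measureT (R : realType) : @unit_measure R setT = 1%E.
Proof. by rewrite unit_measureE setIT lebesgue_measure01. Qed.

HB.instance Definition _ (R : realType) :=
  Measure_isProbability.Build _ _ _ (@unit_measure R) (unit_measureT R).

(* The only consequence of Fubini's theorem needed below: a bound on all the sections
   along one coordinate is a bound on the measure. *)
Definition tonelli_sections (R : realType) m (mu : probability (borelV R m) R) :=
  forall (A : set (borelV R m)) i (c : \bar R), measurable A ->
    (forall x, (@lebesgue_measure R (`]0%R, 1%R[%classic `&` [set s | A (upd x i s)]) <= c)%E) ->
    (mu A <= c)%E.

(** The uniform measure on the cube, built by pushing a product measure forward along concatenation
    of coordinates. In dimension 0 a Dirac mass serves, since there is no coordinate to test. *)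
Lemma cube_probability (R : realType) m :
  exists mu : probability (borelV R m) R, tonelli_sections mu.
Proof.
elim: m => [|m [mu Hmu]].
  by exists (dirac (0 : borelV R 0) : probability (borelV R 0) R) => A [].
pose PU : probability (measurableTypeR R) R := @unit_measure R.
pose phi (z : borelV R m * measurableTypeR R) : borelV R (1 + m) :=
  row_mx (z.2%:M : 'rV[R]_1) z.1.
have mphi : measurable_fun setT phi by exact: measurable_row_mx.
pose phiX : {mfun (borelV R m * measurableTypeR R)%type >-> borelV R (1 + m)} :=
  HB.pack phi (isMeasurableFun.Build _ _ _ _ phi mphi).
pose nu : probability (borelV R (1 + m)) R := distribution (mu \x PU)%E phiX.
exists nu => A i c mA Ac.
have mXA : measurable (phi @^-1` A).
  by have := mphi measurableT _ mA; rewrite setTI.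
have le_cst d (T : measurableType d) (P : probability T R) (f : T -> \bar R) :
    measurable_fun setT f -> (forall x, 0 <= f x)%E -> (forall x, f x <= c)%E ->
    (\int[P]_x f x <= c)%E.
  move=> mf f0 fc; have -> : c = (\int[P]_x c)%E.
    by rewrite integral_cst//= probability_setT mule1.
  apply: ge0_le_integral => //.
have updl (x : 'rV[R]_m) s r :
    upd (row_mx (s%:M : 'rV[R]_1) x) (lshift m ord0) r = row_mx (r%:M : 'rV[R]_1) x.
  apply/rowP => j; rewrite !mxE; case: (splitP j) => k jk.
    have -> : j = lshift m k by apply: val_inj.
    by rewrite ord1 eqxx mxE eqxx mulr1n.
  have -> : j = rshift 1 k by apply: val_inj.
  by rewrite eq_rlshift.
have updr (x : 'rV[R]_m) s k r :
    upd (row_mx (s%:M : 'rV[R]_1) x) (rshift 1 k) r = row_mx (s%:M : 'rV[R]_1) (upd x k r).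
  apply/rowP => j; rewrite !mxE; case: (splitP j) => l jl.
    have -> : j = lshift m l by apply: val_inj.
    by rewrite eq_lrshift.
  have -> : j = rshift 1 l by apply: val_inj.
  by rewrite eq_rshift mxE.
change (\int[mu]_x (PU \o xsection (phi @^-1` A)) x <= c)%E.
case: (@splitP 1 m i) => k ik.
  apply: le_cst => [|x|x] //.
    exact: measurable_fun_xsection.
  rewrite /= /PU unit_measureE; have := Ac (row_mx (0%:M : 'rV[R]_1) x).
  have -> : i = lshift m (ord0 : 'I_1) by apply: val_inj; rewrite /= ik ord1.
  congr (_ <= _)%E; congr (lebesgue_measure (_ `&` _)).
  by apply/seteqP; split => s; rewrite /xsection/= inE /phi/= updl.
(* For the new coordinate the product measure is already an integral of the required sections. For
   an old one the order of integration is swapped, so that the induction hypothesis applies with the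
   new coordinate frozen. *)
have -> : (\int[mu]_x (PU \o xsection (phi @^-1` A)) x =
          \int[PU]_x (mu \o ysection (phi @^-1` A)) x)%E.
  have := @indic_fubini_tonelli _ _ _ _ R mu PU (phi @^-1` A) mXA.
  by rewrite indic_fubini_tonelli_FE// indic_fubini_tonelli_GE.
apply: le_cst => [|s|s] //.
  exact: measurable_fun_ysection.
apply: (Hmu _ k); first exact: measurable_ysection.
move=> x; have := Ac (row_mx (s%:M : 'rV[R]_1) x).
have -> : i = rshift 1 k by apply: val_inj.
congr (_ <= _)%E; congr (lebesgue_measure (_ `&` _)).
by apply/seteqP; split => r; rewrite /ysection/= inE /phi/= updr.
Qed.

Lemma closed_borel (R : realType) m (A : set 'rV[R]_m) :
  closed A -> @measurable _ (borelV R m) A.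
Proof.
move=> cA; rewrite -(setCK A); apply: measurableC.
by apply: sub_sigma_algebra; exact: closed_openC.
Qed.

Lemma ae_mono d (T : measurableType d) (R : realType)
    (mu : {measure set T -> \bar R}) (P Q : T -> Prop) :
  (forall x, P x -> Q x) -> {ae mu, forall x, P x} -> {ae mu, forall x, Q x}.
Proof. by move=> PQ; apply: negligibleS; apply: subsetC => x; exact: PQ. Qed.

Lemma ae_and d (T : measurableType d) (R : realType)
    (mu : {measure set T -> \bar R}) (P Q : T -> Prop) :
  {ae mu, forall x, P x} -> {ae mu, forall x, Q x} -> {ae mu, forall x, P x /\ Q x}.
Proof.
move=> HP HQ; have := negligibleU HP HQ; apply: negligibleS.
by move=> x /= /not_andP.
Qed.

Lemma ae_forall_count d (T : measurableType d) (R : realType)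
    (mu : {measure set T -> \bar R}) (I : countType) (P : I -> T -> Prop) :
  (forall i, {ae mu, forall x, P i x}) -> {ae mu, forall x, forall i, P i x}.
Proof.
move=> H.
have : forall n : nat, {ae mu, forall x,
    if @unpickle I n is Some i then P i x else True}.
  by move=> n; case: unpickle => //; exact: aeW.
move=> /ae_foralln; apply: ae_mono.
by move=> x Hx i; have := Hx (pickle i); rewrite pickleK.
Qed.

Lemma closed_norm_le (R : realType) (T : topologicalType) (f : T -> R) (c : R) :
  continuous f -> closed [set x | `|f x| <= c].
Proof.
move=> cf.
apply: (@preimage_closed _ _ (fun x => `|f x|) [set y | y <= c]).
  by move=> x _; apply: continuous_comp; [exact: cf|exact: norm_continuous].
exact: closed_le.
Qed.

Lemma lipschitz_norm_continuous (R : realType) k (f : 'rV[R]_k -> R) (L : R) :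
  (forall x y, `|f x - f y| <= L * `|x - y|) -> continuous f.
Proof.
move=> Lf x; apply: continuous_norm => e e0.
have K0 : 0 < `|L| + 1 by rewrite ltr_wpDl.
exists ((`|L| + 1)^-1 * e) => [|y /ltW xy]; first by rewrite mulr_gt0// invr_gt0.
apply: le_trans (Lf x y) _.
apply: (@le_trans _ _ ((`|L| + 1) * `|x - y|)).
  by rewrite ler_wpM2r// (le_trans (ler_norm L))// lerDl.
by rewrite -ler_pdivlMl.
Qed.

Lemma continuous_shift (R : realType) k (f : 'rV[R]_k -> R) (h : 'rV[R]_k) :
  continuous f -> continuous (fun x : 'rV[R]_k => f (x + h)).
Proof.
move=> cf x; apply: (@continuous_comp _ _ _ (fun x : 'rV[R]_k => x + h) f); last exact: cf.
apply: continuous_norm => e e0; exists e => // y /ltW xy.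
by rewrite opprD addrACA subrr addr0.
Qed.

Lemma continuous_increment (R : realType) k (f : 'rV[R]_k -> R) (h : 'rV[R]_k) (c : R) :
  continuous f -> continuous (fun x : 'rV[R]_k => f (x + h) - f x - c).
Proof.
move=> cf x.
have -> : (fun x : 'rV[R]_k => f (x + h) - f x - c) = (fun x => f (x + h)) - f - cst c.
  exact/funext.
apply: continuousB; last exact: cst_continuous.
by apply: continuousB; [exact: continuous_shift|exact: cf].
Qed.

Lemma upd_add (R : realType) m (x : 'rV[R]_m) i s t :
  upd x i s + t *: delta_mx 0 i = upd x i (s + t).
Proof.
apply/rowP => j; rewrite !mxE eqxx /=; case: eqP => _.
  by rewrite mulr1.
by rewrite mulr0 addr0.
Qed.

Lemma norm_updB (R : realType) m (x : 'rV[R]_m) i s t :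
  `|upd x i s - upd x i t| <= `|s - t|.
Proof.
apply: mx_norm_le => // a j; rewrite !mxE; case: eqP => // _.
by rewrite subrr normr0.
Qed.

Lemma measurable_upd_section (R : realType) m (x : 'rV[R]_m) i (A : set (borelV R m)) :
  measurable A -> @measurable _ (measurableTypeR R) [set s | A (upd x i s)].
Proof.
suff H : measurable_fun setT (fun s : measurableTypeR R => (upd x i s : borelV R m)).
  by move=> mA; have := H measurableT _ mA; rewrite setTI.
apply: (@measurability _ _ _ (borelV R m) _ _
  (@open 'rV[R]_m : set (set (borelV R m)))) => //.
move=> _ [U oU <-]; rewrite setTI; apply: open_measurable.
move: oU; apply: open_comp => s _.
apply: continuous_norm => e e0; exists e => // t /ltW st.
exact: le_trans (norm_updB _ _ _ _) st.
Qed.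

(** With a rational slope and a reciprocal radius the good set is a countable union of closed sets,
    hence Borel; the section bound then reduces the claim to the theorem on the line. *)
Lemma ae_coord_slope (R : realType) m (mu : probability (borelV R m) R)
    (f : 'rV[R]_m -> R) (L : R) (i : 'I_m) (e : R) :
  tonelli_sections mu ->
  (forall x y, `|f x - f y| <= L * `|x - y|) -> 0 < e ->
  {ae mu, forall x, exists (q : rat) (n : nat), forall t, `|t| <= n.+1%:R^-1 ->
     `|f (x + t *: delta_mx 0 i) - f x - t * ratr q| <= e * `|t|}.
Proof.
move=> Hmu Lf e0.
have cf := lipschitz_norm_continuous Lf.
pose A (p : rat * nat) := \bigcap_(t in [set t : R | `|t| <= p.2.+1%:R^-1])
  [set x | `|f (x + t *: delta_mx 0 i) - f x - t * ratr p.1| <= e * `|t|].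
have mA p : @measurable _ (borelV R m) (A p).
  apply: closed_borel; apply: closed_bigI => t _.
  apply: closed_norm_le => x.
  exact: continuous_increment.
exists (~` \bigcup_p A p); split.
- by apply: measurableC; apply: countable_bigcupT_measurable.
- apply/eqP; rewrite eq_le measure_ge0 andbT; apply: (Hmu _ i).
    by apply: measurableC; apply: countable_bigcupT_measurable.
  move=> x; have H := @lipschitz_ae_slope R (fun s => f (upd x i s)) L.
  have {}H := H _; have : (forall s t : R, `|f (upd x i s) - f (upd x i t)| <= L * `|s - t|).
    move=> s t; apply: le_trans (Lf _ _) _.
    have [L0|L0] := leP 0 L; first by rewrite ler_wpM2l// norm_updB.
    have := Lf (upd x i s) (upd x i t) => H1.
    have := norm_updB x i s t => H2.
    have xx : `|upd x i s - upd x i t| = `|s - t|.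
      apply/eqP; rewrite eq_le H2 /=.
      by have := mx_entry_le_norm (upd x i s - upd x i t) 0 i; rewrite !mxE eqxx.
    by rewrite xx.
  move=> /H [N [mN N0 HN]].
  rewrite -N0; apply: le_measure; rewrite ?inE//.
    apply: measurableI; first exact: measurable_itv.
    apply: measurable_upd_section; apply: measurableC.
    exact: countable_bigcupT_measurable.
  move=> s /= [s01 Hs]; apply: HN => /= Hc.
  have [|c /(_ (e / 2))[|d d0 Hd]] := Hc.
  + by move: s01; rewrite in_itv.
  + by rewrite divr_gt0.
  have ce : c - e / 2 < c + e / 2 by clear -e0; lra.
  have [q] := rat_in_itvoo ce; rewrite in_itv/= => /andP[q1 q2].
  have cq : `|ratr q - c| <= e / 2.
    by rewrite ler_distl (ltW q1) (ltW q2).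
  near \oo => n.
  have nd : n.+1%:R^-1 < d by near: n; exact: (near_infty_natSinv_lt (PosNum d0)).
  apply: Hs; exists (q, n) => // t /= tn.
  have := Hd t (le_trans tn (ltW nd)); rewrite -upd_add => H1.
  have -> : f (upd x i s + t *: delta_mx 0 i) - f (upd x i s) - t * ratr q =
    (f (upd x i s + t *: delta_mx 0 i) - f (upd x i s) - t * c) - t * (ratr q - c).
    by rewrite mulrBr opprB addrA subrK.
  apply: le_trans (ler_normB _ _) _.
  rewrite [e]splitr mulrDl lerD// normrM mulrC ler_wpM2r//.
- move=> x /= Hx; apply: contra_not Hx => /= -[[q n] _ Hq].
  by exists q, n => t tn; exact: (Hq t tn).
Unshelve. all: by end_near. Qed.

Definition dist_set (R : realType) k (A : set 'rV[R]_k) (x : 'rV[R]_k) : R :=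
  inf [set `|x - a| | a in A].

Section DistSet.
Context (R : realType) (k : nat) (A : set 'rV[R]_k).

Lemma dist_set_le x a : A a -> dist_set A x <= `|x - a|.
Proof.
move=> Aa; apply: ge_inf; last by exists a.
by exists 0 => _ [b _ <-].
Qed.

Lemma dist_set_lt x r : A !=set0 -> dist_set A x < r -> exists2 a, A a & `|x - a| < r.
Proof.
move=> [a0 Aa0] H.
have [_ [a Aa <-] ar] := inf_lt (ex_intro _ _ (imageP (fun a => `|x - a|) Aa0)) H.
by exists a.
Qed.

Lemma dist_set_ge0 x : A !=set0 -> 0 <= dist_set A x.
Proof.
move=> A0; rewrite leNgt; apply/negP => /(dist_set_lt A0)[a _].
by rewrite ltNge normr_ge0.
Qed.

Lemma dist_set0 x : A x -> dist_set A x = 0.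
Proof.
move=> Ax; apply/eqP; rewrite eq_le dist_set_ge0 ?andbT; last by exists x.
by have := dist_set_le x Ax; rewrite subrr normr0.
Qed.

Lemma dist_set_lipschitz x y : A !=set0 -> `|dist_set A x - dist_set A y| <= 1 * `|x - y|.
Proof.
move=> A0; rewrite mul1r.
have H u v : dist_set A u - dist_set A v <= `|u - v|.
  rewrite lerBlDl; apply/ler_addgt0Pr => e e0.
  have [|a Aa va] := @dist_set_lt v (dist_set A v + e) A0; first by rewrite ltrDl.
  apply: le_trans (dist_set_le u Aa) _.
  rewrite (_ : u - a = (u - v) + (v - a)); last by rewrite addrA subrK.
  apply: le_trans (ler_normD _ _) _.
  by rewrite addrAC addrC lerD2l ltW.
by rewrite ler_norml H andbT lerNl opprB distrC H.
Qed.

End DistSet.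

(** Differentiability up to the error [e] along the first [j] coordinates. The gradient [q] is
    rational and the radius is indexed by [n], so that an almost everywhere statement can be made
    for all parameters at once. *)
Definition slope_on_span (R : realType) k (f : 'rV[R]_k -> R) (j : nat) (e : R)
    (q : 'rV[rat]_k) (n : nat) (x : 'rV[R]_k) :=
  forall h : 'rV[R]_k, `|h| <= n.+1%:R^-1 -> (forall l : 'I_k, (j <= l)%N -> h 0 l = 0) ->
    `|f (x + h) - f x - dot h (map_mx ratr q)| <= e * `|h|.

(* The point x + t e_j is within O(eta t) of the set where the span of the first
   j coordinates is already handled, since almost every point of that closed set
   is a point where the distance to it has vanishing slope. *)
Lemma slope_on_span_step (R : realType) k (f : 'rV[R]_k -> R) (L eta : R) (j : 'I_k)
    (q : 'rV[rat]_k) (r : rat) (n : nat) (d : R) (x : 'rV[R]_k) :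
  0 <= L -> 0 < eta -> (forall x y, `|f x - f y| <= L * `|x - y|) ->
  slope_on_span f j eta q n x ->
  (forall t, `|t| <= d -> dist_set (slope_on_span f j eta q n) (x + t *: delta_mx 0 j)
      <= 2 * eta * `|t|) ->
  (forall t, `|t| <= d ->
     `|f (x + t *: delta_mx 0 j) - f x - t * ratr r| <= eta * `|t|) ->
  forall h : 'rV[R]_k, `|h| <= n.+1%:R^-1 -> `|h| <= d ->
    (forall l : 'I_k, (j.+1 <= l)%N -> h 0 l = 0) ->
    `|f (x + h) - f x - dot h (map_mx ratr (upd q j r))| <= (6 * L + 2) * eta * `|h|.
Proof.
set A := slope_on_span f j eta q n => L0 e0 Lf Ax dA fr h hn hd hj.
set t := h 0 j; set y := x + t *: delta_mx 0 j; set h' := h - t *: delta_mx 0 j.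
have th : `|t| <= `|h| by exact: mx_entry_le_norm.
have td : `|t| <= d := le_trans th hd.
have h'E l : h' 0 l = if l == j then 0 else h 0 l.
  rewrite !mxE eqxx /=; case: eqP => [->|_]; first by rewrite mulr1n mulr1 subrr.
  by rewrite mulr0n mulr0 subr0.
have h'h : `|h'| <= `|h|.
  apply: mx_norm_le => // a l; rewrite ord1 h'E; case: ifP => _; first by rewrite normr0.
  exact: mx_entry_le_norm.
have h'j (l : 'I_k) : (j <= l)%N -> h' 0 l = 0.
  rewrite h'E leq_eqVlt => /predU1P[jl|/hj ->]; last by case: ifP.
  by rewrite ifT//; apply/eqP/val_inj.
have hE : x + h = y + h' by rewrite /y /h' addrA addrAC addrK.
have dotE' : dot h (map_mx ratr (upd q j r)) = dot h' (map_mx ratr q) + t * ratr r.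
  rewrite !dotE (bigD1 j)//= [in RHS](bigD1 j)//= h'E eqxx mul0r add0r !mxE eqxx addrC.
  by congr (_ + _); apply: eq_bigr => l /negPf lj; rewrite h'E !mxE lj.
(* The factor 3 exceeds the bound 2 on the distance strictly, so for [t != 0] a point of [A] is
   found within it; for [t = 0] the point [x] itself serves. *)
have [x' Ax' xy] : exists2 x', A x' & `|y - x'| <= 3 * eta * `|t|.
  have [t0|t0] := eqVneq t 0.
    by exists x => //; rewrite /y t0 scale0r addr0 subrr !normr0 mulr0.
  have [||a Aa ya] := @dist_set_lt _ _ A y (3 * eta * `|t|); [by exists x| |].
    apply: le_lt_trans (dA t td) _; rewrite ltr_pM2r ?normr_gt0// ltr_pM2r//.
    by rewrite ltr_nat.
  by exists a => //; exact: ltW.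
rewrite hE dotE'.
(* Exchanging [y] for [x'] costs [3 * eta * L] twice, and the slopes at [x'] and along the new
   coordinate cost [eta] each: this is the constant [6 * L + 2]. *)
have -> : f (y + h') - f x - (dot h' (map_mx ratr q) + t * ratr r) =
  (f (y + h') - f (x' + h')) + (f (x' + h') - f x' - dot h' (map_mx ratr q)) +
  (f x' - f y) + (f y - f x - t * ratr r) by clear; ring.
have H1 : `|f (y + h') - f (x' + h')| <= L * (3 * eta * `|t|).
  apply: le_trans (Lf _ _) _; rewrite ler_wpM2l//.
  by rewrite opprD addrACA subrr addr0.
have H2 := Ax' h' (le_trans h'h hn) h'j.
have H3 : `|f x' - f y| <= L * (3 * eta * `|t|).
  by apply: le_trans (Lf _ _) _; rewrite ler_wpM2l// distrC.
have H4 := fr t td.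
have HT : L * (eta * `|t|) <= L * (eta * `|h|) by rewrite ler_wpM2l// ler_wpM2l// ltW.
have HT' : eta * `|t| <= eta * `|h| by rewrite ler_wpM2l// ltW.
have HT'' : eta * `|h'| <= eta * `|h| by rewrite ler_wpM2l// ltW.
apply: le_trans (ler_normD _ _) _; apply: le_trans (lerD (ler_normD _ _) (lexx _)) _.
apply: le_trans (lerD (lerD (ler_normD _ _) (lexx _)) (lexx _)) _.
apply: le_trans (lerD (lerD (lerD H1 H2) H3) H4) _.
move: HT HT' HT''; move: `|t| `|h| `|h'| => a b c; clear => HT HT' HT''.
have -> : L * (3 * eta * a) + eta * c + L * (3 * eta * a) + eta * a =
  6 * (L * (eta * a)) + eta * c + eta * a by ring.
have -> : (6 * L + 2) * eta * b = 6 * (L * (eta * b)) + eta * b + eta * b by ring.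
by rewrite !lerD// ler_pM2l.
Qed.

(** Induction on the number of coordinates. The coordinate slope result is applied to [f] and to the
    distance functions of the countably many sets obtained at the previous stage, with the tolerance
    divided by the loss of one step. *)
Lemma ae_slope_on_span (R : realType) k (mu : probability (borelV R k) R)
    (f : 'rV[R]_k -> R) (L : R) (j : nat) :
  tonelli_sections mu -> 0 <= L -> (forall x y, `|f x - f y| <= L * `|x - y|) ->
  (j <= k)%N -> forall e, 0 < e ->
  {ae mu, forall x, exists (q : 'rV[rat]_k) n, slope_on_span f j e q n x}.
Proof.
move=> Hmu L0 Lf; elim: j => [_ e e0|j IH jk e e0].
  apply: aeW => x; exists 0, 0%N => h _ hj.
  have -> : h = 0 by apply/rowP => l; rewrite mxE hj.
  by rewrite addr0 subrr dot0l subr0 !normr0 mulr0.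
pose eta := e / (6 * L + 2).
have L62 : 0 < 6 * L + 2 by rewrite ltr_wpDl// mulr_ge0.
have eta0 : 0 < eta by rewrite divr_gt0.
pose j' := Ordinal jk.
have H1 := IH (ltnW jk) eta eta0.
have H2 := ae_coord_slope j' Hmu Lf eta0.
have H3 : {ae mu, forall x, forall p : 'rV[rat]_k * nat,
    slope_on_span f j eta p.1 p.2 !=set0 ->
    exists (q : rat) (n : nat), forall t, `|t| <= n.+1%:R^-1 ->
     `|dist_set (slope_on_span f j eta p.1 p.2) (x + t *: delta_mx 0 j') -
       dist_set (slope_on_span f j eta p.1 p.2) x - t * ratr q| <= eta * `|t|}.
  apply: ae_forall_count => p.
  have [->|/set0P A0] := eqVneq (slope_on_span f j eta p.1 p.2) set0.
    by apply: aeW => x -[].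
  apply: ae_mono (ae_coord_slope j' Hmu (fun x y => @dist_set_lipschitz R k _ x y A0) eta0).
  by move=> x.
apply: ae_mono (ae_and H1 (ae_and H2 H3)) => x [[q [n1 Hq]] [[r [n2 Hr]] Hd]].
have A0 : slope_on_span f j eta q n1 !=set0 by exists x.
have [s [n3 Hs]] := Hd (q, n1) A0.
exists (upd q j' r), (n1 + n2 + n3)%N => h hn hj.
have le_inv (a b : nat) : (a <= b)%N -> (b.+1%:R^-1 : R) <= a.+1%:R^-1.
  by move=> ab; rewrite lef_pV2 ?posrE// ler_nat.
pose d : R := (n2 + n3).+1%:R^-1.
have -> : e = (6 * L + 2) * eta by rewrite /eta mulrC divfK// gt_eqF.
apply: (@slope_on_span_step R k f L eta j' q r n1 d x) => //.
(* The distance vanishes at [x] and is nonnegative at both [x + t e_j] and [x - t e_j]. Its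
   approximate slope [s] is therefore at most [eta] in absolute value, and the distance at most
   [2 * eta * |t|]. *)
- move=> t td.
  have {Hs} Hs u : `|u| <= d -> `|dist_set (slope_on_span f j eta q n1) (x + u *: delta_mx 0 j') - u * ratr s| <= eta * `|u|.
    move=> ud; have := Hs u (le_trans ud (le_inv _ _ (leq_addl _ _))).
    by rewrite /= (dist_set0 Hq) subr0.
  have := Hs t td; have := Hs (- t); rewrite normrN => /(_ td).
  have := dist_set_ge0 (x + (- t) *: delta_mx 0 j') A0.
  move: (dist_set _ _) (dist_set _ _) (ratr s) `|t| => a b c T; clear.
  by rewrite !ler_norml => H1 H2 H3; lra.
- by move=> t td; apply: Hr; apply: le_trans td _; apply: le_inv; exact: leq_addr.
- by apply: le_trans hn _; apply: le_inv; rewrite -addnA leq_addr.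
- by apply: le_trans hn _; apply: le_inv; rewrite -addnA leq_addl.
Qed.

(* The approximate gradients are Cauchy; the gradient is the supremum of their
   lower bounds. *)
Lemma frechet_of_approx (R : realType) k (f : 'rV[R]_k -> R) x :
  (forall N : nat, exists (q : 'rV[rat]_k) n, slope_on_span f k N.+1%:R^-1 q n x) ->
  exists p : 'rV[R]_k, forall e, 0 < e -> exists2 d, 0 < d &
    forall h : 'rV[R]_k, `|h| <= d -> `|f (x + h) - f x - dot h p| <= e * `|h|.
Proof.
move=> /choice[q /choice[n H]].
pose E (N : nat) : R := N.+1%:R^-1.
pose Q N (l : 'I_k) : R := ratr (q N 0 l).
(* Both approximations are tested on one short vector along coordinate [l]: every lower bound lies
   below every upper bound, so their supremum is within [E N] of each [Q N l]. *)
have HQ N M l : Q N l - E N <= Q M l + E M.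
  pose d : R := Order.min (n N).+1%:R^-1 (n M).+1%:R^-1.
  have d0 : 0 < d by rewrite lt_min !invr_gt0 !ltr0n.
  have nh : `|d *: delta_mx 0 l : 'rV[R]_k| <= d.
    apply: mx_norm_le => [|a b]; first exact: ltW.
    rewrite !mxE normrM (gtr0_norm d0) ler_piMr ?(ltW d0)//.
    by case: (_ && _); rewrite ?normr1 ?normr0.
  have dotd N' : dot (d *: delta_mx 0 l) (map_mx ratr (q N')) = d * Q N' l.
    by rewrite dotZl /dot -rowE !mxE.
  have nh0 := normr_ge0 (d *: delta_mx 0 l : 'rV[R]_k).
  have := H N (d *: delta_mx 0 l) (le_trans nh _) _.
  have := H M (d *: delta_mx 0 l) (le_trans nh _) _.
  rewrite !ge_min !lexx orbT !dotd => /(_ isT) H1 /(_ isT) H2.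
  have {H1}H1 := H1 (fun l kl => False_ind _ ltac:(by have := ltn_ord l; rewrite ltnNge kl)).
  have {H2}H2 := H2 (fun l kl => False_ind _ ltac:(by have := ltn_ord l; rewrite ltnNge kl)).
  have {H1}H1 := le_trans H1 (ler_wpM2l _ nh).
  have {H2}H2 := le_trans H2 (ler_wpM2l _ nh).
  have EN N' : 0 <= E N' by rewrite invr_ge0.
  move: (H1 (EN M)) (H2 (EN N)); rewrite -/(E N) -/(E M) !ler_norml.
  move: (f _ - f x) (Q N l) (Q M l) (E N) (E M) d0 => a b c u v; clear => d0 K1 K2.
  have : d * (b - u) <= d * (c + v) by lra.
  by rewrite ler_pM2l.
pose p : 'rV[R]_k := \row_l sup (range (fun N => Q N l - E N)).
have pQ N l : `|p 0 l - Q N l| <= E N.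
  rewrite mxE ler_distl; apply/andP; split.
    apply: ub_le_sup; last by exists N.
    by exists (Q 0%N l + E 0%N) => _ [M _ <-]; exact: HQ.
  apply: ge_sup; first by exists (Q N l - E N), N.
  by move=> _ [M _ <-]; exact: HQ.
exists p => e e0.
have ek : 0 < e / (k.+1%:R + 1) by rewrite divr_gt0// ltr_wpDl.
near \oo => N.
have EN : E N <= e / (k.+1%:R + 1).
  by rewrite ltW//; near: N; exact: (near_infty_natSinv_lt (PosNum ek)).
exists (n N).+1%:R^-1; first by rewrite invr_gt0.
move=> h hn.
have -> : f (x + h) - f x - dot h p =
   (f (x + h) - f x - dot h (map_mx ratr (q N))) - dot h (p - map_mx ratr (q N)).
  by rewrite dotBr opprB addrA subrK.
apply: le_trans (ler_normB _ _) _.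
have H1 : `|f (x + h) - f x - dot h (map_mx ratr (q N))| <= E N * `|h|.
  by apply: H => // l; rewrite leqNgt ltn_ord.
have H2 : `|dot h (p - map_mx ratr (q N))| <= k%:R * `|h| * E N.
  apply: le_trans (norm_dot_le _ _) _; rewrite ler_wpM2l ?mulr_ge0//.
  apply: mx_norm_le => [|a l]; first by rewrite invr_ge0.
  by have := pQ N l; rewrite !mxE ord1.
apply: le_trans (lerD H1 H2) _.
rewrite mulrAC -mulrDl ler_wpM2r//.
have E0 : 0 <= E N by rewrite invr_ge0.
apply: (@le_trans _ _ ((k.+1%:R + 1) * E N)).
  rewrite -[leLHS]addrC -[X in _ + X <= _]mul1r -mulrDl ler_wpM2r// lerD2r.
  by rewrite ler_nat.
by rewrite mulrC -ler_pdivlMr// ltr_wpDl.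
Unshelve. all: by end_near. Qed.

Lemma rademacher (R : realType) k (mu : probability (borelV R k) R)
    (f : 'rV[R]_k -> R) (L : R) :
  tonelli_sections mu -> 0 <= L -> (forall x y, `|f x - f y| <= L * `|x - y|) ->
  {ae mu, forall x, exists p : 'rV[R]_k, forall e, 0 < e -> exists2 d, 0 < d &
    forall h : 'rV[R]_k, `|h| <= d -> `|f (x + h) - f x - dot h p| <= e * `|h|}.
Proof.
move=> Hmu L0 Lf.
have : {ae mu, forall x, forall N : nat,
    exists (q : 'rV[rat]_k) n, slope_on_span f k N.+1%:R^-1 q n x}.
  by apply: ae_forall_count => N; apply: (ae_slope_on_span Hmu L0 Lf); rewrite // invr_gt0.
by apply: ae_mono => x; exact: frechet_of_approx.
Qed.

(** * Differentiability points with a small directional derivative *)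

Definition frechet (R : realType) k l (P : 'rV[R]_k -> 'rV[R]_l) (u : 'rV[R]_k)
    (B : 'M[R]_(k, l)) :=
  forall e, 0 < e -> exists2 d, 0 < d &
    forall h : 'rV[R]_k, `|h| <= d -> `|P (u + h) - P u - h *m B| <= e * `|h|.

Lemma closed_ge_fun (R : realType) (T : topologicalType) (f : T -> R) (c : R) :
  continuous f -> closed [set x | c <= f x].
Proof.
move=> cf; apply: (@preimage_closed _ _ f [set y | c <= y]); last exact: closed_ge.
by move=> x _; exact: cf.
Qed.

Lemma uniform_radius (R : realType) (I : finType) (Q : I -> R -> Prop) :
  (forall i, exists2 d, 0 < d & forall x, x <= d -> Q i x) ->
  exists2 d, 0 < d & forall x, x <= d -> forall i, Q i x.
Proof.
move=> /(_ _)/cid2 H; pose D i := projT1 (H i).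
exists (\big[Order.min/1]_i D i).
  by apply: lt_bigmin => // i _; rewrite /D; case: (H i).
move=> x xd i.
have : x <= D i by apply: le_trans xd _; exact: bigmin_le_cond.
by rewrite /D; case: (H i) => /= d _; exact.
Qed.

Lemma ae_unit_cube (R : realType) k (mu : probability (borelV R k) R) :
  tonelli_sections mu -> {ae mu, forall x, `|x : 'rV[R]_k| <= 1}.
Proof.
move=> Hmu.
suff : {ae mu, forall x, forall i : 'I_k, `|(x : 'rV[R]_k) 0 i| <= 1}.
  by apply: ae_mono => x H; apply: mx_norm_le => // a b; rewrite ord1.
apply: ae_forall_count => i.
have cA : closed [set x : 'rV[R]_k | `|x 0 i| <= 1].
  by apply: closed_norm_le; exact: coord_continuous.
have mA : @measurable _ (borelV R k) (~` [set x : 'rV[R]_k | `|x 0 i| <= 1]).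
  by apply: measurableC; exact: closed_borel.
apply/negligibleP => //; apply/eqP; rewrite eq_le measure_ge0 andbT.
apply: (Hmu _ i) => // x.
rewrite (_ : _ `&` _ = set0) ?measure0//.
apply/seteqP; split=> // s [/=]; rewrite in_itv/= => /andP[s0 s1]; apply.
by rewrite mxE eqxx ger0_norm ltW.
Qed.

(** A mean value argument in measure: if [P] gains little along [vs] over a whole segment, then on
    each parallel segment nearby the set of large slopes is small, and full-measure
    differentiability meets its complement. *)
Lemma exists_differentiability_point (R : realType) m (P : 'rV[R]_m -> 'rV[R]_m) (L : R)
    (u0 vs : 'rV[R]_m) (r e : R) :
  0 <= L -> (forall x y, `|P x - P y| <= L * `|x - y|) ->
  (forall x y, 0 <= dot (P x - P y) (x - y)) -> 0 < r -> 0 < e ->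
  dot vs (P (u0 + r *: vs) - P u0) <= r * (e / 4) ->
  exists u B, [/\ `|u - u0| <= r * (1 + `|vs|), frechet P u B & dot vs (vs *m B) <= e].
Proof.
move=> L0 LP mono r0 e0 Hinc.
pose c := m%:R * `|vs| * L.
have c0 : 0 <= c by rewrite !mulr_ge0.
(* Relative width of the tube. A sideways shift by [r * eta] changes the increment along [vs] by at
   most [2 * c * eta * r <= r * (e / 4)]; together with the assumed [r * (e / 4)] this is half of
   [r * e]. *)
pose eta := Order.min 1 (e / (8 * c + 1)).
have c81 : 0 < 8 * c + 1 by rewrite ltr_wpDl// mulr_ge0.
have eta0 : 0 < eta by rewrite lt_min ltr01 divr_gt0.
have eta1 : eta <= 1 by rewrite ge_min lexx.
have etac : 2 * c * eta <= e / 4.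
  have : eta <= e / (8 * c + 1) by rewrite ge_min lexx orbT.
  rewrite ler_pdivlMr//; move: eta0; clear -c0 => h0 h1; nra.
(* Coordinate 0 of [z] runs along [vs] and the others fill a neighbourhood. The extra dimension is
   what makes [vs] a coordinate direction, the only kind that the section bound covers. *)
pose pt (z : 'rV[R]_(1 + m)) : 'rV[R]_m := u0 + r *: (eta *: rsubmx z + z 0 (lshift m ord0) *: vs).
have ptB z z' : `|pt z - pt z'| <= r * (1 + `|vs|) * `|z - z'|.
  have -> : pt z - pt z' = r *: (eta *: rsubmx (z - z') + (z - z') 0 (lshift m ord0) *: vs).
    rewrite /pt opprD addrACA subrr add0r -scalerBr opprD addrACA -scalerBr -scalerBl.
    congr (r *: (eta *: _ + _ *: vs)); last by rewrite !mxE.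
    by apply/rowP => l; rewrite !mxE.
  rewrite normrZ (gtr0_norm r0) -mulrA ler_wpM2l ?(ltW r0)//.
  apply: le_trans (ler_normD _ _) _; rewrite !normrZ mulrDl mul1r lerD//; last first.
    by rewrite mulrC ler_wpM2l// mx_entry_le_norm.
  rewrite (gtr0_norm eta0) -[leRHS]mul1r ler_pM// ?(ltW eta0)//.
  by apply: mx_norm_le => // a b; rewrite [(rsubmx _) _ _]mxE mx_entry_le_norm.
pose K := L * (r * (1 + `|vs|)).
have K0 : 0 <= K by rewrite !mulr_ge0// ?(ltW r0)// addr_ge0.
have LPpt z z' : `|P (pt z) - P (pt z')| <= K * `|z - z'|.
  by apply: le_trans (LP _ _) _; rewrite /K -mulrA ler_wpM2l.
have [mu Hmu] := cube_probability R (1 + m).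
pose phi z := dot vs (P (pt z)).
have phiL z z' : `|phi z - phi z'| <= m%:R * `|vs| * K * `|z - z'|.
  by rewrite /phi -dotBr; apply: le_trans (norm_dot_le _ _) _; rewrite -[leRHS]mulrA ler_wpM2l ?mulr_ge0.
have cphi : continuous phi := lipschitz_norm_continuous phiL.
pose i0 : 'I_(1 + m) := lshift m ord0.
pose E := delta_mx 0 i0 : 'rV[R]_(1 + m).
(* Points where the increment rate stays at least [e * r] at all small scales. Each such set is an
   intersection of closed conditions, so the bad set [C] is Borel. *)
pose Cn n := \bigcap_(t in [set t : R | 0 <= t <= n.+1%:R^-1])
   [set z : 'rV[R]_(1 + m) | e * r * t <= phi (z + t *: E) - phi z].
pose C := [set z : 'rV[R]_(1 + m) | `|z| <= 1] `&` \bigcup_n Cn n.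
have mC : @measurable _ (borelV R (1 + m)) C.
  apply: measurableI.
    apply: closed_borel.
    have -> : [set z : 'rV[R]_(1 + m) | `|z| <= 1] =
        [set z : 'rV[R]_(1 + m) | `|(`|z|)| <= 1].
      by apply/seteqP; split => z /=; rewrite normr_id.
    by apply: closed_norm_le; exact: norm_continuous.
  apply: bigcup_measurable => n _; apply: closed_borel.
  apply: closed_bigI => t _.
  have := @closed_ge_fun R _ _ (e * r * t) (continuous_increment (h := t *: E) (c := 0) cphi).
  by congr closed; apply/seteqP; split => z /=; rewrite subr0.
have muC : (mu C <= (2^-1)%:E)%E.
  apply: (Hmu _ i0) => // x.
  have [x1|x1] := leP `|rsubmx x| 1; last first.
    rewrite (_ : _ `&` _ = set0) ?measure0 ?lee_fin//.
    apply/seteqP; split=> // s [_] /= [s1 _]; move: x1; rewrite ltNge => /negP; apply.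
    apply: mx_norm_le => // a b; rewrite !mxE ord1.
    have := mx_entry_le_norm (upd x i0 s) 0 (rshift 1 b).
    by rewrite mxE eq_rlshift /=; move/le_trans; apply.
  pose w := u0 + r *: (eta *: rsubmx x).
  have ptu s : pt (upd x i0 s) = w + (r * s) *: vs.
    rewrite /pt /w mxE eqxx scalerDr addrA [r *: (s *: vs)]scalerA; congr (_ + r *: (eta *: _) + _).
    by apply/rowP => l; rewrite !mxE eq_rlshift.
  pose K1 := m%:R * `|vs| * K + 1.
  have K10' : 0 <= m%:R * `|vs| * K by rewrite mulr_ge0// mulr_ge0.
  have K10 : 0 < K1 by rewrite ltr_wpDl.
  pose G s := phi (upd x i0 s) / K1.
  have HG s t : s <= t -> 0 <= G t - G s <= t - s.
    move=> st; rewrite /G -mulrBl; apply/andP; split.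
      rewrite divr_ge0 ?(ltW K10)// /phi -dotBr !ptu dotC.
      have := mono (w + (r * t) *: vs) (w + (r * s) *: vs).
      rewrite opprD addrACA subrr add0r -scalerBl dotZr -mulrBr.
      move: st; rewrite le_eqVlt => /predU1P[->|st]; first by rewrite [P _ - P _]subrr dot0l.
      by rewrite pmulr_rge0// mulr_gt0// subr_gt0.
    rewrite ler_pdivrMr//; apply: le_trans (ler_norm _) _.
    apply: le_trans (phiL _ _) _; rewrite mulrC ler_pM//.
      by apply: le_trans (norm_updB _ _ _ _) _; rewrite ger0_norm// subr_ge0.
    by rewrite lerDl.
  have erK : 0 < e * r / K1 by rewrite divr_gt0// mulr_gt0.
  have mS : @measurable _ (measurableTypeR R) (`]0%R, 1%R[%classic `&` [set s | C (upd x i0 s)]).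
    by apply: measurableI; [exact: measurable_itv|exact: measurable_upd_section].
  apply: le_trans (@monotone_lipschitz_markov R G (e * r / K1) _ HG erK mS _ _) _.
  - by move=> s [].
  - move=> s [_ [_ [n _ Hn]]]; exists n.+1%:R^-1; first by rewrite invr_gt0.
    move=> t tn; have := Hn t tn; rewrite /= upd_add /G -mulrBl.
    by rewrite [e * r / K1 * t]mulrAC ler_pM2r ?invr_gt0.
  rewrite lee_fin /G -mulrBl ler_pdivrMr// [leRHS]mulrA  ler_pM2r ?invr_gt0//.
  rewrite /phi -dotBr !ptu mulr1 mulr0 scale0r addr0.
  have -> : P (w + r *: vs) - P w = (P (u0 + r *: vs) - P u0) +
     ((P (w + r *: vs) - P (u0 + r *: vs)) + (P u0 - P w)).
    by apply/rowP => l; rewrite !mxE; ring.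
  rewrite dotDr; apply: le_trans (lerD Hinc (ler_norm _)) _.
  have wu : `|w - u0| <= r * eta.
    rewrite /w addrAC subrr add0r !normrZ (gtr0_norm r0) (gtr0_norm eta0).
    by rewrite mulrA ler_piMr// mulr_ge0// ltW.
  have : `|dot vs ((P (w + r *: vs) - P (u0 + r *: vs)) + (P u0 - P w))| <= c * (2 * (r * eta)).
    apply: le_trans (norm_dot_le _ _) _; rewrite /c -[leRHS]mulrA ler_wpM2l ?mulr_ge0//.
    apply: le_trans (ler_normD _ _) _; apply: le_trans (lerD (LP _ _) (LP _ _)) _.
    rewrite -mulrDr ler_wpM2l// [`|u0 - w|]distrC opprD addrACA subrr addr0.
    by rewrite -mulr2n -[_ *+ 2]mulr_natl ler_wpM2l.
  move: etac r0; move: (`|dot _ _|) => b; clear => etac r0 Hb.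
  have -> : 2^-1 * (e * r) = r * (e / 4) + r * (e / 4) by field.
  apply: lerD => //; apply: le_trans Hb _.
  have -> : c * (2 * (r * eta)) = r * (2 * c * eta) by ring.
  by rewrite ler_pM2l.
have Hdiff : {ae mu, forall x, forall j : 'I_m, exists p : 'rV[R]_(1 + m), forall e, 0 < e -> exists2 d, 0 < d &
    forall h : 'rV[R]_(1 + m), `|h| <= d -> `|P (pt (x + h)) 0 j - P (pt x) 0 j - dot h p| <= e * `|h|}.
  apply: ae_forall_count => j; apply: (rademacher (L := K) Hmu K0) => x y.
  by apply: le_trans (LPpt x y); have := mx_entry_le_norm (P (pt x) - P (pt y)) 0 j; rewrite !mxE.
(* The bad set has measure at most one half, whereas almost every point lies in the cube and is a
   point of differentiability of all components. *)
have [z [[z1 zd] zC]] : exists z, (`|z : 'rV[R]_(1 + m)| <= 1 /\ (forall j : 'I_m, exists p : 'rV[R]_(1 + m), forall e, 0 < e -> exists2 d, 0 < d &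
    forall h : 'rV[R]_(1 + m), `|h| <= d -> `|P (pt (z + h)) 0 j - P (pt z) 0 j - dot h p| <= e * `|h|)) /\ ~ C z.
  have [N [mN N0 HN]] := ae_and (ae_unit_cube Hmu) Hdiff.
  apply: contrapT => Hno.
  have : (mu setT <= mu N + mu C)%E.
    apply: le_trans (measureU2 _ mN mC); apply: le_measure; rewrite ?inE//.
      exact: measurableU.
    move=> z _; have [Cz|nCz] := pselect (C z); first by right.
    by left; apply: HN => Hz; apply: Hno; exists z; split.
  rewrite probability_setT N0 add0e => /le_trans/(_ muC).
  by rewrite lee_fin leNgt invf_lt1// ltr1n.
have [p Hp] := choice zd.
(* A displacement [h] of [pt z] is realized by moving only the last [m] coordinates of [z], by
   [h / (r * eta)]; the Jacobian of [P] is read off there. *)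
pose B : 'M[R]_m := \matrix_(i, j) ((r * eta)^-1 * p j 0 (rshift 1 i)).
have re0 : 0 < r * eta by rewrite mulr_gt0.
have fB : frechet P (pt z) B.
  move=> e1 e10.
  have [j|d d0 Hd] := @uniform_radius R 'I_m (fun j x => forall h : 'rV[R]_(1 + m), `|h| = x ->
     `|P (pt (z + h)) 0 j - P (pt z) 0 j - dot h (p j)| <= (e1 * (r * eta)) * `|h|).
    have [|d d0 Hd] := Hp j (e1 * (r * eta)); first by rewrite mulr_gt0.
    by exists d => // x xd h hx; apply: Hd; rewrite hx.
  exists (d * (r * eta)) => [|h hd]; first by rewrite mulr_gt0.
  pose h' : 'rV[R]_(1 + m) := row_mx 0 ((r * eta)^-1 *: h).
  have nh' : `|h'| <= (r * eta)^-1 * `|h|.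
    apply: mx_norm_le => [|a b]; first by rewrite mulr_ge0// invr_ge0 ltW.
    rewrite mxE; case: splitP => l _; rewrite mxE ?normr0 ?mulr_ge0 ?invr_ge0 ?(ltW re0)//.
    by rewrite normrM normfV (gtr0_norm re0) ler_wpM2l ?invr_ge0 ?(ltW re0)// mx_entry_le_norm.
  have pth : pt (z + h') = pt z + h.
    have rE : rsubmx (z + h') = rsubmx z + (r * eta)^-1 *: h.
      by apply/rowP => l; rewrite [LHS]mxE [LHS]mxE row_mxEr !mxE.
    rewrite /pt rE [(z + h') 0 _]mxE row_mxEl [(0 : 'rV[R]_1) _ _]mxE addr0 !scalerDr.
    apply/rowP => l; rewrite !mxE.
    by field; rewrite !gt_eqF.
  apply: mx_norm_le => [|a j]; first by rewrite mulr_ge0// ltW.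
  rewrite ord1.
  have := Hd `|h'| _ j h' erefl; rewrite pth => {}Hd.
  have {Hd} := Hd _; have hd' : `|h'| <= d.
    by apply: le_trans nh' _; rewrite mulrC ler_pdivrMr.
  move=> /(_ hd') H.
  have -> : (P (pt z + h) - P (pt z) - h *m B) 0 j =
      P (pt z + h) 0 j - P (pt z) 0 j - dot h' (p j).
    rewrite !mxE; congr (_ - _ - _); rewrite dotE [RHS]big_split_ord /= [X in _ = X + _]big1 ?add0r; last first.
      by move=> l _; rewrite row_mxEl mxE mul0r.
    apply: eq_bigr => l _; rewrite row_mxEr !mxE; ring.
  apply: le_trans H _; rewrite -mulrA ler_pM2l// -ler_pdivlMl//.
exists (pt z), B; split => //.
- rewrite /pt addrAC subrr add0r normrZ (gtr0_norm r0) ler_wpM2l ?(ltW r0)//.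
  apply: le_trans (ler_normD _ _) _; rewrite !normrZ (gtr0_norm eta0) lerD//.
    rewrite -[leRHS]mulr1 ler_pM// ?(ltW eta0)//.
    apply: mx_norm_le => // a b; rewrite mxE ord1.
    exact: le_trans (mx_entry_le_norm _ _ _) z1.
  by rewrite ler_piMl//; apply: le_trans (mx_entry_le_norm _ _ _) z1.
apply/ler_addgt0Pr => e1 e10.
have e2 : 0 < e1 / (m%:R * `|vs| * `|vs| + 1).
  by rewrite divr_gt0// ltr_wpDl// !mulr_ge0.
have [d d0 Hd] := fB _ e2.
have rv : 0 < r * `|vs| + 1 by rewrite ltr_wpDl// mulr_ge0// ltW.
have dr : 0 < d / (r * `|vs| + 1) by rewrite divr_gt0.
near \oo => n.
have nd : n.+1%:R^-1 < d / (r * `|vs| + 1).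
  by near: n; exact: (near_infty_natSinv_lt (PosNum dr)).
(* Being outside [Cn n] gives an increment of rate below [e * r] at some scale [t] as small as
   wanted; the strict inequality excludes [t = 0]. *)
have [t [/andP[t0 tn] Ht]] : exists t : R, 0 <= t <= n.+1%:R^-1 /\ phi (z + t *: E) - phi z < e * r * t.
  apply: contrapT => Hno; apply: zC; split => //; exists n => // t tn /=.
  by rewrite leNgt; apply/negP => Hlt; apply: Hno; exists t.
have {}t0 : 0 < t.
  rewrite lt_neqAle t0 andbT eq_sym; apply/eqP => t0'.
  by move: Ht; rewrite t0' scale0r addr0 subrr mulr0 ltxx.
have ptt : pt (z + t *: E) = pt z + (r * t) *: vs.
  rewrite /pt -!addrA -!scalerA -!scalerDr -addrA -scalerDl; congr (_ + r *: (eta *: _ + _ *: _)).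
    by apply/rowP => l; rewrite !mxE eq_rlshift andbF mulr0 addr0.
  by rewrite !mxE !eqxx mulr1.
have Hh := Hd ((r * t) *: vs) _.
have {}Hh : `|P (pt z + (r * t) *: vs) - P (pt z) - ((r * t) *: vs) *m B| <=
    e1 / (m%:R * `|vs| * `|vs| + 1) * ((r * t) * `|vs|).
  rewrite -[r * t in leRHS]gtr0_norm ?mulr_gt0// -normrZ; apply: Hh.
  rewrite normrZ gtr0_norm ?mulr_gt0//.
  apply: (@le_trans _ _ (t * (r * `|vs| + 1))).
    by rewrite mulrDr mulr1 mulrA [t * r]mulrC lerDl ltW.
  by rewrite -ler_pdivlMr//; apply: le_trans tn (ltW nd).
have rt : 0 < r * t by rewrite mulr_gt0.
have : (r * t) * dot vs (vs *m B) <= (r * t) * (e + e1).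
  have -> : (r * t) * dot vs (vs *m B) = (phi (z + t *: E) - phi z) -
     dot vs (P (pt z + (r * t) *: vs) - P (pt z) - ((r * t) *: vs) *m B).
    by rewrite /phi ptt -scalemxAl !dotBr dotZr; ring.
  rewrite mulrDr; apply: lerD; first by rewrite mulrC mulrA ltW.
  apply: le_trans (ler_norm _) _; rewrite normrN; apply: le_trans (norm_dot_le _ _) _.
  have mv : 0 <= m%:R * `|vs| by rewrite mulr_ge0.
  apply: le_trans (ler_wpM2l mv Hh) _.
  have a0 : 0 <= m%:R * `|vs| * `|vs| by rewrite !mulr_ge0.
  set a := m%:R * `|vs| * `|vs| in a0 *.
  have -> : m%:R * `|vs| * (e1 / (a + 1) * (r * t * `|vs|)) = (r * t) * e1 * (a / (a + 1)).
    by rewrite /a; ring.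
  apply: ler_piMr; first by apply: mulr_ge0; exact: ltW.
  by rewrite ler_pdivrMr ?ltr_wpDl// mul1r lerDl.
by rewrite ler_pM2l.
Unshelve. all: by end_near. Qed.

(** * Limits of sequences *)

Lemma cvg_seqP (R : realType) (V : normedModType R) (x_ : nat -> V) (l : V) :
  x_ @ \oo --> l <-> forall e : R, 0 < e -> exists N, forall j, (N <= j)%N -> `|x_ j - l| < e.
Proof.
split=> [/cvgrPdist_lt H e e0|H].
  by have [N _ HN] := H e e0; exists N => j Nj; rewrite distrC; apply: HN.
apply/cvgrPdist_lt => e e0; have [N HN] := H e e0.
by exists N => // j Nj; rewrite distrC; apply: HN.
Qed.

Lemma cvg_seq_le (R : realType) (V : normedModType R) (x_ : nat -> V) (l : V)
    (r : nat -> R) (C : R) :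
  r @ \oo --> 0 -> (forall j, `|x_ j - l| <= C * r j) -> x_ @ \oo --> l.
Proof.
move=> /cvg_seqP r0 H; apply/cvg_seqP => e e0.
have K0 : 0 < `|C| + 1 by rewrite ltr_wpDl.
have [N HN] := r0 (e / (`|C| + 1)) (divr_gt0 e0 K0).
exists N => j /HN; rewrite subr0 => Hr.
apply: le_lt_trans (H j) _; apply: (@le_lt_trans _ _ ((`|C| + 1) * `|r j|)).
  by apply: le_trans (ler_norm _) _; rewrite normrM ler_wpM2r// lerDl.
by rewrite mulrC -ltr_pdivlMr.
Qed.

Lemma cvg_inv_nat (R : realType) : (fun j : nat => j.+1%:R^-1 : R) @ \oo --> 0.
Proof. exact: cvg_harmonic. Qed.

(** Index maps are only required to satisfy [j <= s j], not to increase: this already preserves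
    limits and is easy to obtain by choice. *)
Lemma cvg_subseq (R : realType) (V : normedModType R) (x_ : nat -> V) (l : V)
    (s : nat -> nat) :
  (forall j, (j <= s j)%N) -> x_ @ \oo --> l -> (x_ \o s) @ \oo --> l.
Proof.
move=> sj /cvg_seqP H; apply/cvg_seqP => e /H[N HN].
by exists N => j Nj; apply: HN; apply: leq_trans Nj (sj j).
Qed.

Lemma cvg_mxP (R : realType) m n (M_ : nat -> 'M[R]_(m, n)) (M : 'M[R]_(m, n)) :
  M_ @ \oo --> M <-> forall i j, (fun k => M_ k i j) @ \oo --> M i j.
Proof.
split=> [/cvg_seqP H i j|H].
  apply/cvg_seqP => e /H[N HN]; exists N => k Nk.
  by apply: le_lt_trans (HN k Nk); have := mx_entry_le_norm (M_ k - M) i j; rewrite !mxE.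
apply/cvg_seqP => e e0.
have e20 : 0 < e / 2 by rewrite divr_gt0.
have /choice[N HN] : forall p : 'I_m * 'I_n, exists N, forall k, (N <= k)%N ->
    `|M_ k p.1 p.2 - M p.1 p.2| < e / 2.
  by move=> p; have /cvg_seqP := H p.1 p.2; exact.
exists (\max_p N p) => k Nk.
apply: (@le_lt_trans _ _ (e / 2)); last by rewrite ltr_pdivrMr// ltr_pMr// ltr1n.
apply: mx_norm_le => [|i j]; first exact: ltW.
rewrite !mxE; apply/ltW/(HN (i, j)); apply: leq_trans Nk.
exact: leq_bigmax.
Qed.

Lemma cvg_sum_ord (R : realType) n (a_ : 'I_n -> nat -> R) (a : 'I_n -> R) :
  (forall i, a_ i @ \oo --> a i) ->
  (fun k => \sum_i a_ i k) @ \oo --> \sum_i a i.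
Proof.
move=> H; elim: n a_ a H => [|n IH] a_ a H.
  by rewrite big_ord0; under eq_fun do rewrite big_ord0; exact: cvg_cst.
rewrite big_ord_recl; under eq_fun do rewrite big_ord_recl.
by apply: cvgD; [exact: H|apply: IH => i; exact: H].
Qed.

Lemma cvg_mulmx (R : realType) m n p (A_ : nat -> 'M[R]_(m, n)) (B_ : nat -> 'M[R]_(n, p))
    (A : 'M[R]_(m, n)) (B : 'M[R]_(n, p)) : A_ @ \oo --> A -> B_ @ \oo --> B -> (fun k => A_ k *m B_ k) @ \oo --> A *m B.
Proof.
move=> /cvg_mxP HA /cvg_mxP HB; apply/cvg_mxP => i j.
rewrite mxE; under eq_fun do rewrite mxE.
by apply: cvg_sum_ord => l; apply: cvgM.
Qed.

Lemma cvg_trmx (R : realType) m n (A_ : nat -> 'M[R]_(m, n)) (A : 'M[R]_(m, n)) :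
  A_ @ \oo --> A -> (fun k => (A_ k)^T) @ \oo --> A^T.
Proof.
move=> /cvg_mxP H; apply/cvg_mxP => i j; rewrite mxE; under eq_fun do rewrite mxE.
exact: H.
Qed.

Lemma cvg_row_mx (R : realType) m n p (A_ : nat -> 'M[R]_(m, n)) (B_ : nat -> 'M[R]_(m, p))
    (A : 'M[R]_(m, n)) (B : 'M[R]_(m, p)) : A_ @ \oo --> A -> B_ @ \oo --> B -> (fun k => row_mx (A_ k) (B_ k)) @ \oo --> row_mx A B.
Proof.
move=> /cvg_mxP HA /cvg_mxP HB; apply/cvg_mxP => i j; rewrite -[j]splitK; case: (fintype.split j) => l /=.
  by rewrite row_mxEl; under eq_fun do rewrite row_mxEl; exact: HA.
by rewrite row_mxEr; under eq_fun do rewrite row_mxEr; exact: HB.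
Qed.

Lemma cvg_lsubmx (R : realType) m n p (A_ : nat -> 'M[R]_(m, n + p)) (A : 'M[R]_(m, n + p)) :
  A_ @ \oo --> A -> (fun k => lsubmx (A_ k)) @ \oo --> lsubmx A.
Proof.
move=> /cvg_mxP H; apply/cvg_mxP => i j; rewrite mxE; under eq_fun do rewrite mxE.
exact: H.
Qed.

Lemma cvg_rsubmx (R : realType) m n p (A_ : nat -> 'M[R]_(m, n + p)) (A : 'M[R]_(m, n + p)) :
  A_ @ \oo --> A -> (fun k => rsubmx (A_ k)) @ \oo --> rsubmx A.
Proof.
move=> /cvg_mxP H; apply/cvg_mxP => i j; rewrite mxE; under eq_fun do rewrite mxE.
exact: H.
Qed.

Lemma cvg_dot (R : realType) k (u_ v_ : nat -> 'rV[R]_k) (u v : 'rV[R]_k) :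
  u_ @ \oo --> u -> v_ @ \oo --> v -> (fun j => dot (u_ j) (v_ j)) @ \oo --> dot u v.
Proof.
by move=> Hu Hv; have /cvg_mxP := cvg_mulmx Hu (cvg_trmx Hv); exact.
Qed.

Lemma cvg_norm_seq (R : realType) (V : normedModType R) (x_ : nat -> V) (l : V) :
  x_ @ \oo --> l -> (fun j => `|x_ j|) @ \oo --> `|l|.
Proof. exact: cvg_norm. Qed.

Lemma cvg_seq_unique (R : realType) (V : normedModType R) (x_ : nat -> V) (a b : V) :
  x_ @ \oo --> a -> x_ @ \oo --> b -> a = b.
Proof. by move=> Ha Hb; apply: (cvg_unique _ Ha Hb). Qed.

Lemma cvg_seq_ler (R : realType) (a_ b_ : nat -> R) (a b : R) :
  a_ @ \oo --> a -> b_ @ \oo --> b -> (forall j, a_ j <= b_ j) -> a <= b.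
Proof.
move=> Ha Hb H; apply: (ler_cvg_to Ha Hb).
by exists 0%N => // j _; exact: H.
Qed.

Lemma bounded_rV_subseq (R : realType) n (x_ : nat -> 'rV[R]_n) (M : R) :
  (forall j, `|x_ j| <= M) ->
  exists (s : nat -> nat) (l : 'rV[R]_n), (forall j, (j <= s j)%N) /\ (x_ \o s) @ \oo --> l.
Proof.
move=> xM.
have cA : compact [set v : 'rV[R]_n | `|v| <= M].
  apply: bounded_closed_compact.
    exists M; split; first exact: num_real.
    by move=> r Mr v /= vM; apply: le_trans vM (ltW Mr).
  have -> : [set v : 'rV[R]_n | `|v| <= M] = [set v : 'rV[R]_n | `|(`|v|)| <= M].
    by apply/seteqP; split => z /=; rewrite normr_id.
  by apply: closed_norm_le; exact: norm_continuous.
have [|l [_ lcl]] := cA (x_ @ \oo) _; first by exists 0%N => // j _; exact: xM.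
have /choice[s Hs] : forall j : nat, exists i, (j <= i)%N /\ `|x_ i - l| < j.+1%:R^-1.
  move=> j.
  have F1 : (x_ @ \oo) [set x_ i | i in [set i | (j <= i)%N]].
    by exists j => // i ji; exists i.
  have F2 : nbhs l [set v | `|v - l| < j.+1%:R^-1].
    apply/near_norm; exists j.+1%:R^-1; first by rewrite invr_gt0.
    by move=> y; rewrite distrC.
  by have [_ [[i ji <-] Hi]] := lcl _ _ F1 F2; exists i.
exists s, l; split=> [j|]; first by have [] := Hs j.
apply: (cvg_seq_le (C := 1) (@cvg_inv_nat R)) => j.
by rewrite mul1r ltW//; have [] := Hs j.
Qed.

Lemma bounded_mx_subseq (R : realType) m n (x_ : nat -> 'M[R]_(m, n)) (M : R) :
  (forall j, `|x_ j| <= M) ->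
  exists (s : nat -> nat) (l : 'M[R]_(m, n)), (forall j, (j <= s j)%N) /\ (x_ \o s) @ \oo --> l.
Proof.
move=> xM; have [|s [l [sj /cvg_mxP H]]] := @bounded_rV_subseq R _ (mxvec \o x_) M.
  move=> j; apply: mx_norm_le => [|a b]; first exact: le_trans (normr_ge0 _) (xM j).
  rewrite /= ord1; case/mxvec_indexP: b => a' b; rewrite mxvecE.
  exact: le_trans (mx_entry_le_norm _ _ _) (xM j).
exists s, (vec_mx l); split => //; apply/cvg_mxP => i j.
have := H 0 (mxvec_index i j); rewrite mxE /=.
by under eq_fun do rewrite mxvecE.
Qed.

(** * The resolvent of a convex subdifferential *)

(** The three facts about [(I + S)^-1] on which the rest relies: it is defined everywhere,
    single-valued and firmly nonexpansive. The first two are Minty's parametrization of the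
    graph. *)
Definition resolvent (R : realType) m (S : 'rV[R]_m -> set 'rV[R]_m) (P : 'rV[R]_m -> 'rV[R]_m) :=
  [/\ forall u, S (P u) (u - P u), forall y ys, S y ys -> P (y + ys) = y &
      forall u v, dot (P u - P v) (P u - P v) <= dot (P u - P v) (u - v)].

Lemma csubdiff_monotone (R : realType) m (g : 'rV[R]_m -> \bar R) y ys y' ys' :
  csubdiff g y ys -> csubdiff g y' ys' -> 0 <= dot (y - y') (ys - ys').
Proof.
move=> [gy H] [gy' H']; have := H y'; have := H' y.
rewrite -(fineK gy) -(fineK gy') -!EFinD !lee_fin => h1 h2.
have -> : dot (y - y') (ys - ys') = - dot ys (y' - y) - dot ys' (y - y').
  rewrite dotC -[y' - y]opprB dotNr opprK !dotBl; ring.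
move: h1 h2; clear; lra.
Qed.

(** The known subgradient gives an affine minorant of [g], which makes the proximal objective
    coercive; lower semicontinuity does the rest. Competitors are restricted to finite values so
    that [fine] is faithful. *)
Lemma prox_minimizer (R : realType) (m : nat) (g : 'rV[R]_m -> \bar R) (yb ysb : 'rV[R]_m) u :
  lower_semicontinuous g -> econvex g -> (forall y, g y != -oo%E) -> csubdiff g yb ysb ->
  exists2 y, g y \is a fin_num &
  forall z, g z \is a fin_num ->
    fine (g y) + 2^-1 * dot (y - u) (y - u) <= fine (g z) + 2^-1 * dot (z - u) (z - u).
Proof.
move=> lsc cvx gNy Hb.
have fin y : g y != +oo%E -> g y \is a fin_num by move=> h; rewrite fin_numE gNy h.
pose Phi z := fine (g z) + 2^-1 * dot (z - u) (z - u).
have [gyb Hyb] := Hb.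
pose D := [set Phi z | z in [set z | g z \is a fin_num]].
have lowb z : g z \is a fin_num ->
    fine (g yb) + dot ysb (z - yb) + 2^-1 * dot (z - u) (z - u) <= Phi z.
  move=> gz; rewrite lerD2r; have := Hyb z.
  by rewrite -{1}(fineK gyb) -{1}(fineK gz) -EFinD lee_fin.
pose c := dot ysb (u - yb) + fine (g yb).
(* Expanding the square of [(z - u) / 2 + ysb] lets half of the quadratic term absorb the linear
   one; the remaining quarter bounds minimizing sequences. *)
have low z : g z \is a fin_num -> c - dot ysb ysb + 4^-1 * dot (z - u) (z - u) <= Phi z.
  move=> gz; apply: le_trans (lowb z gz).
  have := dot_ge0 (2^-1 *: (z - u) + ysb).
  have -> : z - yb = (z - u) + (u - yb) by rewrite addrA subrK.
  rewrite /c; move: (z - u) (u - yb) (fine _) => w v f.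
  rewrite !dotD (dotC ysb w); move: (dot w ysb) (dot w w) (dot ysb ysb) (dot ysb v).
  by clear => a b d e; lra.
have D0 : D !=set0 by exists (Phi yb), yb.
have Dlb : has_lbound D.
  exists (c - dot ysb ysb) => _ [z gz <-]; apply: le_trans (low z gz).
  by rewrite lerDl mulr_ge0 ?dot_ge0.
have Dinf : has_inf D by split.
have /choice[y_ Hy] : forall j : nat, exists z, g z \is a fin_num /\ Phi z < inf D + j.+1%:R^-1.
  move=> j; have j0 : (0 : R) < j.+1%:R^-1 by rewrite invr_gt0.
  by have [_ [z gz <-] Hz] := inf_adherent j0 Dinf; exists z.
have [s [l [sj Hl]]] : exists (s : nat -> nat) (l : 'rV[R]_m), (forall j, (j <= s j)%N) /\ (y_ \o s) @ \oo --> l.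
  pose M := 4 * (inf D + 1 - (c - dot ysb ysb)).
  apply: (@bounded_rV_subseq R m y_ (M + 1 + `|u|)) => j.
  have [gz Hz] := Hy j.
  have HM : dot (y_ j - u) (y_ j - u) <= M.
    have j1 : (j.+1%:R^-1 : R) <= 1 by rewrite invf_le1// ler1n.
    have := le_lt_trans (low _ gz) Hz; rewrite /M.
    move: (dot (y_ j - u) _) (dot ysb ysb) (inf D) (j.+1%:R^-1) j1.
    by clear => a b d e j1; lra.
  have : enorm (y_ j - u) <= M + 1.
    move: HM; rewrite -enorm_sqr; have := enorm_ge0 (y_ j - u).
    by move: (enorm _) M; clear => a M h0 h1; nra.
  move/(le_trans (norm_le_enorm _)) => H.
  by rewrite -[y_ j](subrK u); apply: le_trans (ler_normD _ _) _; rewrite lerD2r.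
have j0s : (fun j => (s j).+1%:R^-1 : R) @ \oo --> 0.
  exact: (cvg_subseq sj (@cvg_inv_nat R)).
have Hdot : (fun j => 2^-1 * dot (y_ (s j) - u) (y_ (s j) - u)) @ \oo --> 2^-1 * dot (l - u) (l - u).
  have H1 : (fun j => y_ (s j) - u) @ \oo --> l - u by apply: cvgB => //; exact: cvg_cst.
  by apply: cvgM; [exact: cvg_cst|exact: cvg_dot].
(* Lower semicontinuity tested by real numbers below [g l]: a large one shows that [g l] is finite,
   and those close to [g l] show minimality. *)
have lscl (a : R) : (a%:E < g l)%E -> a + 2^-1 * dot (l - u) (l - u) <= inf D.
  move=> /lsc[V Vl HV].
  have /near_norm[d d0 Hd] := Vl.
  move/cvg_seqP : (Hl) => /(_ d d0)[N HN].
  have Hlim : (fun j => inf D + (s j).+1%:R^-1) @ \oo --> inf D + 0.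
    by apply: cvgD => //; exact: cvg_cst.
  have Ha : (fun j => a + 2^-1 * dot (y_ (s j) - u) (y_ (s j) - u)) @ \oo --> a + 2^-1 * dot (l - u) (l - u).
    by apply: cvgD => //; exact: cvg_cst.
  rewrite -[inf D]addr0; apply: (ler_cvg_to Ha Hlim).
  exists N => // j Nj /=; have [gz Hz] := Hy (s j).
  apply: le_trans (ltW Hz); rewrite lerD2r.
  have : (a%:E < g (y_ (s j)))%E by apply: HV; apply: Hd; rewrite distrC; exact: HN.
  by rewrite -(fineK gz) lte_fin => /ltW.
have gl : g l \is a fin_num.
  apply: fin; apply/eqP => gl.
  have := lscl (inf D - 2^-1 * dot (l - u) (l - u) + 1).
  rewrite gl ltry => /(_ isT); clear; move: (inf D) (dot _ _) => a b; lra.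
exists l => // z gz.
apply: (@le_trans _ _ (inf D)); last by apply: ge_inf => //; exists z.
rewrite -lerBrDr; apply/ler_addgt0Pr => e e0.
have : ((fine (g l) - e)%:E < g l)%E by rewrite -{2}(fineK gl) lte_fin gtrBl.
by move=> /lscl; move: (fine _) (dot _ _) (inf D) => a b i; clear => H; lra.
Qed.

(** Compare the minimizer [y] with [t z + (1 - t) y]: by convexity the subgradient inequality holds
    up to an error of order [t]. *)
Lemma prox_subgradient (R : realType) (m : nat) (g : 'rV[R]_m -> \bar R) (yb ysb : 'rV[R]_m) u :
  lower_semicontinuous g -> econvex g -> (forall y, g y != -oo%E) -> csubdiff g yb ysb ->
  exists y, csubdiff g y (u - y).
Proof.
move=> lsc cvx gNy Hb.
have fin y : g y != +oo%E -> g y \is a fin_num by move=> h; rewrite fin_numE gNy h.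
have [y gy Hy] := prox_minimizer u lsc cvx gNy Hb; exists y; split => // z.
have [gz|] := eqVneq (g z) +oo%E; first by rewrite gz leey.
move=> /fin gz; rewrite -(fineK gy) -(fineK gz) -EFinD lee_fin.
set a := fine (g y); set b := fine (g z).
set d := dot (z - y) (z - y).
have d0 : 0 <= d := dot_ge0 _.
set p := dot (u - y) (z - y).
have key t : 0 < t < 1 -> t * (a + p - b) <= t * (2^-1 * t * d).
  move=> t01; pose zt := t *: z + (1 - t) *: y.
  have := cvx z y t t01; rewrite -/zt -(fineK gy) -(fineK gz) -!EFinM -EFinD -/a -/b => gzt.
  have gztf : g zt \is a fin_num.
    by apply: fin; apply/eqP => E; move: gzt; rewrite E.
  have := Hy zt gztf; move: gzt; rewrite -(fineK gztf) lee_fin -/a.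
  have -> : zt - u = (y - u) + t *: (z - y).
    by rewrite /zt scalerBl scale1r scalerBr; apply/rowP => i; rewrite !mxE; ring.
  rewrite /p /d -[u - y]opprB; move: (y - u) (z - y) (fine _) => v w q.
  rewrite !dotD (dotC w v); move: (dot v w) (dot v v) (dot w w) t01 => r r' r''.
  by rewrite [fine q%:E]/=; clear => t01 h1 h2; lra.
apply/ler_addgt0Pr => e e0.
pose t := Order.min 2^-1 (e / (d + 1)).
have d1 : 0 < d + 1 by rewrite ltr_wpDl.
have t0 : 0 < t by rewrite lt_min invr_gt0 ltr0n divr_gt0.
have t1 : t < 1 by rewrite gt_min invf_lt1// ltr1n.
have te : t * (d + 1) <= e by rewrite -ler_pdivlMr// ge_min lexx orbT.
have := key t; rewrite t0 t1 ler_pM2l// => /(_ isT).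
by move: t0 t1 te d0; clear => t0 t1 te d0 H; nra.
Qed.

Lemma prox_resolvent (R : realType) (m : nat) (g : 'rV[R]_m -> \bar R) (yb ysb : 'rV[R]_m) :
  lower_semicontinuous g -> econvex g -> (forall y, g y != -oo%E) -> csubdiff g yb ysb ->
  exists P, resolvent (csubdiff g) P.
Proof.
move=> lsc cvx gNy Hb.
have /choice[P HP] : forall u, exists y, csubdiff g y (u - y).
  by move=> u; exact: prox_subgradient lsc cvx gNy Hb.
exists P; split => //.
- move=> y ys Hy; have := csubdiff_monotone (HP (y + ys)) Hy.
  have -> : y + ys - P (y + ys) - ys = - (P (y + ys) - y).
    by apply/rowP => i; rewrite !mxE; ring.
  rewrite dotNr oppr_ge0 => H; apply/eqP; rewrite -subr_eq0; apply/eqP/dot_eq0/eqP.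
  by rewrite eq_le H dot_ge0.
- move=> u v; have := csubdiff_monotone (HP u) (HP v).
  have -> : u - P u - (v - P v) = (u - v) - (P u - P v).
    by apply/rowP => i; rewrite !mxE; ring.
  by rewrite dotBr subr_ge0.
Qed.

Lemma to0p_inv_nat (R : realType) : to0p (fun j : nat => j.+1%:R^-1 : R).
Proof. by split; [move=> k; rewrite invr_gt0|exact: cvg_inv_nat]. Qed.

Lemma cvg_const (R : realType) (V : normedModType R) (x : V) : (fun _ : nat => x) @ \oo --> x.
Proof. exact: cvg_cst. Qed.
Arguments cvg_const {R V} x.

Lemma cvg_mulr0 (R : realType) (c : R) (a_ : nat -> R) :
  a_ @ \oo --> 0 -> (fun j => c * a_ j) @ \oo --> 0.
Proof. by move=> H; rewrite -(mulr0 c); apply: cvgM => //; exact: cvg_cst. Qed.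

Lemma cvg_addr0 (R : realType) (a_ b_ : nat -> R) :
  a_ @ \oo --> 0 -> b_ @ \oo --> 0 -> (fun j => a_ j + b_ j) @ \oo --> 0.
Proof. by move=> Ha Hb; rewrite -[X in _ --> X](addr0 (0 : R)); exact: cvgD. Qed.

Lemma cvg_norm0 (R : realType) (V : normedModType R) (x_ : nat -> V) :
  x_ @ \oo --> 0 -> (fun j => `|x_ j|) @ \oo --> 0.
Proof. by move=> /cvg_norm_seq; rewrite normr0. Qed.

Lemma cvg_lin_mulmx (R : realType) m n (v_ : nat -> 'rV[R]_m) (v : 'rV[R]_m) (B : 'M[R]_(m, n)) :
  v_ @ \oo --> v -> (fun j => v_ j *m B) @ \oo --> v *m B.
Proof. by move=> Hv; apply: cvg_mulmx => //; exact: cvg_cst. Qed.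

Lemma cvg_sub0 (R : realType) (V : normedModType R) (x_ : nat -> V) (l : V) :
  (fun j => x_ j - l) @ \oo --> 0 <-> x_ @ \oo --> l.
Proof.
split=> /cvg_seqP H; apply/cvg_seqP => e /H[N HN]; exists N => j /HN.
  by rewrite subr0.
by rewrite subr0.
Qed.

Lemma cvg_bounded (R : realType) (V : normedModType R) (x_ : nat -> V) (l : V) :
  x_ @ \oo --> l -> exists2 N, 0 < N & exists K, forall j, (K <= j)%N -> `|x_ j| <= N.
Proof.
move=> /cvg_seqP /(_ 1 ltr01)[K HK]; exists (`|l| + 1); first by rewrite ltr_wpDl.
exists K => j /HK H; rewrite -(subrK l (x_ j)) addrC.
by apply: le_trans (ler_normD _ _) _; rewrite lerD2l ltW.
Qed.

Lemma frechet_cvg (R : realType) k l (P : 'rV[R]_k -> 'rV[R]_l) u B (t : nat -> R)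
    (v_ : nat -> 'rV[R]_k) (v : 'rV[R]_k) :
  frechet P u B -> to0p t -> v_ @ \oo --> v ->
  (fun j => (t j)^-1 *: (P (u + t j *: v_ j) - P u)) @ \oo --> v *m B.
Proof.
move=> HB [t0 Ht] Hv.
have HvB := cvg_lin_mulmx (B := B) Hv.
suff H : (fun j => (t j)^-1 *: (P (u + t j *: v_ j) - P u) - v_ j *m B) @ \oo --> (0 : 'rV[R]_l).
  have := cvgD H HvB; rewrite add0r.
  have -> : (fun j => (t j)^-1 *: (P (u + t j *: v_ j) - P u) - v_ j *m B) + (fun j => v_ j *m B) =
     (fun j => (t j)^-1 *: (P (u + t j *: v_ j) - P u)) by apply/funext => j; rewrite !fctE subrK.
  exact.
have [N N0 [K HK]] := cvg_bounded Hv.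
apply/cvg_seqP => e e0.
have eN : 0 < e / (N + N) by rewrite divr_gt0// addr_gt0.
have [d d0 Hd] := HB _ eN.
move/cvg_seqP : Ht => /(_ (d / N) (divr_gt0 d0 N0))[K' HK'].
exists (maxn K K') => j; rewrite geq_max => /andP[/HK vN /HK' td].
rewrite subr0 gtr0_norm// in td; rewrite subr0.
have tv : `|t j *: v_ j| <= d.
  rewrite normrZ gtr0_norm//; apply: (@le_trans _ _ (t j * N)); first by rewrite ler_wpM2l// ltW.
  by rewrite -ler_pdivlMr// ltW.
have -> : (t j)^-1 *: (P (u + t j *: v_ j) - P u) - v_ j *m B =
    (t j)^-1 *: (P (u + t j *: v_ j) - P u - (t j *: v_ j) *m B).
  by rewrite [in RHS]scalerBr -scalemxAl scalerA mulVf ?scale1r// gt_eqF.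
rewrite normrZ normfV (gtr0_norm (t0 j)) ltr_pdivrMl//.
apply: le_lt_trans (Hd _ tv) _; rewrite normrZ (gtr0_norm (t0 j)) mulrCA ltr_pM2l//.
apply: (@le_lt_trans _ _ (e / (N + N) * N)); first by rewrite ler_wpM2l// ltW.
by rewrite mulrAC ltr_pdivrMr ?addr_gt0// ltr_pM2l// ltrDl.
Qed.

Lemma resolvent_lipschitz (R : realType) m (S : 'rV[R]_m -> set 'rV[R]_m) P :
  resolvent S P -> forall u v, enorm (P u - P v) <= enorm (u - v).
Proof.
move=> [_ _ H] u v; have := le_trans (H u v) (cauchy_schwarz _ _).
rewrite -enorm_sqr; have := enorm_ge0 (P u - P v); have := enorm_ge0 (u - v).
by move: (enorm _) (enorm _) => a b; clear => a0 b0 H; nra.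
Qed.

Lemma resolvent_lipschitz_norm (R : realType) m (S : 'rV[R]_m -> set 'rV[R]_m) P :
  resolvent S P -> forall u v, `|P u - P v| <= m%:R * `|u - v|.
Proof.
move=> HP u v; apply: le_trans (norm_le_enorm _) _.
exact: le_trans (resolvent_lipschitz HP u v) (enorm_le_norm _).
Qed.

Lemma resolvent_cvg (R : realType) m (S : 'rV[R]_m -> set 'rV[R]_m) P (u_ : nat -> 'rV[R]_m) (u : 'rV[R]_m) :
  resolvent S P -> u_ @ \oo --> u -> (P \o u_) @ \oo --> P u.
Proof.
move=> HP /cvg_sub0 Hu; apply: (@cvg_seq_le R _ _ _ (fun j => `|u_ j - u|) m%:R).
  by have := cvg_norm_seq Hu; rewrite normr0.
by move=> j; exact: resolvent_lipschitz_norm HP _ _.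
Qed.

Lemma frechet_firm (R : realType) m (S : 'rV[R]_m -> set 'rV[R]_m) P u B :
  resolvent S P -> frechet P u B -> forall v, dot (v *m B) (v *m B) <= dot (v *m B) v.
Proof.
move=> [_ _ HP] HB v.
have Hp := frechet_cvg HB (@to0p_inv_nat R) (cvg_const v).
have := cvg_seq_ler (cvg_dot Hp Hp) (cvg_dot Hp (cvg_const v)); apply => j.
have j0 : (0 : R) < j.+1%:R by [].
rewrite !dotZl dotZr invrK ler_pM2l//.
have := HP (u + j.+1%:R^-1 *: v) u; rewrite [_ + _ - u]addrC addKr dotZr.
by rewrite -ler_pdivlMl ?invr_gt0.
Qed.

Lemma firm_contraction (R : realType) m (B : 'M[R]_m) :
  (forall v, dot (v *m B) (v *m B) <= dot (v *m B) v) -> forall v, enorm (v *m B) <= enorm v.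
Proof.
move=> H v; have := le_trans (H v) (cauchy_schwarz _ _).
rewrite -enorm_sqr; have := enorm_ge0 (v *m B); have := enorm_ge0 v.
by move: (enorm _) (enorm _) => a b; clear => a0 b0 H; nra.
Qed.

Lemma contraction_norm_le1 (R : realType) k l (B : 'M[R]_(k, l)) :
  (forall v, enorm (v *m B) <= enorm v) -> `|B| <= 1.
Proof.
move=> H; apply: mx_norm_le => // i j.
have -> : B i j = ((delta_mx 0 i : 'rV[R]_k) *m B) 0 j by rewrite -rowE mxE.
apply: le_trans (mx_entry_le_norm _ _ _) _; apply: le_trans (norm_le_enorm _) _.
apply: le_trans (H _) _.
by rewrite /enorm /dot trmx_delta mul_delta_mx mxE !eqxx sqrtr1.
Qed.

(** Adding the two halves of graph points and of difference quotients turns the strict derivative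
    into increments of [P] over steps [t j] in directions tending to [vs], and these increments are
    of smaller order than [t j]. *)
Lemma differentiability_sequence (R : realType) m (S : 'rV[R]_m -> set 'rV[R]_m) P y ys vs :
  resolvent S P -> S y ys -> strict_derivative S y ys 0 vs ->
  exists (u_ : nat -> 'rV[R]_m) (B_ : nat -> 'M[R]_m) (B : 'M[R]_m),
    [/\ u_ @ \oo --> y + ys, B_ @ \oo --> B, forall j, frechet P (u_ j) (B_ j) &
        vs *m B = 0].
Proof.
move=> HP Sy [z_ [t [w_ [Hz [zl [[t0 tl] [wl Hzw]]]]]]].
have [HP1 HP2 HP3] := HP.
pose u j := lsubmx (z_ j) + rsubmx (z_ j).
pose v j := lsubmx (w_ j) + rsubmx (w_ j).
have ul : u @ \oo --> y + ys.
  have := cvgD (cvg_lsubmx zl) (cvg_rsubmx zl); rewrite row_mxKl row_mxKr; exact.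
have lw0 : (fun j => lsubmx (w_ j)) @ \oo --> (0 : 'rV[R]_m).
  by have := cvg_lsubmx wl; rewrite row_mxKl.
have vl : v @ \oo --> vs.
  by have := cvgD (cvg_lsubmx wl) (cvg_rsubmx wl); rewrite row_mxKl row_mxKr add0r; exact.
have Pu j : P (u j) = lsubmx (z_ j) by exact/HP2/Hz.
have Puv j : P (u j + t j *: v j) = lsubmx (z_ j) + t j *: lsubmx (w_ j).
  have := HP2 _ _ (Hzw j); rewrite !linearD !linearZ /= => <-; congr P.
  by apply/rowP => i; rewrite /u /v !mxE; ring.
(* Two errors: replacing the direction [v j] by [vs], controlled by the Lipschitz constant, and the
   first half of the quotient, which tends to 0. *)
pose del j := m%:R * `|vs| * (m%:R * `|vs - v j| + `|lsubmx (w_ j)|).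
have Hdel j : dot vs (P (u j + t j *: vs) - P (u j)) <= t j * del j.
  apply: le_trans (ler_norm _) _; apply: le_trans (norm_dot_le _ _) _.
  rewrite /del mulrCA ler_wpM2l ?mulr_ge0//.
  have -> : P (u j + t j *: vs) - P (u j) =
     (P (u j + t j *: vs) - P (u j + t j *: v j)) + t j *: lsubmx (w_ j).
    by rewrite Puv Pu; apply/rowP => i; rewrite !mxE; ring.
  apply: le_trans (ler_normD _ _) _; rewrite mulrDr normrZ (gtr0_norm (t0 j)) lerD2r.
  apply: le_trans (resolvent_lipschitz_norm HP _ _) _.
  by rewrite opprD addrACA subrr add0r -scalerBr normrZ (gtr0_norm (t0 j)) mulrCA.
have dl : del @ \oo --> (0 : R).
  have H1 : (fun j => vs - v j) @ \oo --> (0 : 'rV[R]_m).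
    by rewrite -[X in _ --> X](subrr vs); apply: cvgB => //; exact: cvg_const.
  by apply: cvg_mulr0; apply: cvg_addr0; [apply: cvg_mulr0|]; exact: cvg_norm0.
(* The factor 4 matches the quarter in the hypothesis of [exists_differentiability_point]; the added
   term keeps the tolerance positive where [del j] vanishes. *)
pose e j := 4 * (del j + j.+1%:R^-1).
have del0 j : 0 <= del j by rewrite /del mulr_ge0// ?mulr_ge0// addr_ge0// mulr_ge0.
have e0 j : 0 < e j by rewrite /e mulr_gt0// ltr_wpDl// invr_gt0.
have el : e @ \oo --> (0 : R).
  by apply: cvg_mulr0; apply: cvg_addr0 => //; exact: cvg_inv_nat.
have /choice[u' /choice[B HB]] : forall j, exists u', exists B,
    [/\ `|u' - u j| <= t j * (1 + `|vs|), frechet P u' B & dot vs (vs *m B) <= e j].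
  move=> j; apply: (@exists_differentiability_point R m P m%:R) => //.
  - by move=> a b; exact: resolvent_lipschitz_norm HP a b.
  - by move=> a b; apply: le_trans (dot_ge0 _) (HP3 a b).
  apply: le_trans (Hdel j) _; rewrite ler_pM2l// /e mulrAC divff ?mul1r ?pnatr_eq0//.
  by rewrite lerDl invr_ge0.
have firm j : forall v, dot (v *m B j) (v *m B j) <= dot (v *m B j) v.
  by have [_ HBj _] := HB j; exact: frechet_firm HP HBj.
have [s [Bl [sj HBl]]] := bounded_mx_subseq (fun j => contraction_norm_le1 (firm_contraction (firm j))).
exists (u' \o s), (B \o s), Bl; split => //.
- apply: cvg_subseq => //; apply/cvg_sub0.
  have -> : (fun j => u' j - (y + ys)) = (fun j => (u' j - u j)) + (fun j => u j - (y + ys)).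
    by apply/funext => j; rewrite !fctE addrA subrK.
  rewrite -[X in _ --> X]addr0; apply: cvgD; last exact/cvg_sub0.
  apply: (@cvg_seq_le R _ _ _ t (1 + `|vs|)) => // j.
  by rewrite subr0 mulrC; have [] := HB j.
- by move=> j; have [_ HBj _] := HB (s j).
(* Firmness bounds the squared norm of [vs *m B j] by its product with [vs], hence by [e j]. *)
apply: dot_eq0; apply/eqP; rewrite eq_le dot_ge0 andbT.
have H := cvg_mulmx (cvg_const vs) HBl.
have := cvg_seq_ler (cvg_dot H H) (cvg_subseq sj el); apply => j /=.
by apply: le_trans (firm (s j) vs) _; rewrite dotC; have [] := HB (s j).
Qed.

Definition tangent_mx (R : realType) m (B : 'M[R]_m) : 'M[R]_(m, m + m) := row_mx B (1%:M - B).

Lemma tangent_mxE (R : realType) m (B : 'M[R]_m) (v : 'rV[R]_m) :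
  v *m tangent_mx B = row_mx (v *m B) (v - v *m B).
Proof. by rewrite /tangent_mx mul_mx_row mulmxBr mulmx1. Qed.

(** Adding the two halves recovers the parameter of a tangent vector. So the tangent space has
    dimension [m] whatever the rank of [B], and parameters converge with the tangent vectors. *)
Lemma tangent_mx_sum (R : realType) m (B : 'M[R]_m) :
  tangent_mx B *m col_mx 1%:M 1%:M = 1%:M :> 'M[R]_m.
Proof. by rewrite /tangent_mx mul_row_col !mulmx1 addrC subrK. Qed.

Lemma tangent_cone_frechet (R : realType) m (S : 'rV[R]_m -> set 'rV[R]_m) P u B w :
  resolvent S P -> frechet P u B ->
  tangent_cone (gph S) (row_mx (P u) (u - P u)) w <-> (w <= tangent_mx B)%MS.
Proof.
move=> [HP1 HP2 HP3] HB; split=> [[t [w_ [[t0 tl] [wl Hw]]]]|/submxP[v ->]].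
  pose v_ j := lsubmx (w_ j) + rsubmx (w_ j).
  have vl : v_ @ \oo --> lsubmx w + rsubmx w by exact: cvgD (cvg_lsubmx wl) (cvg_rsubmx wl).
  have H1 := frechet_cvg HB (conj t0 tl) vl.
  have E : (fun j => (t j)^-1 *: (P (u + t j *: v_ j) - P u)) = (fun j => lsubmx (w_ j)).
    apply/funext => j.
    have -> : P (u + t j *: v_ j) = P u + t j *: lsubmx (w_ j).
      have := HP2 _ _ (Hw j); rewrite !linearD !linearZ /= row_mxKl row_mxKr => <-.
      by congr P; apply/rowP => i; rewrite /v_ !mxE; ring.
    by rewrite addrC addKr scalerA mulVf ?scale1r// gt_eqF.
  rewrite E in H1; have H2 := cvg_seq_unique (cvg_lsubmx wl) H1.
  apply/submxP; exists (lsubmx w + rsubmx w); rewrite tangent_mxE -H2 addrC addKr.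
  by rewrite hsubmxK.
have t0 := @to0p_inv_nat R.
have Hp := frechet_cvg HB t0 (cvg_const v).
set p := (X in X @ \oo --> _) in Hp.
exists (fun j => j.+1%:R^-1), (fun j => row_mx (p j) (v - p j)); split => //; split.
  by rewrite tangent_mxE; apply: cvg_row_mx => //; apply: cvgB => //; exact: cvg_const.
move=> j; rewrite /gph /= scale_row_mx add_row_mx row_mxKl row_mxKr.
have -> : P u + j.+1%:R^-1 *: p j = P (u + j.+1%:R^-1 *: v).
  by rewrite /p scalerA mulfV ?scale1r ?invr_eq0 ?pnatr_eq0// addrC subrK.
have -> : u - P u + j.+1%:R^-1 *: (v - p j) = (u + j.+1%:R^-1 *: v) - P (u + j.+1%:R^-1 *: v).
  rewrite scalerBr /p scalerA mulfV ?scale1r ?invr_eq0 ?pnatr_eq0//.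
  by apply/rowP => i; rewrite !mxE; ring.
exact: HP1.
Qed.

(** * SC derivative, coderivative and strict derivative *)

(** A right inverse makes the rows independent, so the Gram matrix [A *m A^T] is invertible and the
    classical formula applies. *)
Lemma orth_proj_exists (R : realType) r k (A : 'M[R]_(r, k)) (C : 'M[R]_(k, r)) :
  A *m C = 1%:M -> exists Pr : 'M[R]_k, orth_proj [set z | (z <= A)%MS] Pr.
Proof.
move=> AC.
have AAu : A *m A^T \in unitmx.
  rewrite -row_free_unit -kermx_eq0; apply/rowV0P => v /sub_kermxP vAA.
  have vA : v *m A = 0.
    by apply: dot_eq0; rewrite dot_mulmx -mulmxA vAA dot0r.
  by rewrite -[v]mulmx1 -AC mulmxA vA mul0mx.
exists (A^T *m invmx (A *m A^T) *m A); split; last split.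
- by rewrite !trmx_mul trmx_inv trmx_mul trmxK mulmxA.
- rewrite -!mulmxA; congr (_ *m (_ *m _)).
  by rewrite (mulmxA A) (mulmxA _ _ A) mulmxV// mul1mx.
- move=> z; split=> [/submxP[v ->]|<-]; last by rewrite /= mulmxA submxMl.
  by rewrite -!mulmxA (mulmxA A) (mulmxA _ _ A) mulmxV// mul1mx.
Qed.

Lemma orth_proj_firm (R : realType) k (L : set 'rV[R]_k) (Pr : 'M[R]_k) :
  orth_proj L Pr -> forall v, dot (v *m Pr) (v *m Pr) <= dot (v *m Pr) v.
Proof. by move=> [sP [PP _]] v; rewrite [leRHS]dotC dot_mulmx sP -mulmxA PP dotC. Qed.

Lemma orth_projP (R : realType) k (L : set 'rV[R]_k) (Pr : 'M[R]_k) z :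
  orth_proj L Pr -> L (z *m Pr).
Proof. by move=> [_ [PP H]]; apply/H; rewrite -mulmxA PP. Qed.

Lemma tangent_mx_subspace (R : realType) m (B : 'M[R]_m) (L : set 'rV[R]_(m + m)) :
  (forall z, L z <-> (z <= tangent_mx B)%MS) -> is_subspace_dim L m.
Proof.
move=> HL; exists <<tangent_mx B>>%MS; split.
  rewrite mxrank_gen; apply/eqP; rewrite -[_ == _]/(row_free _).
  by apply/row_freeP; exists (col_mx 1%:M 1%:M); exact: tangent_mx_sum.
by move=> z; rewrite genmxE; exact: HL.
Qed.

(** The limit subspace is the row space attached to the limit Jacobian. Since [vs] is annihilated by
    it, the parameter [vs] gives the vector [(0, vs)]. *)
Lemma SC_of_strict_derivative (R : realType) m (S : 'rV[R]_m -> set 'rV[R]_m) P y ys vs :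
  resolvent S P -> S y ys -> strict_derivative S y ys 0 vs ->
  exists2 L, SC_derivative S y ys L & L (row_mx 0 vs).
Proof.
move=> HP Sy Hvs; have [HP1 HP2 _] := HP.
have [u [B [Bl [ul Bll fB vB]]]] := differentiability_sequence HP Sy Hvs.
have /choice[Pr HPr] : forall j, exists Pr : 'M[R]_(m + m),
    orth_proj [set z | (z <= tangent_mx (B j))%MS] Pr.
  by move=> j; apply: orth_proj_exists (tangent_mx_sum (B j)).
have [s [Q [sj HQ]]] := bounded_mx_subseq
  (fun j => contraction_norm_le1 (firm_contraction (orth_proj_firm (HPr j)))).
exists [set z | (z <= tangent_mx Bl)%MS]; last first.
  by apply/submxP; exists vs; rewrite tangent_mxE vB subr0.
split; first exact: (@tangent_mx_subspace _ _ Bl).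
exists (P \o u \o s), (fun j => u (s j) - P (u (s j))), (Pr \o s), Q.
have usl : (u \o s) @ \oo --> y + ys by exact: cvg_subseq.
have Pusl : (P \o u \o s) @ \oo --> y.
  by have := resolvent_cvg HP usl; rewrite (HP2 _ _ Sy).
have Tj j z : tangent_cone (gph S) (row_mx (P (u (s j))) (u (s j) - P (u (s j)))) z <->
    (z <= tangent_mx (B (s j)))%MS := tangent_cone_frechet z HP (fB (s j)).
split; first by move=> j; exact: HP1.
split => //; split.
  by rewrite -[ys](addKr y) addrC; apply: cvgB.
split.
  move=> j; split; first by apply: (@tangent_mx_subspace _ _ (B (s j))) => z; exact: Tj.
  have [sP [PP HPz]] := HPr (s j); split => //; split => // z.
  by rewrite Tj; exact: HPz.
split => //.
have BLl : (fun j => tangent_mx (B (s j))) @ \oo --> tangent_mx Bl.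
  apply: cvg_row_mx; first exact: cvg_subseq.
  by apply: cvgB; [exact: cvg_const|exact: cvg_subseq].
split; last split.
- apply: cvg_seq_unique (cvg_trmx HQ) _.
  have -> : (fun k => ((Pr \o s) k)^T) = Pr \o s by apply/funext => j /=; have [] := HPr (s j).
  exact: HQ.
- apply: cvg_seq_unique (cvg_mulmx HQ HQ) _.
  have -> : (fun k => (Pr \o s) k *m (Pr \o s) k) = Pr \o s.
    by apply/funext => j /=; have [_ []] := HPr (s j).
  exact: HQ.
move=> z; split=> [/submxP[v ->]|zQ].
  apply: cvg_seq_unique (cvg_mulmx (cvg_mulmx (cvg_const v) BLl) HQ) _.
  have -> : (fun k => v *m tangent_mx (B (s k)) *m (Pr \o s) k) = (fun k => v *m tangent_mx (B (s k))).
    by apply/funext => j /=; have [_ [_ H]] := HPr (s j); apply/H/submxMl.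
  by apply: cvg_mulmx => //; exact: cvg_const.
(* Parameters of the projections of [z]. They converge, which keeps the range of the limit projector
   inside the row space of [tangent_mx Bl]. *)
pose v_ j := z *m Pr (s j) *m col_mx 1%:M 1%:M : 'rV[R]_m.
have vl : v_ @ \oo --> z *m col_mx 1%:M 1%:M.
  rewrite -{1}zQ; apply: cvg_mulmx; last exact: cvg_const.
  by apply: cvg_mulmx => //; exact: cvg_const.
have H1 := cvg_mulmx vl BLl; have H2 := cvg_mulmx (cvg_const z) HQ.
have E : (fun k => v_ k *m tangent_mx (B (s k))) = (fun k => z *m (Pr \o s) k).
  apply/funext => j; have /submxP[w Hw] := orth_projP z (HPr (s j)).
  by rewrite /v_ /= Hw -(mulmxA w) tangent_mx_sum mulmx1.
rewrite E in H1; apply/submxP; exists (z *m col_mx 1%:M 1%:M).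
by rewrite (cvg_seq_unique H1 H2).
Qed.

(** Compactness of the unit ball: normalized secants violating the normal inequality accumulate at a
    tangent vector whose product with [v] is at least [e]. *)
Lemma regular_normal_of_polar (R : realType) k (C : set 'rV[R]_k) (z v : 'rV[R]_k) :
  (forall w, tangent_cone C z w -> dot v w <= 0) -> regular_normal_cone C z v.
Proof.
move=> Hv e e0; apply: contrapT => Hno.
have /choice[z' Hz'] : forall j : nat, exists z', [/\ C z', enorm (z' - z) < j.+1%:R^-1 &
    e * enorm (z' - z) < dot v (z' - z)].
  move=> j; apply: contrapT => Hj; apply: Hno; exists j.+1%:R^-1.
  split=> [|z' Cz' zz']; first by rewrite invr_gt0.
  by rewrite leNgt; apply/negP => H; apply: Hj; exists z'.
pose t j := enorm (z' j - z).
have t0 j : 0 < t j.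
  rewrite lt_neqAle enorm_ge0 andbT eq_sym; apply/eqP => H.
  by have [_ _] := Hz' j; rewrite -/(t j) H (enorm_eq0 H) dot0r mulr0 ltxx.
pose w j := (t j)^-1 *: (z' j - z).
have w1 j : `|w j| <= 1.
  apply: le_trans (norm_le_enorm _) _.
  by rewrite /w enormZ gtr0_norm ?invr_gt0// mulVf// gt_eqF.
have [s [l [sj Hl]]] := bounded_rV_subseq w1.
have : dot v l <= 0.
  apply: Hv; exists (t \o s), (w \o s); split; [split|split] => //.
  - by move=> j; exact: t0.
  - apply: (cvg_seq_le (C := 1) (cvg_subseq sj (@cvg_inv_nat R))) => j /=.
    by rewrite subr0 mul1r gtr0_norm//; have [_ /ltW] := Hz' (s j).
  - move=> j /=; rewrite /w scalerA mulfV ?scale1r ?gt_eqF// addrC subrK.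
    by have [] := Hz' (s j).
apply/negP; rewrite -ltNge; apply: lt_le_trans e0 _.
have := cvg_seq_ler (cvg_const e) (cvg_dot (cvg_const v) Hl); apply => j /=.
rewrite /w dotZr -ler_pdivrMl ?invr_gt0// invrK mulrC.
by have [_ _ /ltW] := Hz' (s j).
Qed.

Definition monotone_map (R : realType) m (S : 'rV[R]_m -> set 'rV[R]_m) :=
  forall y ys y' ys', S y ys -> S y' ys' -> 0 <= dot (y - y') (ys - ys').

Lemma tangent_cone_monotone (R : realType) m (S : 'rV[R]_m -> set 'rV[R]_m) y ys w :
  monotone_map S -> S y ys -> tangent_cone (gph S) (row_mx y ys) w ->
  0 <= dot (lsubmx w) (rsubmx w).
Proof.
move=> mS Sy [t [w_ [[t0 _] [wl Hw]]]].
have := cvg_seq_ler (cvg_const 0) (cvg_dot (cvg_lsubmx wl) (cvg_rsubmx wl)); apply => j.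
have := mS _ _ _ _ (Hw j) Sy.
have -> : lsubmx (row_mx y ys + t j *: w_ j) - y = t j *: lsubmx (w_ j).
  by rewrite linearD linearZ /= row_mxKl addrC addKr.
have -> : rsubmx (row_mx y ys + t j *: w_ j) - ys = t j *: rsubmx (w_ j).
  by rewrite linearD linearZ /= row_mxKr addrC addKr.
by rewrite dotZl dotZr !pmulr_rge0.
Qed.

(** The first-order condition at 0 for a quadratic in [s], reused for orthogonality, for symmetry of
    Jacobians and for subgradients of quadratic forms. *)
Lemma linear_coef_eq0 (R : realType) (p q : R) : (forall s, 0 <= s * (p + s * q)) -> p = 0.
Proof.
move=> key; have q1 : 0 < `|q| + 1 by rewrite ltr_wpDl.
have aux e : 0 < e -> e / (`|q| + 1) * q <= e.
  move=> e0; rewrite mulrAC ler_pdivrMr// ler_pM2l//; apply: le_trans (ler_norm q) _.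
  by rewrite lerDl.
apply/eqP; rewrite eq_le; apply/andP; split; apply/ler_addgt0Pr => e e0.
- have := key (- (e / (`|q| + 1))); have e1 : 0 < e / (`|q| + 1) by rewrite divr_gt0.
  rewrite mulNr oppr_ge0 pmulr_rle0// => H; rewrite add0r.
  by move: H (aux e e0); rewrite mulNr; move: (_ * q) => r; clear => *; lra.
- have := key (e / (`|q| + 1)); have e1 : 0 < e / (`|q| + 1) by rewrite divr_gt0.
  rewrite pmulr_rge0// => H.
  by move: H (aux e e0); move: (_ * q) => r; clear => *; lra.
Qed.

(** For [z = (a, b)] in the subspace, monotonicity on [(0, vs) + s z] reads
    [0 <= s (<vs, a> + s <a, b>)] for every real [s]. *)
Lemma monotone_subspace_orthogonal (R : realType) m (Q : 'M[R]_(m + m)) (vs : 'rV[R]_m) :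
  (forall z, z *m Q = z -> 0 <= dot (lsubmx z) (rsubmx z)) ->
  row_mx 0 vs *m Q = row_mx 0 vs ->
  forall z, z *m Q = z -> dot (row_mx vs 0) z = 0.
Proof.
move=> Hmon Hvs z zQ; rewrite -[z]hsubmxK dot_row_mx dot0l addr0.
set a := lsubmx z; set b := rsubmx z.
have key s : 0 <= s * (dot vs a + s * dot a b).
  have := Hmon (row_mx 0 vs + s *: z) _.
  rewrite mulmxDl -scalemxAl Hvs zQ => /(_ erefl).
  rewrite !linearD !linearZ /= row_mxKl row_mxKr add0r -/a -/b.
  by rewrite dotZl dotDr dotZr (dotC a vs).
exact: linear_coef_eq0 key.
Qed.

(** Subtracting from [(vs, 0)] its projection on the tangent spaces gives regular normals at the
    approximating points; they tend to [(vs, 0)], whose projection on [L] is zero. *)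
Lemma coderivative_of_SC (R : realType) m (S : 'rV[R]_m -> set 'rV[R]_m) y ys L vs :
  monotone_map S -> SC_derivative S y ys L -> L (row_mx 0 vs) -> coderivative S y ys 0 vs.
Proof.
move=> mS [_ [y_ [ys_ [P_ [Q [Sj [yl [ysl [HT [HQ Ql]]]]]]]]]] Lvs.
have [sQ [QQ LQ]] := HQ.
have Hmon z : z *m Q = z -> 0 <= dot (lsubmx z) (rsubmx z).
  move=> zQ; have zl := cvg_mulmx (cvg_const z) Ql; rewrite zQ in zl.
  have := cvg_seq_ler (cvg_const 0) (cvg_dot (cvg_lsubmx zl) (cvg_rsubmx zl)); apply => j.
  have [_ HPj] := HT j.
  exact: tangent_cone_monotone mS (Sj j) (orth_projP z HPj).
have vsQ : row_mx 0 vs *m Q = row_mx 0 vs by exact/LQ.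
have nL := monotone_subspace_orthogonal Hmon vsQ.
set n := row_mx vs 0 in nL.
have nQ : n *m Q = 0.
  by apply: dot_eq0; rewrite [LHS]dot_mulmx sQ -mulmxA QQ nL// -mulmxA QQ.
exists (fun j => row_mx (y_ j) (ys_ j)), (fun j => n - n *m P_ j).
split; first by move=> j; rewrite /gph /= row_mxKl row_mxKr.
split; first exact: cvg_row_mx.
split.
  rewrite oppr0 -/n -[X in _ --> X]subr0 -nQ.
  by apply: cvgB; [exact: cvg_const|apply: cvg_mulmx => //; exact: cvg_const].
move=> j; apply: regular_normal_of_polar => w Tw.
have [_ [sP [PP HP]]] := HT j.
by rewrite dotBl dot_mulmx sP; have /HP -> := Tw; rewrite subrr.
Qed.

(** A diagonal choice: at each approximating point, one difference quotient close to the projection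
    of [(0, vs)] on the tangent space there. *)
Lemma strict_derivative_of_SC (R : realType) m (S : 'rV[R]_m -> set 'rV[R]_m) y ys L vs :
  SC_derivative S y ys L -> L (row_mx 0 vs) -> strict_derivative S y ys 0 vs.
Proof.
move=> [_ [y_ [ys_ [P_ [Q [Sj [yl [ysl [HT [[_ [_ LQ]] Ql]]]]]]]]]] /LQ vsQ.
set w := row_mx 0 vs in vsQ *.
have wl := cvg_mulmx (cvg_const w) Ql; rewrite vsQ in wl.
have /choice[tw Htw] : forall j : nat, exists tw : R * 'rV[R]_(m + m),
    [/\ 0 < tw.1, tw.1 < j.+1%:R^-1, `|tw.2 - w *m P_ j| < j.+1%:R^-1 &
      gph S (row_mx (y_ j) (ys_ j) + tw.1 *: tw.2)].
  move=> j; have [_ HPj] := HT j.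
  have [t [w_ [[t0 /cvg_seqP tl] [/cvg_seqP wjl Hw]]]] := orth_projP w HPj.
  have j0 : (0 : R) < j.+1%:R^-1 by rewrite invr_gt0.
  have [N1 HN1] := tl _ j0; have [N2 HN2] := wjl _ j0.
  exists (t (maxn N1 N2), w_ (maxn N1 N2)); split => //=.
    by have := HN1 _ (leq_maxl N1 N2); rewrite subr0 gtr0_norm.
  exact: HN2 _ (leq_maxr N1 N2).
exists (fun j => row_mx (y_ j) (ys_ j)), (fun j => (tw j).1), (fun j => (tw j).2).
split; first by move=> j; rewrite /gph /= row_mxKl row_mxKr.
split; first exact: cvg_row_mx.
split.
  split; first by move=> j; have [] := Htw j.
  apply: (cvg_seq_le (C := 1) (@cvg_inv_nat R)) => j.
  by rewrite subr0 mul1r; have [h0 h1 _ _] := Htw j; rewrite gtr0_norm// ltW.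
split; last by move=> j; have [] := Htw j.
apply/cvg_sub0.
have -> : (fun j => (tw j).2 - w) = (fun j => (tw j).2 - w *m P_ j) + (fun j => w *m P_ j - w).
  by apply/funext => j; rewrite !fctE addrA subrK.
rewrite -[X in _ --> X]addr0; apply: cvgD; last exact/cvg_sub0.
apply: (cvg_seq_le (C := 1) (@cvg_inv_nat R)) => j.
by rewrite subr0 mul1r; have [_ _ /ltW] := Htw j.
Qed.

(** * The multiplier mapping *)

Definition local_estimate (R : realType) m n (S : 'rV[R]_m -> set 'rV[R]_m)
    (y ys : 'rV[R]_m) (K : 'M[R]_(m, n)) :=
  exists2 kappa, 0 <= kappa & exists2 d, 0 < d & forall a as_ b bs, S a as_ -> S b bs ->
    `|a - y| < d -> `|as_ - ys| < d -> `|b - y| < d -> `|bs - ys| < d ->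
    `|as_ - bs| <= kappa * (`|a - b| + `|(as_ - bs) *m K|).

Lemma norm_row_mx_le (R : realType) m n p (A : 'M[R]_(m, n)) (B : 'M[R]_(m, p)) e :
  `|A| <= e -> `|B| <= e -> `|row_mx A B| <= e.
Proof.
move=> HA HB; apply: mx_norm_le => [|i j]; first exact: le_trans (normr_ge0 _) HA.
rewrite -[j]splitK; case: (fintype.split j) => l /=.
  by rewrite row_mxEl; exact: le_trans (mx_entry_le_norm _ _ _) HA.
by rewrite row_mxEr; exact: le_trans (mx_entry_le_norm _ _ _) HB.
Qed.

Lemma norm_lsubmx_le (R : realType) m n p (A : 'M[R]_(m, n + p)) : `|lsubmx A| <= `|A|.
Proof. by apply: mx_norm_le => // i j; rewrite mxE mx_entry_le_norm. Qed.

Lemma norm_rsubmx_le (R : realType) m n p (A : 'M[R]_(m, n + p)) : `|rsubmx A| <= `|A|.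
Proof. by apply: mx_norm_le => // i j; rewrite mxE mx_entry_le_norm. Qed.

(** Pairs violating the estimate with constant [j] are divided by the distance of their second
    components. A limit of the quotients is a unit vector [v] annihilated by [K], with [(0, v)] in
    the paratingent cone. *)
Lemma local_estimate_of_strict (R : realType) m n (S : 'rV[R]_m -> set 'rV[R]_m)
    y ys (K : 'M[R]_(m, n)) :
  (forall vs, vs *m K = 0 -> strict_derivative S y ys 0 vs -> vs = 0) ->
  local_estimate S y ys K.
Proof.
move=> Hiv; apply: contrapT => Hno.
have /choice[q Hq] : forall j : nat, exists q : ('rV[R]_m * 'rV[R]_m) * ('rV[R]_m * 'rV[R]_m),
    [/\ S q.1.1 q.1.2, S q.2.1 q.2.2,
      [/\ `|q.1.1 - y| < j.+1%:R^-1, `|q.1.2 - ys| < j.+1%:R^-1,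
      `|q.2.1 - y| < j.+1%:R^-1 & `|q.2.2 - ys| < j.+1%:R^-1] &
      j.+1%:R * (`|q.1.1 - q.2.1| + `|(q.1.2 - q.2.2) *m K|) < `|q.1.2 - q.2.2|].
  move=> j; apply: contrapT => Hj; apply: Hno.
  exists j.+1%:R => //; exists j.+1%:R^-1; first by rewrite invr_gt0.
  move=> a as_ b bs Sa Sb h1 h2 h3 h4; rewrite leNgt; apply/negP => H; apply: Hj.
  by exists ((a, as_), (b, bs)).
pose t j := `|(q j).1.2 - (q j).2.2|.
have t0 j : 0 < t j.
  have [_ _ _ H] := Hq j; apply: le_lt_trans _ H.
  by rewrite mulr_ge0// addr_ge0.
pose da j := (t j)^-1 *: ((q j).1.1 - (q j).2.1).
pose ds j := (t j)^-1 *: ((q j).1.2 - (q j).2.2).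
have ds1 j : `|ds j| = 1.
  by rewrite /ds normrZ normfV gtr0_norm// mulVf// gt_eqF.
have ds1' j : `|ds j| <= 1 by rewrite ds1.
have Hd j : `|da j| + `|ds j *m K| <= j.+1%:R^-1.
  have [_ _ _ H] := Hq j.
  rewrite /da /ds -scalemxAl !normrZ normfV (gtr0_norm (t0 j)) -mulrDr.
  by rewrite mulrC ler_pdivrMr// -ler_pdivrMl ?invr_gt0// invrK; exact: ltW.
have [s [v [sj Hv]]] := bounded_rV_subseq ds1'.
have near_cvg (x_ : nat -> 'rV[R]_m) (x : 'rV[R]_m) : (forall j, `|x_ j - x| < j.+1%:R^-1) -> x_ @ \oo --> x.
  by move=> H; apply: (cvg_seq_le (C := 1) (@cvg_inv_nat R)) => j; rewrite mul1r ltW.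
have da0 : da @ \oo --> (0 : 'rV[R]_m).
  apply: (cvg_seq_le (C := 1) (@cvg_inv_nat R)) => j; rewrite subr0 mul1r.
  by apply: le_trans (Hd j); rewrite lerDl.
have vK : v *m K = 0.
  apply: cvg_seq_unique (cvg_lin_mulmx (B := K) Hv) _.
  apply: (cvg_seq_le (C := 1) (cvg_subseq sj (@cvg_inv_nat R))) => j; rewrite subr0 mul1r.
  by apply: le_trans (Hd (s j)); rewrite lerDr.
have v0 : v = 0.
  apply: Hiv => //.
  have yl : (fun j => (q j).2.1) @ \oo --> y by apply: near_cvg => j; have [_ _ []] := Hq j.
  have ysl : (fun j => (q j).2.2) @ \oo --> ys by apply: near_cvg => j; have [_ _ []] := Hq j.
  have ysl' : (fun j => (q j).1.2) @ \oo --> ys by apply: near_cvg => j; have [_ _ []] := Hq j.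
  exists (fun j => row_mx (q (s j)).2.1 (q (s j)).2.2), (t \o s), (fun j => row_mx (da (s j)) (ds (s j))).
  split; first by move=> j; rewrite /gph /= row_mxKl row_mxKr; have [] := Hq (s j).
  split; first by apply: cvg_row_mx; [exact: (cvg_subseq sj yl)|exact: (cvg_subseq sj ysl)].
  split.
    split=> [j|]; first exact: t0.
    apply: cvg_subseq => //; apply: cvg_norm0.
    by rewrite -[X in _ --> X](subrr ys); exact: cvgB.
  split; first by apply: cvg_row_mx => //; exact: (cvg_subseq sj da0).
  move=> j; rewrite /gph /= scale_row_mx add_row_mx row_mxKl row_mxKr.
  rewrite /da /ds !scalerA mulfV ?gt_eqF// !scale1r.
  by rewrite [_ + (_ - _)]addrC subrK [_ + (_ - _)]addrC subrK; have [] := Hq (s j).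
have := cvg_norm_seq Hv; rewrite v0 normr0.
under eq_fun do rewrite /= ds1.
by move=> /(cvg_seq_unique (cvg_const (1 : R))) /eqP; rewrite oner_eq0.
Qed.

Lemma strict_of_local_estimate (R : realType) m n (S : 'rV[R]_m -> set 'rV[R]_m)
    y ys (K : 'M[R]_(m, n)) :
  local_estimate S y ys K ->
  forall vs, vs *m K = 0 -> strict_derivative S y ys 0 vs -> vs = 0.
Proof.
move=> [kappa k0 [d d0 HE]] vs vsK [z_ [t [w_ [Hz [zl [[t0 tl] [wl Hzw]]]]]]].
have zwl : (fun j => z_ j + t j *: w_ j) @ \oo --> row_mx y ys.
  rewrite -[X in _ --> X]addr0; apply: cvgD => //.
  by rewrite -(scale0r (row_mx 0 vs)); apply: cvgZ.
have ev (x_ : nat -> 'rV[R]_m) (x : 'rV[R]_m) : x_ @ \oo --> x -> exists N, forall j, (N <= j)%N -> `|x_ j - x| < d.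
  by move=> /cvg_seqP; exact.
have lE (u : nat -> 'rV[R]_(m + m)) : u @ \oo --> row_mx y ys -> (fun j => lsubmx (u j)) @ \oo --> y.
  by move=> /cvg_lsubmx; rewrite row_mxKl.
have rE (u : nat -> 'rV[R]_(m + m)) : u @ \oo --> row_mx y ys -> (fun j => rsubmx (u j)) @ \oo --> ys.
  by move=> /cvg_rsubmx; rewrite row_mxKr.
have [N1 H1] := ev _ _ (lE _ zl); have [N2 H2] := ev _ _ (rE _ zl).
have [N3 H3] := ev _ _ (lE _ zwl); have [N4 H4] := ev _ _ (rE _ zwl).
have lw : (fun j => lsubmx (w_ j)) @ \oo --> (0 : 'rV[R]_m).
  by have := cvg_lsubmx wl; rewrite row_mxKl.
have rw : (fun j => rsubmx (w_ j)) @ \oo --> vs.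
  by have := cvg_rsubmx wl; rewrite row_mxKr.
have Hlim : (fun j => kappa * (`|lsubmx (w_ j)| + `|rsubmx (w_ j) *m K|)) @ \oo --> (0 : R).
  apply: cvg_mulr0; apply: cvg_addr0; apply: cvg_norm0 => //.
  by have := cvg_lin_mulmx (B := K) rw; rewrite vsK.
apply/normr0_eq0/eqP; rewrite eq_le normr_ge0 andbT.
apply: (ler_cvg_to (cvg_norm_seq rw) Hlim).
exists (maxn (maxn N1 N2) (maxn N3 N4)) => // j; rewrite /= !geq_max => /andP[/andP[j1 j2] /andP[j3 j4]].
have := HE _ _ _ _ (Hzw j) (Hz j) (H3 _ j3) (H4 _ j4) (H1 _ j1) (H2 _ j2).
have -> : lsubmx (z_ j + t j *: w_ j) - lsubmx (z_ j) = t j *: lsubmx (w_ j).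
  by rewrite linearD linearZ /= addrC addKr.
have -> : rsubmx (z_ j + t j *: w_ j) - rsubmx (z_ j) = t j *: rsubmx (w_ j).
  by rewrite linearD linearZ /= addrC addKr.
rewrite -scalemxAl !normrZ (gtr0_norm (t0 j)) -mulrDr mulrCA.
by rewrite ler_pM2l.
Qed.

Lemma localization_of_local_estimate (R : realType) m n (S : 'rV[R]_m -> set 'rV[R]_m)
    y ys (K : 'M[R]_(m, n)) :
  local_estimate S y ys K ->
  sv_lip_localization (fun p : 'rV[R]_(n + m) =>
    [set vs | S (y + rsubmx p) vs /\ vs *m K = lsubmx p]) (row_mx (ys *m K) 0) ys.
Proof.
move=> [kappa k0 [d d0 HE]].
exists [set p | `|rsubmx p| < d], [set v | `|v - ys| < d]; split.
  apply/near_norm; exists d => // p; rewrite distrC => H /=.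
  have := norm_rsubmx_le (p - row_mx (ys *m K) 0).
  by rewrite linearB /= row_mxKr subr0 => /le_lt_trans; apply.
split; first by apply/near_norm; exists d => // v; rewrite distrC.
set loc := fun p v => _.
have Hlip p p' v v' : loc p v -> loc p' v' ->
    `|v - v'| <= (kappa * 2) * `|p - p'|.
  move=> [[Sv vK] Up Wv] [[Sv' vK'] Up' Wv'].
  have := HE _ _ _ _ Sv Sv'; rewrite ![y + _ - y]addrC !addKr => /(_ Up Wv Up' Wv').
  move=> H; apply: le_trans H _; rewrite -mulrA ler_wpM2l//.
  rewrite mulrDl mul1r lerD//.
    by rewrite opprD addrACA subrr add0r -linearB; exact: norm_rsubmx_le.
  by rewrite mulmxBl vK vK' -linearB; exact: norm_lsubmx_le.
split.
  move=> p v v' Hv Hv'; apply/eqP; rewrite -subr_eq0 -normr_le0.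
  by apply: le_trans (Hlip _ _ _ _ Hv Hv') _; rewrite subrr normr0 mulr0.
exists (m%:R * (kappa * 2)); split; first by rewrite !mulr_ge0.
move=> p p' v v' Hv Hv'; apply: le_trans (enorm_le_norm _) _.
rewrite -mulrA ler_wpM2l//; apply: le_trans (Hlip _ _ _ _ Hv Hv') _.
by rewrite ler_wpM2l ?mulr_ge0// norm_le_enorm.
Qed.

Lemma local_estimate_of_localization (R : realType) m n (S : 'rV[R]_m -> set 'rV[R]_m)
    y ys (K : 'M[R]_(m, n)) :
  sv_lip_localization (fun p : 'rV[R]_(n + m) =>
    [set vs | S (y + rsubmx p) vs /\ vs *m K = lsubmx p]) (row_mx (ys *m K) 0) ys ->
  local_estimate S y ys K.
Proof.
move=> [U [W [/near_norm[d1 d10 HU] [/near_norm[d2 d20 HW] [_ [kappa [k0 Hk]]]]]]].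
exists (kappa * (n + m)%:R); first by rewrite mulr_ge0.
have c0 : 0 < m%:R * `|K| + 1 by rewrite ltr_wpDl// mulr_ge0.
pose d := Order.min d2 (d1 / (m%:R * `|K| + 1)).
have dd1 : d * (m%:R * `|K| + 1) <= d1 by rewrite -ler_pdivlMr// ge_min lexx orbT.
have d0 : 0 < d by rewrite lt_min d20 divr_gt0.
exists d => // a as_ b bs Sa Sb a1 a2 b1 b2.
(* The parameter for which [as_] is a multiplier. The radius [d] is chosen so that graph points near
   [(y, ys)] have their parameter in [U]. *)
pose p (a as_ : 'rV[R]_m) : 'rV[R]_(n + m) := row_mx (as_ *m K) (a - y).
have Hloc (c cs : 'rV[R]_m) : S c cs -> `|c - y| < d -> `|cs - ys| < d ->
   [/\ S (y + rsubmx (p c cs)) cs /\ cs *m K = lsubmx (p c cs), U (p c cs) & W cs].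
  move=> Sc c1 c2; rewrite row_mxKr row_mxKl addrC subrK; split => //.
    apply: HU; rewrite opp_row_mx add_row_mx sub0r -mulmxBl -normrN opp_row_mx opprK -mulNmx opprB.
    apply: lt_le_trans _ dd1; apply: (@le_lt_trans _ _ (Order.max `|cs - ys| `|c - y| * (m%:R * `|K| + 1))).
      apply: norm_row_mx_le.
        apply: le_trans (norm_mulmx_le _ _) _.
        rewrite mulrAC mulrC ler_pM// ?mulr_ge0// ?le_max ?lexx//.
        by rewrite lerDl.
      rewrite -[leLHS]mulr1 ler_pM// ?le_max ?lexx ?orbT//.
      by rewrite lerDr mulr_ge0.
    by rewrite ltr_pM2r// gt_max c1 c2.
  by apply: HW; rewrite distrC; apply: lt_le_trans c2 _; rewrite ge_min lexx.
have := Hk _ _ _ _ (Hloc _ _ Sa a1 a2) (Hloc _ _ Sb b1 b2).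
move=> H; apply: le_trans (norm_le_enorm _) _; apply: le_trans H _.
rewrite -mulrA ler_wpM2l//; apply: le_trans (enorm_le_norm _) _; rewrite ler_wpM2l//.
rewrite opp_row_mx add_row_mx -mulmxBl opprB addrA subrK.
by apply: norm_row_mx_le; rewrite ?lerDl ?lerDr.
Qed.

(** * Metric regularity *)

Definition C1_at (R : realType) n m (F : 'rV[R]_n -> 'rV[R]_m) (J : 'rV[R]_n -> 'M[R]_(n, m))
    (xb : 'rV[R]_n) :=
  forall e, 0 < e -> exists2 d, 0 < d & forall x, `|x - xb| < d ->
    frechet F x (J x) /\ `|J x - J xb| <= e.

Lemma frechet_continuous (R : realType) n m (F : 'rV[R]_n -> 'rV[R]_m) x B e :
  frechet F x B -> 0 < e -> exists2 d, 0 < d & forall y, `|y - x| <= d -> `|F y - F x| <= e.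
Proof.
move=> HF e0; have [d d0 Hd] := HF 1 ltr01.
have c0 : 0 < n%:R * `|B| + 1 by rewrite ltr_wpDl// mulr_ge0.
exists (Order.min d (e / (n%:R * `|B| + 1))); first by rewrite lt_min d0 divr_gt0.
move=> y; rewrite le_min => /andP[yd ye].
have := Hd _ yd; rewrite mul1r [x + _]addrC subrK => H.
rewrite -[F y - F x](subrK ((y - x) *m B)); apply: le_trans (ler_normD _ _) _.
apply: le_trans (lerD H (norm_mulmx_le _ _)) _.
move: ye; rewrite ler_pdivlMr//; apply: le_trans.
by rewrite le_eqVlt; apply/orP; left; apply/eqP; ring.
Qed.

Lemma frechet_cvg_seq (R : realType) n m (F : 'rV[R]_n -> 'rV[R]_m) (x : 'rV[R]_n) B
    (x_ : nat -> 'rV[R]_n) :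
  frechet F x B -> x_ @ \oo --> x -> (F \o x_) @ \oo --> F x.
Proof.
move=> HF /cvg_seqP Hx; apply/cvg_seqP => e e0.
have e20 : 0 < e / 2 by rewrite divr_gt0.
have [d d0 Hd] := frechet_continuous HF e20; have [N HN] := Hx d d0.
exists N => j /HN /ltW /Hd H; apply: le_lt_trans H _.
by rewrite ltr_pdivrMr// ltr_pMr// ltr1n.
Qed.

Lemma cvg_enorm (R : realType) k (x_ : nat -> 'rV[R]_k) (x : 'rV[R]_k) :
  x_ @ \oo --> x -> (fun j => enorm (x_ j)) @ \oo --> enorm x.
Proof.
move=> /cvg_sub0 /cvg_norm0 H; apply: (cvg_seq_le (C := k%:R) H) => j.
apply: le_trans (enorm_le_norm _).
rewrite ler_norml; apply/andP; split.
  rewrite lerNl opprB lerBlDr enormB; apply: le_trans (enormD _ _).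
  by rewrite subrK.
by rewrite lerBlDr; apply: le_trans (enormD _ _); rewrite subrK.
Qed.

(** Continuity is asked only at points of the box, because the inner map is controlled only near the
    reference point. *)
Lemma box_minimizer (R : realType) k (phi : 'rV[R]_k -> R) (c : 'rV[R]_k) (rho : R) :
  0 <= rho -> (forall x, 0 <= phi x) ->
  (forall (x_ : nat -> 'rV[R]_k) (x : 'rV[R]_k), `|x - c| <= rho -> x_ @ \oo --> x ->
     (phi \o x_) @ \oo --> phi x) ->
  exists2 x, `|x - c| <= rho & forall y, `|y - c| <= rho -> phi x <= phi y.
Proof.
move=> rho0 phi0 Hc.
pose D := [set phi z | z in [set z | `|z - c| <= rho]].
have D0 : D !=set0 by exists (phi c), c => //=; rewrite subrr normr0.
have Dinf : has_inf D by split => //; exists 0 => _ [z _ <-].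
have /choice[y_ Hy] : forall j : nat, exists z, `|z - c| <= rho /\ phi z < inf D + j.+1%:R^-1.
  move=> j; have j0 : (0 : R) < j.+1%:R^-1 by rewrite invr_gt0.
  by have [_ [z zD <-] Hz] := inf_adherent j0 Dinf; exists z.
have yb j : `|y_ j| <= rho + `|c|.
  by rewrite -(subrK c (y_ j)); apply: le_trans (ler_normD _ _) _; rewrite lerD2r; have [] := Hy j.
have [s [l [sj Hl]]] := bounded_rV_subseq yb.
have lc : `|l - c| <= rho.
  have H1 : (fun j => (y_ \o s) j - c) @ \oo --> l - c by apply: cvgB => //; exact: cvg_const.
  have := cvg_seq_ler (cvg_norm_seq H1) (cvg_const rho); apply => j /=.
  by have [] := Hy (s j).
exists l => // y yc; apply: (@le_trans _ _ (inf D)); last by apply: ge_inf; [case: Dinf|exists y].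
have H1 : (fun j => inf D + (s j).+1%:R^-1) @ \oo --> inf D.
  rewrite -[X in _ --> X]addr0; apply: cvgD; first exact: cvg_const.
  exact: (cvg_subseq sj (@cvg_inv_nat R)).
have := cvg_seq_ler (Hc _ _ lc Hl) H1; apply => j /=.
by have [_ /ltW] := Hy (s j).
Qed.

(** The inequality between geometric and arithmetic means: after division by [enorm H], a
    linearization of the norm with explicit quadratic remainder. *)
Lemma enorm_linearize (R : realType) k (H b : 'rV[R]_k) :
  enorm H * enorm (H + b) <= enorm H ^+ 2 + dot H b + 2^-1 * dot b b.
Proof.
have := enorm_sqr (H + b); rewrite !dotD (dotC b H) -(enorm_sqr H).
move: (enorm H) (enorm (H + b)) (dot H b) (dot b b) => h h' p q; clear => E.
have := sqr_ge0 (h - h'); nra.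
Qed.

(* First-order condition in x for minimizing enorm (H x) + eps |x - x0|. *)
Lemma penalized_gradient_le (R : realType) n m (F : 'rV[R]_n -> 'rV[R]_m) x B (H : 'rV[R]_m) eps :
  frechet F x B -> 0 < enorm H -> 0 <= eps ->
  (exists2 s0, 0 < s0 & forall a : 'rV[R]_n, `|a| <= s0 ->
     enorm H - eps * `|a| <= enorm (H - (F (x + a) - F x))) ->
  enorm (((enorm H)^-1 *: H) *m B^T) <= eps.
Proof.
move=> HF h0 eps0 [s0 s00 Hmin].
set h := enorm H in h0 *; set e := h^-1 *: H.
have He : H = h *: e by rewrite /e scalerA mulfV ?scale1r// gt_eqF.
pose a := e *m B^T; pose b := a *m B.
have eb : dot e b = dot a a by rewrite /b dotC dot_mulmx dotC.
suff key : dot a a <= eps * `|a|.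
  have := le_trans key (ler_wpM2l eps0 (norm_le_enorm a)).
  rewrite -enorm_sqr -/a; have := enorm_ge0 a; move: (enorm a) => t; clear -eps0 => t0 H; nra.
apply/ler_addgt0Pr => eta eta0.
pose be := dot b b / (2 * h); have be0 : 0 <= be by rewrite divr_ge0 ?dot_ge0// mulr_ge0// ltW.
pose et := eta / (2 * (m%:R * `|a| + 1)).
have ma : 0 < m%:R * `|a| + 1 by rewrite ltr_wpDl// mulr_ge0.
have et0 : 0 < et by rewrite divr_gt0// mulr_gt0.
have [d d0 Hd] := HF _ et0.
have a1 : 0 < `|a| + 1 by rewrite ltr_wpDl.
(* The first bound keeps the step [s a] where minimality and the expansion of [F] hold; the second
   makes the quadratic remainder at most [s * eta / 2]. *)
pose s := Order.min (Order.min s0 d / (`|a| + 1)) (eta / (2 * (be + 1))).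
have be1 : 0 < 2 * (be + 1) by rewrite mulr_gt0// ltr_wpDl.
have s_gt0 : 0 < s by rewrite lt_min !divr_gt0// lt_min s00 d0.
have sa : `|s *: a| <= Order.min s0 d.
  rewrite normrZ gtr0_norm//; apply: (@le_trans _ _ (s * (`|a| + 1))).
    by rewrite ler_wpM2l ?(ltW s_gt0)// lerDl.
  by rewrite -ler_pdivlMr// ge_min lexx.
have sbe : s * be <= eta / 2.
  have : s <= eta / (2 * (be + 1)) by rewrite ge_min lexx orbT.
  rewrite !ler_pdivlMr//; apply: le_trans.
  by rewrite -mulrA ler_pM2l// mulrC ler_pM2l// lerDl.
move: sa; rewrite le_min => /andP[sa0 sad].
have H1 := Hmin _ sa0; have H2 := Hd _ sad.
set r := F (x + s *: a) - F x - (s *: a) *m B in H2.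
have H3 : enorm (H - (F (x + s *: a) - F x)) <= enorm (H - s *: b) + s * (eta / 2).
  have -> : H - (F (x + s *: a) - F x) = (H - s *: b) - r.
    by rewrite /r /b -scalemxAl; apply/rowP => i; rewrite !mxE; ring.
  apply: le_trans (enormD _ _) _; rewrite lerD2l enormN.
  apply: le_trans (enorm_le_norm _) _; apply: le_trans (ler_wpM2l (ler0n _ _) H2) _.
  rewrite normrZ (gtr0_norm s_gt0).
  have -> : m%:R * (et * (s * `|a|)) = s * (et * (m%:R * `|a|)) by ring.
  rewrite ler_pM2l//; apply: (@le_trans _ _ (et * (m%:R * `|a| + 1))).
    by rewrite ler_pM2l// lerDl.
  by rewrite /et invfM mulrA -[leLHS]mulrA mulVf ?mulr1// gt_eqF.
have H4 := enorm_linearize H (- (s *: b)).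
rewrite !(dotNl, dotNr, dotZl, dotZr) opprK -/h in H4.
have HB : dot H b = h * dot a a by rewrite {1}He dotZl eb.
rewrite HB in H4.
have bb : dot b b = be * (2 * h) by rewrite /be divfK// gt_eqF// mulr_gt0.
rewrite bb in H4.
rewrite normrZ (gtr0_norm s_gt0) in H1.
have {}H1 := le_trans H1 H3.
have H5 : enorm (H - s *: b) <= h - s * dot a a + s * s * be.
  rewrite -(ler_pM2l h0); apply: le_trans H4 _; rewrite le_eqVlt; apply/orP; left; apply/eqP.
  by field.
rewrite -(ler_pM2l s_gt0).
have H6 := ler_wpM2l (ltW s_gt0) sbe.
have := le_trans H1 (lerD H5 (lexx _)); rewrite -/h.
move: H6; move: (dot a a) `|a| (s) (be) (h) => q na s' be' h'.
by clear => H6 H7; lra.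
Qed.

(* Firm nonexpansiveness makes P move by at most sigma s when u moves by s
   against the residual direction, if the residual decreases at rate at most
   sigma^2 / 2. *)
Lemma penalized_resolvent_step (R : realType) m (dP H e : 'rV[R]_m) (s sigma : R) :
  0 < s -> s <= enorm H -> 0 <= sigma -> H = enorm H *: e ->
  dot dP dP <= dot dP (- (s *: e)) ->
  enorm H - sigma ^+ 2 / 2 * s <= enorm (H + dP) -> enorm dP <= sigma * s.
Proof.
move=> s0 sh sig0 He firm Hmin.
have H1 := enorm_linearize H dP.
have h0 : 0 < enorm H := lt_le_trans s0 sh.
have HdP : dot H dP = enorm H * dot e dP by rewrite {1}He dotZl.
move: firm; rewrite dotNr dotZr (dotC dP e) => firm.
rewrite HdP in H1.
rewrite -(@ler_pXn2r _ 2) ?nnegrE ?enorm_ge0 ?mulr_ge0 ?(ltW s0)// enorm_sqr.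
move: (enorm (H + dP)) (enorm H) (dot e dP) (dot dP dP) (dot_ge0 dP) H1 h0 sh firm Hmin.
move: s0 sig0; clear => s0 sig0 h' h p q q0 H1 h0 sh firm Hmin.
(* With [p = <e, dP>] and [q = |dP|^2], minimality gives [- (sigma^2 / 2) s h <= h p + q / 2]. After
   multiplication by [s], firmness [q <= - s p] and [s <= h] leave [q <= (sigma s)^2]. *)
have A1 := ler_wpM2l (ltW h0) Hmin.
have A2 := ler_wpM2l (ltW h0) firm.
have A3 : s * q <= h * q by rewrite ler_wpM2r.
have A4 := ler_wpM2l (ltW s0) (le_trans A1 H1).
have A5 : h * q <= h * (sigma * s) ^+ 2.
  rewrite exprMn; nra.
by move: A5; rewrite ler_pM2l.
Qed.

Lemma norm_trmx_le (R : realType) m n (A : 'M[R]_(m, n)) : `|A^T| <= `|A|.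
Proof. by apply: mx_norm_le => // i j; rewrite mxE mx_entry_le_norm. Qed.

(** Passing to [(x, u)] replaces the set-valued equation by one for the Lipschitz map [P u - F x].
    Solvability with a linear bound follows from the penalty: an exact solution minimizing it cannot
    be farther away than the initial residual over [eps]. *)
Lemma local_solution (R : realType) n m (F : 'rV[R]_n -> 'rV[R]_m) J xb
    (S : 'rV[R]_m -> set 'rV[R]_m) P ysb :
  resolvent S P -> S (F xb) ysb -> C1_at F J xb ->
  local_estimate S (F xb) ysb (J xb)^T ->
  exists2 C, 0 < C & exists2 rho, 0 < rho & forall x u w,
    `|x - xb| < rho -> `|u - (F xb + ysb)| < rho -> enorm (P u - F x - w) < rho ->
    exists x' u', P u' - F x' = w /\ `|x' - x| + `|u' - u| <= C * enorm (P u - F x - w).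
Proof.
move=> HP Sb HF [kappa k0 [d d0 HE]]; have [HP1 HP2 HP3] := HP.
set ub := F xb + ysb; set K := (J xb)^T.
have Pub : P ub = F xb by exact: HP2.
(* Total error in units of [sigma * s]: the leading 1 for [dP]; inside, 2 for [dP] and [eps], [m]
   for the variation of the Jacobian, [m * |K|] for [dP *m K]. Then [sigma] is chosen so that
   [m * sigma * T < 1]. *)
pose T := 1 + kappa * (2 + m%:R + m%:R * `|K|).
have T1 : 1 <= T by rewrite lerDl mulr_ge0// !addr_ge0// mulr_ge0.
have T0 : 0 < T := lt_le_trans ltr01 T1.
pose sigma := (m.+1%:R * T)^-1.
have sig0 : 0 < sigma by rewrite invr_gt0 mulr_gt0.
have sig1 : sigma <= 1.
  by rewrite invf_le1 ?mulr_gt0// -[leLHS]mulr1 ler_pM// ler1n.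
have sigT : m%:R * (sigma * T) < 1.
  rewrite /sigma invfM divfK ?gt_eqF//.
  by rewrite ltr_pdivrMr// mul1r ltr_nat.
pose eps := sigma ^+ 2 / 2.
have eps0 : 0 < eps by rewrite divr_gt0// exprn_gt0.
have epss : eps <= sigma.
  by rewrite /eps; move: sig0 sig1; move: (sigma) => t; clear => h1 h2; nra.
have [d1 d10 Hd1] := HF sigma sig0.
have m1 : (0 : R) < m%:R + 1 by rewrite ltr_wpDl.
pose r := Order.min d1 (d / (m%:R + 1)).
have r0 : 0 < r by rewrite lt_min d10 divr_gt0.
have rd1 : r <= d1 by rewrite ge_min lexx.
have rd : r * (m%:R + 1) <= d by rewrite -ler_pdivlMr// ge_min lexx orbT.
exists eps^-1; first by rewrite invr_gt0.
(* The box has half-width [r3]. An initial residual below [eps * r6] keeps the minimizer within [r6]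
   of the centre, so perturbations of size [r6] stay in the box. *)
pose r3 := r / 3; pose r6 := r / 6.
have r30 : 0 < r3 by rewrite divr_gt0.
have r60 : 0 < r6 by rewrite divr_gt0.
have r663 : r6 + r6 = r3 by rewrite /r6 /r3; field.
have r333 : r3 + r3 + r3 = r by rewrite /r3; field.
exists (Order.min r3 (eps * r6)); first by rewrite lt_min r30 mulr_gt0.
move=> x u w; rewrite !lt_min => /andP[xx _] /andP[uu _] /andP[_ Hh].
pose res x u := P u - F x - w.
pose phi (z : 'rV[R]_(n + m)) := enorm (res (lsubmx z) (rsubmx z)) +
  eps * (`|lsubmx z - x| + `|rsubmx z - u|).
pose c := row_mx x u.
have boxl z : `|z - c| <= r3 -> `|lsubmx z - x| <= r3 /\ `|rsubmx z - u| <= r3.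
  move=> zc; split; apply: le_trans zc.
    by have := norm_lsubmx_le (z - c); rewrite linearB /= row_mxKl.
  by have := norm_rsubmx_le (z - c); rewrite linearB /= row_mxKr.
have nearx x' : `|x' - x| <= r3 -> `|x' - xb| < r.
  move=> H; rewrite -(subrK x x') -addrA; apply: le_lt_trans (ler_normD _ _) _.
  apply: lt_le_trans (ler_ltD H xx) _; rewrite -r333 lerDl; exact: ltW.
have phi0 z : 0 <= phi z by rewrite addr_ge0 ?enorm_ge0// mulr_ge0 ?addr_ge0// ltW.
have phic (z_ : nat -> 'rV[R]_(n + m)) (z : 'rV[R]_(n + m)) : `|z - c| <= r3 -> z_ @ \oo --> z ->
     (phi \o z_) @ \oo --> phi z.
  move=> /boxl[/nearx zx _] Hz.
  have [Fz _] := Hd1 _ (lt_le_trans zx rd1).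
  have Hl := cvg_lsubmx Hz; have Hr := cvg_rsubmx Hz.
  apply: cvgD.
    apply: cvg_enorm; apply: cvgB; last exact: cvg_const.
    by apply: cvgB; [exact: resolvent_cvg HP Hr|exact: frechet_cvg_seq Fz Hl].
  apply: cvgM; first exact: cvg_const.
  by apply: cvgD; apply: cvg_norm_seq; apply: cvgB => //; exact: cvg_const.
have [z zc zmin] := box_minimizer (ltW r30) phi0 phic.
set x' := lsubmx z; set u' := rsubmx z.
have phiz : phi z <= enorm (P u - F x - w).
  have := zmin c; rewrite subrr normr0 => /(_ (ltW r30)).
  by rewrite {2}/phi /c row_mxKl row_mxKr !subrr !normr0 addr0 mulr0 addr0.
have Hdist : eps * (`|x' - x| + `|u' - u|) <= enorm (P u - F x - w).
  by apply: le_trans phiz; rewrite lerDr enorm_ge0.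
exists x', u'; split; last by rewrite mulrC ler_pdivlMr// mulrC.
have Hdist6 : `|x' - x| + `|u' - u| < r6.
  by rewrite -(ltr_pM2l eps0); exact: le_lt_trans Hdist Hh.
have x'6 : `|x' - x| <= r6 by apply: le_trans (ltW Hdist6); rewrite lerDl.
have u'6 : `|u' - u| <= r6 by apply: le_trans (ltW Hdist6); rewrite lerDr.
have Hmin a b : `|a| <= r6 -> `|b| <= r6 ->
    enorm (res x' u') - eps * (`|a| + `|b|) <= enorm (res (x' + a) (u' + b)).
  move=> ar br; have := zmin (row_mx (x' + a) (u' + b)).
  have box : `|row_mx (x' + a) (u' + b) - c| <= r3.
    rewrite opp_row_mx add_row_mx -r663; apply: norm_row_mx_le; rewrite addrAC.
      by apply: le_trans (ler_normD _ _) _; exact: lerD.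
    by apply: le_trans (ler_normD _ _) _; exact: lerD.
  move=> /(_ box); rewrite /phi row_mxKl row_mxKr -/x' -/u'.
  have H1 : `|x' + a - x| <= `|x' - x| + `|a| by rewrite addrAC; exact: ler_normD.
  have H2 : `|u' + b - u| <= `|u' - u| + `|b| by rewrite addrAC; exact: ler_normD.
  have := ler_wpM2l (ltW eps0) (lerD H1 H2).
  move: (enorm _) (enorm _) `|x' + a - x| `|u' + b - u| `|x' - x| `|u' - u| `|a| `|b|.
  by move: (eps) => e; clear => h h' p q p' q' na nb H1 H2; lra.
set H := res x' u'.
apply/eqP; rewrite -subr_eq0 -[_ - w]/H; apply/eqP/enorm_eq0/eqP.
rewrite eq_le enorm_ge0 andbT leNgt; apply/negP => h0.
set h := enorm H in h0; pose e := h^-1 *: H.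
have He : H = h *: e by rewrite /e scalerA mulfV ?scale1r// gt_eqF.
have e1 : enorm e = 1 by rewrite /e enormZ gtr0_norm ?invr_gt0// mulVf// gt_eqF.
have ne1 : `|e| <= 1 by rewrite -e1 norm_le_enorm.
have [FJ JJ] : frechet F x' (J x') /\ `|J x' - J xb| <= sigma.
  by apply: Hd1; apply: lt_le_trans rd1; apply: nearx; have [] := boxl z zc.
have eJ : enorm (e *m (J x')^T) <= eps.
  apply: (penalized_gradient_le FJ h0 (ltW eps0)); exists r6 => // a ar.
  have := Hmin a 0 ar; rewrite normr0 addr0 (ltW r60) => /(_ isT).
  rewrite addr0 -/H; congr (_ <= enorm _).
  by rewrite /H /res; apply/rowP => i; rewrite !mxE; ring.
(* Step length against the normalized residual [e]: at most [h], as the resolvent step requires, and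
   at most [r6], to remain in the box. *)
pose s := Order.min h r6.
have s0 : 0 < s by rewrite lt_min h0.
have sh : s <= h by rewrite ge_min lexx.
have s6 : s <= r6 by rewrite ge_min lexx orbT.
pose u2 := u' + - (s *: e).
have se6 : `|- (s *: e)| <= s.
  by rewrite normrN normrZ (gtr0_norm s0) ler_piMr// ltW.
set dP := P u2 - P u'.
have HdP : enorm dP <= sigma * s.
  apply: (@penalized_resolvent_step R m dP H e s sigma s0 sh (ltW sig0) He).
    have := HP3 u2 u'; rewrite -/dP /u2 [u' + _ - u']addrC addKr; exact.
  have := Hmin 0 (- (s *: e)); rewrite normr0 (ltW r60) => /(_ isT (le_trans se6 s6)).
  rewrite addr0 add0r -/u2 => Hm.
  have -> : H + dP = res x' u2 by rewrite /H /dP /res; apply/rowP => i; rewrite !mxE; ring.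
  by apply: le_trans Hm; rewrite -/H lerD2l lerN2 ler_pM2l.
have ndP : `|dP| <= sigma * s := le_trans (norm_le_enorm _) HdP.
have nearS v : `|v - ub| < r -> `|P v - F xb| < d /\ `|v - P v - ysb| < d.
  move=> vr; have H1 : `|P v - F xb| <= m%:R * `|v - ub|.
    by rewrite -Pub; exact: resolvent_lipschitz_norm HP _ _.
  have H2 : (m%:R + 1) * `|v - ub| < d.
    by apply: lt_le_trans _ rd; rewrite mulrC ltr_pM2r.
  split; first by apply: le_lt_trans H1 (le_lt_trans _ H2); rewrite mulrDl mul1r lerDl.
  have -> : v - P v - ysb = (v - ub) - (P v - F xb).
    by rewrite /ub; apply/rowP => i; rewrite !mxE; ring.
  apply: le_lt_trans (ler_normB _ _) (le_lt_trans _ H2).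
  by rewrite mulrDl mul1r addrC lerD2r.
have u'r3 : `|u' - ub| < r3 + r6.
  have -> : u' - ub = (u' - u) + (u - ub) by rewrite addrA subrK.
  apply: le_lt_trans (ler_normD _ _) _; rewrite [r3 + r6]addrC.
  exact: ler_ltD u'6 uu.
have u'r : `|u' - ub| < r.
  apply: lt_le_trans u'r3 _; rewrite -r333 -addrA lerD2l -r663 -addrA lerDl.
  by rewrite ltW// addr_gt0// addr_gt0.
have u2r : `|u2 - ub| < r.
  rewrite /u2 addrAC; apply: le_lt_trans (ler_normD _ _) _.
  apply: lt_le_trans (ltr_leD u'r3 (le_trans se6 s6)) _.
  by rewrite -addrA r663 -r333 lerDl ltW.
have [a1 a2] := nearS _ u'r; have [b1 b2] := nearS _ u2r.
(* The two graph points differ by [dP] in the first component and by [s e + dP] in the second. The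
   small quantities are [dP] and [e *m K], so the estimate forces [e] to be small. *)
have := HE _ _ _ _ (HP1 u') (HP1 u2) a1 a2 b1 b2; rewrite -/K.
have -> : u' - P u' - (u2 - P u2) = s *: e + dP.
  by rewrite /u2 /dP; apply/rowP => i; rewrite !mxE; ring.
have -> : P u' - P u2 = - dP by rewrite opprB.
rewrite normrN mulmxDl -scalemxAl => H1.
have H2 : s * `|e| <= `|s *: e + dP| + `|dP|.
  rewrite -[X in X * _](gtr0_norm s0) -normrZ -{1}[s *: e](addrK dP).
  exact: ler_normB.
have eK : `|e *m K| <= eps + m%:R * sigma.
  have -> : e *m K = e *m (J x')^T - e *m (J x' - J xb)^T.
    rewrite -mulmxBr; congr (e *m _); apply/matrixP => i j; rewrite /K !mxE; ring.
  apply: le_trans (ler_normB _ _) (lerD (le_trans (norm_le_enorm _) eJ) _).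
  apply: le_trans (norm_mulmx_le _ _) _; rewrite -mulrA ler_wpM2l//.
  rewrite -[leRHS]mul1r ler_pM//.
  exact: le_trans (norm_trmx_le _) JJ.
have H3 : `|s *: (e *m K) + dP *m K| <= s * (eps + m%:R * sigma) + m%:R * (sigma * s) * `|K|.
  apply: le_trans (ler_normD _ _) _; apply: lerD.
    by rewrite normrZ (gtr0_norm s0) ler_pM2l.
  by apply: le_trans (norm_mulmx_le _ _) _; rewrite ler_wpM2r// ler_wpM2l.
have H4 : s * `|e| <= s * (sigma * T).
  apply: le_trans H2 _; apply: le_trans (lerD H1 ndP) _.
  have := ler_wpM2l k0 (lerD ndP H3).
  have := ler_wpM2l k0 (ler_wpM2l (ltW s0) epss).
  rewrite /T; move: `|dP| `|_ + _| `|K| (eps) (sigma) (s) (m%:R) => p q nK ee sg t mm.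
  by clear => H1 H2; lra.
(* A Euclidean unit vector has max norm at least [1 / m], which contradicts [|e| <= sigma * T]. *)
have := enorm_le_norm e; rewrite e1 => H5.
move: H4; rewrite ler_pM2l// => /(ler_wpM2l (ler0n R m)) H4.
by have := le_lt_trans (le_trans H5 H4) sigT; rewrite ltxx.
Qed.

Lemma edist_set_le (R : realType) k (z a : 'rV[R]_k) (A : set 'rV[R]_k) :
  A a -> (Defs.edist z A <= (enorm (z - a))%:E)%E.
Proof. by move=> Aa; apply: ereal_inf_lbound; exists a. Qed.

Lemma edist_set_le_mul (R : realType) k l (z : 'rV[R]_k) (A : set 'rV[R]_k) (w : 'rV[R]_l)
    (B : set 'rV[R]_l) (kappa : R) : 0 < kappa ->
  (forall b, B b -> exists2 a, A a & enorm (z - a) <= kappa * enorm (w - b)) ->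
  (Defs.edist z A <= kappa%:E * Defs.edist w B)%E.
Proof.
move=> k0 H; rewrite -lee_pdivrMl//; apply: le_ereal_inf_tmp => _ [b Bb <-].
rewrite lee_pdivrMl// -EFinM; have [a Aa za] := H b Bb.
by apply: le_trans (edist_set_le z Aa) _; rewrite lee_fin.
Qed.

Lemma enorm_row_mx_le (R : realType) m n (a : 'rV[R]_m) (b : 'rV[R]_n) :
  enorm (row_mx a b) <= enorm a + enorm b.
Proof.
rewrite -(@ler_pXn2r _ 2) ?nnegrE ?addr_ge0 ?enorm_ge0//.
rewrite enorm_sqr dot_row_mx -!enorm_sqr.
have := enorm_ge0 a; have := enorm_ge0 b; move: (enorm a) (enorm b) => p q; clear; nra.
Qed.

Lemma dot_hsubmx (R : realType) m n (z : 'rV[R]_(m + n)) :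
  dot z z = dot (lsubmx z) (lsubmx z) + dot (rsubmx z) (rsubmx z).
Proof. by rewrite -dot_row_mx hsubmxK. Qed.

Lemma enorm_lsubmx_le (R : realType) m n (z : 'rV[R]_(m + n)) : enorm (lsubmx z) <= enorm z.
Proof.
rewrite -(@ler_pXn2r _ 2) ?nnegrE ?enorm_ge0// !enorm_sqr dot_hsubmx.
by rewrite lerDl dot_ge0.
Qed.

Lemma enorm_rsubmx_le (R : realType) m n (z : 'rV[R]_(m + n)) : enorm (rsubmx z) <= enorm z.
Proof.
rewrite -(@ler_pXn2r _ 2) ?nnegrE ?enorm_ge0// !enorm_sqr dot_hsubmx.
by rewrite lerDr dot_ge0.
Qed.

(** The correction found in the variables [(x, u)] is translated back by [ys' = u' - P u'], at the
    cost of the Lipschitz constant of [P]. *)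
Lemma metric_regular_of_local_solution (R : realType) n m (F : 'rV[R]_n -> 'rV[R]_m) J xb
    (S : 'rV[R]_m -> set 'rV[R]_m) P ysb :
  resolvent S P -> S (F xb) ysb -> C1_at F J xb ->
  local_estimate S (F xb) ysb (J xb)^T ->
  metric_regular (fun z : 'rV[R]_(n + m) =>
        [set w | exists y, S y (rsubmx z) /\ w = y - F (lsubmx z)]) (row_mx xb ysb) 0.
Proof.
move=> HP Sb HF HE.
have [C C0 [rho rho0 Hsol]] := local_solution HP Sb HF HE.
have [HP1 HP2 HP3] := HP.
have Pub : P (F xb + ysb) = F xb by exact: HP2.
pose C1 := (n + m)%:R * (m%:R + 1) * C.
have C10 : 0 <= C1 by rewrite !mulr_ge0// ?addr_ge0// ltW.
have Hsol' x y ys w : S y ys -> `|x - xb| < rho -> `|y + ys - (F xb + ysb)| < rho ->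
    enorm (y - F x - w) < rho ->
    exists2 z' : 'rV[R]_(n + m), exists y', S y' (rsubmx z') /\ w = y' - F (lsubmx z') &
      enorm (row_mx x ys - z') <= C1 * enorm (y - F x - w).
  move=> Sy xx uu; rewrite -{1 2}(HP2 _ _ Sy) => Hw.
  have [x' [u' [Hw' Hd]]] := Hsol _ _ _ xx uu Hw.
  exists (row_mx x' (u' - P u')).
    by exists (P u'); rewrite row_mxKl row_mxKr; split => //; exact: HP1.
  apply: le_trans (enorm_le_norm _) _; rewrite /C1 -!mulrA ler_wpM2l//.
  apply: (@le_trans _ _ ((m%:R + 1) * (`|x' - x| + `|u' - (y + ys)|))); last first.
    by rewrite ler_wpM2l// addr_ge0.
  rewrite opp_row_mx add_row_mx; apply: norm_row_mx_le.
    rewrite distrC -[leLHS]mul1r ler_pM// ?addr_ge0//.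
      by rewrite lerDr.
    by rewrite lerDl.
  have -> : ys - (u' - P u') = (P u' - P (y + ys)) - (u' - (y + ys)).
    by rewrite (HP2 _ _ Sy); apply/rowP => i; rewrite !mxE; ring.
  apply: le_trans (ler_normB _ _) _.
  apply: le_trans (lerD (resolvent_lipschitz_norm HP _ _) (lexx _)) _.
  rewrite -[X in _ + X <= _]mul1r -mulrDl ler_wpM2l ?addr_ge0//.
  by rewrite lerDr.
have [e0 e00 He0] := HF 1 ltr01.
have Fxb : frechet F xb (J xb) by have := He0 xb; rewrite subrr normr0 => /(_ e00)[].
pose r := rho / 8.
have r0 : 0 < r by rewrite divr_gt0.
have r8 : 8 * r = rho by rewrite /r; field.
have m1 : (0 : R) < m%:R + 1 by rewrite ltr_wpDl.
have rm0 : 0 < r / (m%:R + 1) by rewrite divr_gt0.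
have [d1 d10 Hd1] := frechet_continuous Fxb rm0.
have Hd1' x : `|x - xb| <= d1 -> enorm (F x - F xb) <= r.
  move=> /Hd1 H; apply: le_trans (enorm_le_norm _) _.
  apply: le_trans (ler_wpM2l (ler0n _ _) H) _.
  rewrite mulrCA -[leRHS]mulr1 ler_pM2l// ler_pdivrMr// mul1r lerDl //.
exists (1 + C1); split; first by rewrite ltr_wpDr.
pose d := Order.min r d1.
have d0 : 0 < d by rewrite lt_min r0.
have dr : d <= r by rewrite ge_min lexx.
exists d; split => // z w zd; rewrite subr0 => wd.
set x := lsubmx z; set ys := rsubmx z.
have zE : z = row_mx x ys by rewrite /x /ys hsubmxK.
have xd : enorm (x - xb) < d.
  apply: le_lt_trans zd; have := enorm_lsubmx_le (z - row_mx xb ysb).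
  by rewrite linearB /= row_mxKl.
have ysd : enorm (ys - ysb) < d.
  apply: le_lt_trans zd; have := enorm_rsubmx_le (z - row_mx xb ysb).
  by rewrite linearB /= row_mxKr.
have Fx : enorm (F x - F xb) <= r.
  apply: Hd1'; apply: le_trans (norm_le_enorm _) _; apply: le_trans (ltW xd) _.
  by rewrite ge_min lexx orbT.
apply: edist_set_le_mul; first by rewrite ltr_wpDr.
move=> _ [y [Sy ->]]; rewrite -/x.
have wE : enorm (w - (y - F x)) = enorm (y - F x - w) by exact: enormB.
(* Only [ys] is known to be close to its reference, not [y]. A small residual forces [y] to be close
   too; for a large one, a solution found from the reference point is within [(1 + C1) * r]. *)
have [Hnear|Hfar] := ltP (enorm (w - (y - F x))) r.
  have xrho : `|x - xb| < rho.
    apply: le_lt_trans (norm_le_enorm _) _; apply: lt_le_trans xd _.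
    by rewrite -r8; apply: le_trans dr _; rewrite ler_peMl ?(ltW r0)// ler1n.
  have urho : `|y + ys - (F xb + ysb)| < rho.
    apply: le_lt_trans (norm_le_enorm _) _.
    have -> : y + ys - (F xb + ysb) = - (w - (y - F x)) + w + (F x - F xb) + (ys - ysb).
      by apply/rowP => i; rewrite !mxE; ring.
    apply: le_lt_trans (enormD _ _) _; apply: le_lt_trans (lerD (enormD _ _) (lexx _)) _.
    apply: le_lt_trans (lerD (lerD (enormD _ _) (lexx _)) (lexx _)) _; rewrite enormN.
    move: Hnear wd Fx ysd dr r8 r0; move: (enorm _) (enorm w) (enorm (F x - F xb)) (enorm (ys - ysb)).
    by move: (d) (r) (rho); clear => *; lra.
  have wrho : enorm (y - F x - w) < rho.
    by rewrite -wE; apply: lt_le_trans Hnear _; rewrite -r8 ler_peMl ?(ltW r0)// ler1n.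
  have [z' Hz' zz'] := Hsol' _ _ _ _ Sy xrho urho wrho.
  exists z' => //; rewrite wE zE; apply: le_trans zz' _.
  by rewrite ler_wpM2r ?enorm_ge0// lerDr.
have [||| z' Hz' zz'] := Hsol' xb (F xb) ysb w Sb.
- by rewrite subrr normr0.
- by rewrite subrr normr0.
- rewrite subrr sub0r enormN; apply: lt_le_trans wd _; apply: le_trans dr _.
  by rewrite -r8 ler_peMl ?(ltW r0)// ler1n.
exists z' => //; move: zz'; rewrite subrr sub0r enormN => zz'.
have -> : z - z' = (z - row_mx xb ysb) + (row_mx xb ysb - z') by rewrite addrA subrK.
apply: le_trans (enormD _ _) _; apply: le_trans (lerD (ltW zd) zz') _.
apply: (@le_trans _ _ ((1 + C1) * r)); last by rewrite ler_wpM2l// addr_ge0.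
rewrite mulrDl mul1r lerD// ler_wpM2l//.
exact: le_trans (ltW wd) dr.
Qed.

Lemma edist_set_lt (R : realType) k (z : 'rV[R]_k) (A : set 'rV[R]_k) (r : R) :
  (Defs.edist z A < r%:E)%E -> exists2 a, A a & enorm (z - a) < r.
Proof. by move=> /ereal_inf_lt [_ [a Aa <-]]; rewrite lte_fin; exists a. Qed.

(** Metric regularity moves a graph point so that its first component shifts by [t vs], up to the
    image of the derivative of [F], which is orthogonal to [vs], and a small error. A regular normal
    close to [(vs, 0)] then bounds [t |vs|^2] by a small multiple of [t]. *)
Lemma coderivative_of_metric_regular (R : realType) n m (F : 'rV[R]_n -> 'rV[R]_m)
    (B : 'M[R]_(n, m)) xb (S : 'rV[R]_m -> set 'rV[R]_m) ysb vs :
  frechet F xb B ->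
  metric_regular (fun z : 'rV[R]_(n + m) =>
        [set w | exists y, S y (rsubmx z) /\ w = y - F (lsubmx z)]) (row_mx xb ysb) 0 ->
  vs *m B^T = 0 -> coderivative S (F xb) ysb 0 vs -> vs = 0.
Proof.
move=> HF [kappa [k0 [d [d0 Hreg]]]] vsB [z_ [v_ [Hz [zl [vl Hv]]]]].
rewrite oppr0 in vl.
(* The added 1 makes the distance bound strict, so that an actual solution lies within [t * C]. *)
pose C := kappa * enorm vs + 1.
have C0 : 0 < C by rewrite ltr_wpDl// mulr_ge0 ?enorm_ge0// ltW.
pose D := `|vs| + n%:R * C * `|B| + C.
have D0 : 0 <= D by rewrite addr_ge0 ?(ltW C0)// addr_ge0// !mulr_ge0// ltW.
pose E := (m + m)%:R * (D + C).
have E0 : 0 <= E by rewrite mulr_ge0// addr_ge0// ltW.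
pose M := E + m%:R * `|vs| * C + m%:R * D + m%:R * C.
have M0 : 0 <= M by rewrite !addr_ge0// ?mulr_ge0 ?(ltW C0)// mulr_ge0.
suff key del : 0 < del -> del <= 1 -> dot vs vs <= del * M.
  apply: dot_eq0; apply/eqP; rewrite eq_le dot_ge0 andbT; apply/ler_addgt0Pr => e e0.
  have M1 : 0 < M + 1 by rewrite ltr_wpDl.
  rewrite add0r; apply: le_trans (key (Order.min 1 (e / (M + 1))) _ _) _.
  - by rewrite lt_min ltr01 divr_gt0.
  - by rewrite ge_min lexx.
  apply: (@le_trans _ _ (e / (M + 1) * (M + 1))); last by rewrite divfK// gt_eqF.
  by rewrite ler_pM// ?lerDl// ?ge_min ?lexx ?orbT// le_min ler01 divr_ge0 ?(ltW e0) ?(ltW M1).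
move=> del0 del1.
have d20 : 0 < d / 2 by rewrite divr_gt0.
have [N1 HN1] : exists N, forall j, (N <= j)%N -> enorm (z_ j - row_mx (F xb) ysb) < d / 2.
  have : (fun j => enorm (z_ j - row_mx (F xb) ysb)) @ \oo --> enorm (row_mx (F xb) ysb - row_mx (F xb) ysb).
    by apply: cvg_enorm; apply: cvgB => //; exact: cvg_const.
  move=> /cvg_seqP /(_ _ d20)[N HN]; exists N => j /HN; rewrite subrr enorm0 subr0.
  by rewrite ger0_norm ?enorm_ge0.
have [N2 HN2] : exists N, forall j, (N <= j)%N -> `|v_ j - row_mx vs 0| < del.
  by move/cvg_seqP : vl => /(_ del del0).
pose k := maxn N1 N2.
have zk := HN1 k (leq_maxl _ _); have vk := HN2 k (leq_maxr _ _).
set y := lsubmx (z_ k); set ys := rsubmx (z_ k).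
have Sy : S y ys := Hz k.
set a := lsubmx (v_ k); set b := rsubmx (v_ k).
have ad : `|a - vs| <= del.
  by apply: le_trans (ltW vk); have := norm_lsubmx_le (v_ k - row_mx vs 0); rewrite linearB /= row_mxKl.
have bd : `|b| <= del.
  by apply: le_trans (ltW vk); have := norm_rsubmx_le (v_ k - row_mx vs 0); rewrite linearB /= row_mxKr subr0.
have yd : enorm (y - F xb) < d / 2.
  by apply: le_lt_trans zk; have := enorm_lsubmx_le (z_ k - row_mx (F xb) ysb); rewrite linearB /= row_mxKl.
have ysd : enorm (ys - ysb) < d.
  apply: lt_trans (_ : _ < d / 2) _; last by rewrite ltr_pdivrMr// ltr_pMr// ltr1n.
  by apply: le_lt_trans zk; have := enorm_rsubmx_le (z_ k - row_mx (F xb) ysb); rewrite linearB /= row_mxKr.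
have [r1 [r10 Hr1]] := Hv k del del0.
have [r2 r20 Hr2] := HF del del0.
have E1 : 0 < E + 1 by rewrite ltr_wpDl.
have nv1 : 0 < enorm vs + 1 by rewrite ltr_wpDl// enorm_ge0.
pose t := Order.min (d / 2 / (enorm vs + 1)) (Order.min (r1 / (E + 1)) (r2 / C)).
have t0 : 0 < t by rewrite !lt_min !divr_gt0.
have td : t * enorm vs < d / 2.
  apply: (@lt_le_trans _ _ (t * (enorm vs + 1))); first by rewrite ltr_pM2l// ltrDl.
  by rewrite -ler_pdivlMr// ge_min lexx.
have tr1 : t * E < r1.
  apply: (@lt_le_trans _ _ (t * (E + 1))); first by rewrite ltr_pM2l// ltrDl.
  by rewrite -ler_pdivlMr// !ge_min lexx orbT.
have tr2 : t * C <= r2 by rewrite -ler_pdivlMr// !ge_min lexx !orbT.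
(* At [(xb, ys)] the value [y - F xb] is available, so the residual for the target [w] is exactly
   [t vs]. *)
pose z := row_mx xb ys; pose w := y - F xb + t *: vs.
have [z' [y' [Sy' wy']] zz'] : exists2 z' : 'rV[R]_(n + m),
    (exists y', S y' (rsubmx z') /\ w = y' - F (lsubmx z')) & enorm (z - z') < t * C.
  apply: edist_set_lt; apply: le_lt_trans (Hreg z w _ _) _.
  - rewrite /z opp_row_mx add_row_mx subrr; apply: le_lt_trans (enorm_row_mx_le _ _) _.
    by rewrite enorm0 add0r.
  - rewrite subr0 /w; apply: le_lt_trans (enormD _ _) _; rewrite enormZ (gtr0_norm t0).
    by rewrite [d]splitr; exact: ltrD.
  have H : (Defs.edist w [set w | exists y, S y (rsubmx z) /\ w = (y - F (lsubmx z))%R] <= (t * enorm vs)%:E)%E.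
    have -> : t * enorm vs = enorm (w - (y - F xb)).
      by rewrite /w addrC addKr enormZ gtr0_norm.
    by apply: edist_set_le; exists y; rewrite /z row_mxKl row_mxKr.
  apply: le_lt_trans (lee_wpmul2l _ H) _; first by rewrite lee_fin ltW.
  by rewrite -EFinM lte_fin mulrCA ltr_pM2l// ltrDl.
set x' := lsubmx z' in wy'; set ys' := rsubmx z' in Sy'.
have xx' : `|x' - xb| <= t * C.
  rewrite distrC; apply: le_trans (norm_le_enorm _) _; apply: le_trans (ltW zz').
  by have := enorm_lsubmx_le (z - z'); rewrite linearB /= row_mxKl.
have yss : `|ys' - ys| <= t * C.
  rewrite distrC; apply: le_trans (norm_le_enorm _) _; apply: le_trans (ltW zz').
  by have := enorm_rsubmx_le (z - z'); rewrite linearB /= row_mxKr.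
pose rr := F x' - F xb - (x' - xb) *m B.
have rrd : `|rr| <= del * (t * C).
  have := Hr2 (x' - xb) (le_trans xx' tr2); rewrite [xb + _]addrC subrK -/rr.
  by move/le_trans; apply; rewrite ler_pM2l.
have yy : y' - y = t *: vs + (x' - xb) *m B + rr.
  have -> : y' = w + F x' by rewrite wy' subrK.
  by rewrite /w /rr; apply/rowP => i; rewrite !mxE; ring.
have yyD : `|y' - y| <= t * D.
  rewrite yy; apply: le_trans (ler_normD _ _) _.
  apply: le_trans (lerD (ler_normD _ _) rrd) _.
  rewrite /D [t * (_ + C)]mulrDr [t * (`|vs| + _)]mulrDr normrZ (gtr0_norm t0); apply: lerD; first apply: lerD => //.
    apply: le_trans (norm_mulmx_le _ _) _; rewrite [leRHS]mulrA ler_wpM2r//.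
    by rewrite [leRHS]mulrCA ler_wpM2l.
  by rewrite ler_piMl// mulr_ge0// ltW.
have Hn := Hr1 (row_mx y' ys').
have zzE : enorm (row_mx y' ys' - z_ k) <= t * E.
  apply: le_trans (enorm_le_norm _) _; rewrite /E mulrCA ler_wpM2l//.
  rewrite -[z_ k]hsubmxK opp_row_mx add_row_mx mulrDr; apply: norm_row_mx_le.
    by apply: le_trans yyD _; rewrite lerDl mulr_ge0// ltW.
  by apply: le_trans yss _; rewrite lerDr mulr_ge0// ltW.
have {}Hn : dot (v_ k) (row_mx y' ys' - z_ k) <= del * (t * E).
  apply: le_trans (Hn _ (le_lt_trans zzE tr1)) _.
    by rewrite /gph /= row_mxKl row_mxKr.
  by rewrite ler_pM2l.
have vE : dot (v_ k) (row_mx y' ys' - z_ k) = dot a (y' - y) + dot b (ys' - ys).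
  by rewrite -[v_ k]hsubmxK -[z_ k in LHS]hsubmxK opp_row_mx add_row_mx dot_row_mx.
have vB0 : dot vs ((x' - xb) *m B) = 0 by rewrite dotC dot_mulmx vsB dot0r.
have aE : dot a (y' - y) = t * dot vs vs + dot vs rr + dot (a - vs) (y' - y).
  have -> : dot a (y' - y) = dot vs (y' - y) + dot (a - vs) (y' - y).
    by rewrite -dotDl [vs + _]addrC subrK.
  congr (_ + _); rewrite yy dotDr; congr (_ + _).
  by rewrite dotDr vB0 addr0 dotZr.
rewrite vE aE in Hn.
have h1 : - (t * (del * (m%:R * `|vs| * C))) <= dot vs rr.
  rewrite lerNl -dotNl; apply: le_trans (ler_norm _) _; apply: le_trans (norm_dot_le _ _) _.
  rewrite normrN; apply: le_trans (ler_wpM2l _ rrd) _; first by rewrite mulr_ge0.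
  by rewrite le_eqVlt; apply/orP; left; apply/eqP; ring.
have h2 : - (t * (del * (m%:R * D))) <= dot (a - vs) (y' - y).
  rewrite lerNl -dotNl; apply: le_trans (ler_norm _) _; apply: le_trans (norm_dot_le _ _) _.
  rewrite normrN; apply: (@le_trans _ _ (m%:R * del * (t * D))).
    by rewrite ler_pM// ?mulr_ge0// ler_wpM2l.
  by rewrite le_eqVlt; apply/orP; left; apply/eqP; ring.
have h3 : - (t * (del * (m%:R * C))) <= dot b (ys' - ys).
  rewrite lerNl -dotNl; apply: le_trans (ler_norm _) _; apply: le_trans (norm_dot_le _ _) _.
  rewrite normrN; apply: (@le_trans _ _ (m%:R * del * (t * C))).
    by rewrite ler_pM// ?mulr_ge0// ler_wpM2l.
  by rewrite le_eqVlt; apply/orP; left; apply/eqP; ring.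
rewrite -(ler_pM2l t0) /M.
move: Hn h1 h2 h3; move: (dot vs rr) (dot (a - vs) _) (dot b _) (dot vs vs).
move: (t) (del) (m%:R * `|vs| * C) (m%:R * D) (m%:R * C) (E).
by clear => *; lra.
Qed.

(** * Epi-convergence and the quadratic bundle *)

Lemma econvex_fin (R : realType) k (f : 'rV[R]_k -> \bar R) :
  (forall x, f x != -oo%E) ->
  (forall x y t (a b : R), 0 < t < 1 -> f x = a%:E -> f y = b%:E ->
     (f (t *: x + (1 - t) *: y)%R <= (t * a + (1 - t) * b)%:E)%E) -> econvex f.
Proof.
move=> fNy H x y t t01; have [t0 t1] := andP t01.
case Ex : (f x) (fNy x) => [a| |] // _; case Ey : (f y) (fNy y) => [b| |] // _.
- by rewrite -!EFinM -EFinD; exact: H.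
- by rewrite gt0_muley ?lte_fin ?subr_gt0// addey// ?leey.
- by rewrite gt0_muley ?lte_fin// addye// ?leey.
- by rewrite !gt0_muley ?lte_fin ?subr_gt0// leey.
Qed.

Lemma epi_cvg_ge0 (R : realType) k (f_ : nat -> 'rV[R]_k -> \bar R) (f : 'rV[R]_k -> \bar R) :
  (forall j x, (0 <= f_ j x)%E) -> epi_cvg f_ f -> forall x, (0 <= f x)%E.
Proof.
move=> f0 Hf x; rewrite leNgt; apply/negP => fx.
have [_ [x_ [_ /(_ 0 fx)[N /(_ N (leqnn N))]]]] := Hf x.
by rewrite ltNge f0.
Qed.

Lemma epi_cvg_subseq (R : realType) k (f_ : nat -> 'rV[R]_k -> \bar R) (f : 'rV[R]_k -> \bar R)
    (s : nat -> nat) :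
  (forall j, (j <= s j)%N) -> epi_cvg f_ f -> epi_cvg (fun j => f_ (s j)) f.
Proof.
move=> sj Hf x; have [H1 H2] := Hf x; split; last first.
  have [x_ [xl Hx]] := H2; exists (x_ \o s); split; first exact: cvg_subseq.
  by move=> b /Hx[N HN]; exists N => j Nj; apply: HN; apply: leq_trans Nj (sj j).
move=> x_ /cvg_seqP xl a ax; apply: contrapT => Hno.
have bad N : exists j, (N <= j)%N /\ (f_ (s j) (x_ j) <= a%:E)%E.
  apply: contrapT => HN; apply: Hno; exists N => j Nj.
  by rewrite ltNge; apply/negP => H; apply: HN; exists j.
(* A test sequence along [s] must be spread over all indices. As [s] may take a value several times,
   each index receives one violating term if there is any, and the limit [x] otherwise. *)
pose Q i j := s j = i /\ (f_ i (x_ j) <= a%:E)%E.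
have /choice[X HX] : forall i, exists y, (exists2 j, Q i j & y = x_ j) \/ (y = x /\ ~ exists j, Q i j).
  move=> i; have [[j Hj]|Hj] := pselect (exists j, Q i j).
    by exists (x_ j); left; exists j.
  by exists x; right.
have Xl : X @ \oo --> x.
  apply/cvg_seqP => e e0; have [N HN] := xl e e0.
  exists (\max_(j < N) s j).+1 => i Ni.
  have [[j [sji _] ->]|[-> _]] := HX i; last by rewrite subrr normr0.
  apply: HN; rewrite leqNgt; apply/negP => jN; move: Ni; rewrite -sji ltnNge.
  by move/negP; apply; exact: (leq_bigmax (Ordinal jN)).
have [N HN] := H1 X Xl a ax; have [j [Nj Hj]] := bad N.
have := HN _ (leq_trans Nj (sj j)); rewrite ltNge => /negP; apply.
have [[j' [_ Hj'] ->]|[_ Hn]] := HX (s j) => //.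
by exfalso; apply: Hn; exists j.
Qed.

Lemma econvex_epi (R : realType) k (f_ : nat -> 'rV[R]_k -> \bar R) (f : 'rV[R]_k -> \bar R) :
  (forall j x, (0 <= f_ j x)%E) -> (forall j, econvex (f_ j)) ->
  epi_cvg f_ f -> econvex f.
Proof.
move=> f0 fc Hf; have f0' := epi_cvg_ge0 f0 Hf.
apply: econvex_fin => [x|x y t a b t01 fx fy].
  by apply/eqP => E; have := f0' x; rewrite E.
have [t0 t1] := andP t01; have t1' : 0 < 1 - t by rewrite subr_gt0.
set z := t *: x + (1 - t) *: y; set c := t * a + (1 - t) * b.
rewrite leNgt; apply/negP => cz.
have [c' cc' c'z] : exists2 c' : R, c < c' & (c'%:E < f z)%E.
  case: (f z) cz => [r| |] //; last by exists (c + 1); rewrite ?ltrDl ?ltry.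
  by rewrite lte_fin => cr; exists ((c + r) / 2); rewrite ?lte_fin midf_lt.
have [Hz _] := Hf z; have [_ [x_ [xl Hx]]] := Hf x; have [_ [y_ [yl Hy]]] := Hf y.
have eta0 : 0 < c' - c by rewrite subr_gt0.
have [|N1 H1] := Hx (a + (c' - c)); first by rewrite fx lte_fin ltrDl.
have [|N2 H2] := Hy (b + (c' - c)); first by rewrite fy lte_fin ltrDl.
have zl : (fun j => t *: x_ j + (1 - t) *: y_ j) @ \oo --> z.
  by apply: cvgD; apply: cvgZ => //; exact: cvg_const.
have [N3 H3] := Hz _ zl c' c'z.
pose N := maxn N1 (maxn N2 N3).
have j1 : (N1 <= N)%N by exact: leq_maxl.
have j2 : (N2 <= N)%N by rewrite /N leq_max leq_maxl orbT.
have j3 : (N3 <= N)%N by rewrite /N leq_max leq_maxr orbT.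
have := lt_le_trans (H3 _ j3) (fc N (x_ N) (y_ N) t t01).
move: (H1 _ j1) (H2 _ j2) (f0 N (x_ N)) (f0 N (y_ N)).
case: (f_ N (x_ N)) => [r| |] //; case: (f_ N (y_ N)) => [r'| |] //.
rewrite -!EFinM -EFinD !lte_fin => h1 h2 _ _.
apply/negP; rewrite -leNgt.
have := ler_wpM2l (ltW t0) (ltW h1); have := ler_wpM2l (ltW t1') (ltW h2).
by rewrite /c; clear -t0 => *; lra.
Qed.

(** The lower half of epi-convergence is used along the minimizers, the upper half along a recovery
    sequence of the competitor. *)
Lemma epi_minimizer (R : realType) k (f_ : nat -> 'rV[R]_k -> \bar R) (f : 'rV[R]_k -> \bar R)
    (w_ : nat -> 'rV[R]_k) (w v : 'rV[R]_k) (c : R) :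
  (forall j x, (0 <= f_ j x)%E) -> epi_cvg f_ f -> w_ @ \oo --> w ->
  (forall j x, (f_ j (w_ j) + (c * dot (w_ j - v) (w_ j - v))%:E <=
     f_ j x + (c * dot (x - v) (x - v))%:E)%E) ->
  forall x, (f w + (c * dot (w - v) (w - v))%:E <= f x + (c * dot (x - v) (x - v))%:E)%E.
Proof.
move=> f0 Hf wl Hmin x; have f0' := epi_cvg_ge0 f0 Hf.
case fx : (f x) (f0' x) => [b| |] // _; last by rewrite leey.
set X := c * dot (x - v) (x - v); set W := c * dot (w - v) (w - v).
rewrite -EFinD -leeBrDr// -EFinB leNgt; apply/negP => cz.
have [a ca az] : exists2 a : R, b + X - W < a & (a%:E < f w)%E.
  case: (f w) cz => [r| |] //; last by exists (b + X - W + 1); rewrite ?ltrDl ?ltry.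
  by rewrite lte_fin => cr; exists ((b + X - W + r) / 2); rewrite ?lte_fin midf_lt.
have [Hw _] := Hf w; have [_ [x_ [xl Hx]]] := Hf x.
have [N1 H1] := Hw _ wl a az.
pose eta := (a - (b + X - W)) / 2.
have eta0 : 0 < eta by rewrite divr_gt0// subr_gt0.
have [|N2 H2] := Hx (b + eta); first by rewrite fx lte_fin ltrDl.
have quad_cvg (z_ : nat -> 'rV[R]_k) (z : 'rV[R]_k) : z_ @ \oo --> z ->
    (fun j => c * dot (z_ j - v) (z_ j - v)) @ \oo --> c * dot (z - v) (z - v).
  move=> zl; have H : (fun j => z_ j - v) @ \oo --> z - v by apply: cvgB => //; exact: cvg_const.
  by apply: cvgM; [exact: cvg_const|exact: cvg_dot].
have Hlim : (fun j => b + eta + c * dot (x_ j - v) (x_ j - v) - c * dot (w_ j - v) (w_ j - v)) @ \oo -->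
    b + eta + X - W.
  apply: cvgB; last exact: quad_cvg.
  by apply: cvgD; [exact: cvg_const|exact: quad_cvg].
have : a <= b + eta + X - W.
  apply: (ler_cvg_to (cvg_const a) Hlim); exists (maxn N1 N2) => // j /=.
  rewrite geq_max => /andP[j1 j2].
  have := Hmin j (x_ j); move: (H1 _ j1) (H2 _ j2) (f0 j (x_ j)).
  case: (f_ j (w_ j)) => [r| |] //; case: (f_ j (x_ j)) => [r'| |] //.
  by rewrite -!EFinD !lee_fin !lte_fin; clear => *; lra.
by rewrite /eta; move: ca; clear => *; lra.
Qed.

(** The local inequality at [x + t (z - x)] with small [t] is carried to [z] by convexity, the error
    being a fraction of [eta]. *)
Lemma regular_subdiff_convex (R : realType) k (f : 'rV[R]_k -> \bar R) x v :
  econvex f -> (forall z, f z != -oo%E) ->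
  regular_subdiff f x v -> forall z, (f x + (dot v (z - x))%:E <= f z)%E.
Proof.
move=> fc fNy [fx Hv] z.
case fz : (f z) (fNy z) => [b| |] // _; last by rewrite leey.
rewrite -(fineK fx); set a := fine (f x); rewrite -EFinD lee_fin.
apply/ler_addgt0Pr => eta eta0.
have zx1 : 0 < enorm (z - x) + 1 by rewrite ltr_wpDl// enorm_ge0.
have [d [d0 Hd]] := Hv (eta / (enorm (z - x) + 1)) (divr_gt0 eta0 zx1).
pose t := Order.min 2^-1 (d / (enorm (z - x) + 1)).
have t0 : 0 < t by rewrite lt_min invr_gt0 ltr0n divr_gt0.
have t1 : t < 1 by rewrite gt_min invf_lt1// ltr1n.
have td : t * enorm (z - x) < d.
  apply: (@lt_le_trans _ _ (t * (enorm (z - x) + 1))); first by rewrite ltr_pM2l// ltrDl.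
  by rewrite -ler_pdivlMr// ge_min lexx orbT.
have E : t *: z + (1 - t) *: x - x = t *: (z - x).
  by apply/rowP => i; rewrite !mxE; ring.
have := Hd (t *: z + (1 - t) *: x); rewrite E enormZ (gtr0_norm t0) => /(_ td) H1.
have := le_trans H1 (fc z x t _); rewrite t0 t1 fz -(fineK fx) -/a => /(_ isT).
rewrite -!EFinM -!EFinD lee_fin dotZr => H2.
have H3 : eta / (enorm (z - x) + 1) * enorm (z - x) <= eta.
  by rewrite mulrAC ler_pdivrMr// ler_pM2l// lerDl.
rewrite -(ler_pM2l t0).
have := ler_wpM2l (ltW t0) H3; move: H2.
by move: (dot _ _) (enorm _) (eta / _) (t) (a); clear => *; lra.
Qed.

Lemma limiting_subdiff_convex (R : realType) k (f : 'rV[R]_k -> \bar R) x v :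
  econvex f -> (forall z, f z != -oo%E) ->
  limiting_subdiff f x v -> forall z, (f x + (dot v (z - x))%:E <= f z)%E.
Proof.
move=> fc fNy [fx [x_ [v_ [xl [vl [Hv fl]]]]]] z.
case fz : (f z) (fNy z) => [b| |] // _; last by rewrite leey.
rewrite -(fineK fx) -EFinD lee_fin.
have Hdot : (fun j => dot (v_ j) (z - x_ j)) @ \oo --> dot v (z - x).
  by apply: cvg_dot => //; apply: cvgB => //; exact: cvg_const.
have Hlim : (fun j => fine (f (x_ j)) + dot (v_ j) (z - x_ j)) @ \oo --> fine (f x) + dot v (z - x).
  exact: cvgD.
have := cvg_seq_ler Hlim (cvg_const b); apply => j.
have [fxj _] := Hv j; have := regular_subdiff_convex fc fNy (Hv j) z.
by rewrite fz -(fineK fxj) -EFinD lee_fin.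
Qed.

Lemma sdqE (R : realType) m (g : 'rV[R]_m -> \bar R) y ys t w (a b : R) :
  g y = a%:E -> g (y + t *: w) = b%:E ->
  sdq g y ys t w = ((b - a - t * dot ys w) * (2 / t ^+ 2))%:E.
Proof. by move=> Ha Hb; rewrite /sdq Ha Hb -!EFinB -EFinM. Qed.

Lemma sdq_pinfty (R : realType) m (g : 'rV[R]_m -> \bar R) y ys t w (a : R) :
  0 < t -> g y = a%:E -> g (y + t *: w) = +oo%E -> sdq g y ys t w = +oo%E.
Proof.
move=> t0 Ha Hb; rewrite /sdq Ha Hb -!EFinN !addye//.
by rewrite gt0_mulye// lte_fin divr_gt0// exprn_gt0.
Qed.

Lemma sdq_ge0 (R : realType) m (g : 'rV[R]_m -> \bar R) y ys t w :
  (forall y, g y != -oo%E) -> csubdiff g y ys -> 0 < t -> (0 <= sdq g y ys t w)%E.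
Proof.
move=> gNy [gy H] t0; have := H (y + t *: w).
case Eb : (g (y + t *: w)) (gNy (y + t *: w)) => [b| |] // _; last first.
  by rewrite (sdq_pinfty ys t0 (esym (fineK gy)) Eb) leey.
rewrite (sdqE ys (esym (fineK gy)) Eb) -{1}(fineK gy) -EFinD !lee_fin [y + _]addrC addrK dotZr => h.
by rewrite mulr_ge0 ?divr_ge0// ?exprn_ge0 ?(ltW t0)//; move: h; clear => *; lra.
Qed.

Lemma sdq_econvex (R : realType) m (g : 'rV[R]_m -> \bar R) y ys t :
  (forall y, g y != -oo%E) -> econvex g -> csubdiff g y ys -> 0 < t -> econvex (sdq g y ys t).
Proof.
move=> gNy gc Hy t0; have [gy _] := Hy.
have Ea := esym (fineK gy); set a := fine (g y) in Ea.
apply: econvex_fin => [x|x x' s A A' s01].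
  by apply/eqP => E; have := sdq_ge0 x gNy Hy t0; rewrite E.
case Eb : (g (y + t *: x)) (gNy (y + t *: x)) => [b| |] // _; last by rewrite (sdq_pinfty ys t0 Ea Eb).
case Eb' : (g (y + t *: x')) (gNy (y + t *: x')) => [b'| |] // _; last by rewrite (sdq_pinfty ys t0 Ea Eb').
rewrite (sdqE ys Ea Eb) (sdqE ys Ea Eb') => -[<-] [<-].
have := gc (y + t *: x) (y + t *: x') s s01.
have -> : s *: (y + t *: x) + (1 - s) *: (y + t *: x') = y + t *: (s *: x + (1 - s) *: x').
  by apply/rowP => i; rewrite !mxE; ring.
set z := s *: x + _; rewrite Eb Eb' -!EFinM -EFinD.
case Ez : (g (y + t *: z)) (gNy (y + t *: z)) => [c| |] // _.
rewrite (sdqE ys Ea Ez) !lee_fin => H.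
have -> : dot ys z = s * dot ys x + (1 - s) * dot ys x' by rewrite /z dotDr !dotZr.
have r0 : 0 <= 2 / t ^+ 2 by rewrite divr_ge0// exprn_ge0// ltW.
rewrite [s * (_ * _)]mulrA [(1 - s) * (_ * _)]mulrA -mulrDl ler_wpM2r//; move: H.
by move: (dot ys x) (dot ys x') => p q; clear => *; lra.
Qed.

Lemma sdq_prox (R : realType) m (g : 'rV[R]_m -> \bar R) P u t v :
  (forall y, g y != -oo%E) -> resolvent (csubdiff g) P -> 0 < t ->
  let p := t^-1 *: (P (u + t *: v) - P u) in
  let c := (fine (g (P (u + t *: v))) - fine (g (P u)) - t * dot (u - P u) p) * (2 / t ^+ 2) in
  sdq g (P u) (u - P u) t p = c%:E /\
  forall w, ((c + 2 * dot (v - p) (w - p))%:E <= sdq g (P u) (u - P u) t w)%E.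
Proof.
move=> gNy [HP1 HP2 HP3] t0 p c.
have [gy Hy] := HP1 u; have [gy' Hy'] := HP1 (u + t *: v).
have Ea := esym (fineK gy); have Eb := esym (fineK gy').
have tp : P u + t *: p = P (u + t *: v).
  by rewrite /p scalerA mulfV ?gt_eqF// scale1r addrC subrK.
have Eb' : g (P u + t *: p) = (fine (g (P (u + t *: v))))%:E by rewrite tp.
split; first exact: sdqE Ea Eb'.
move=> w; have := Hy' (P u + t *: w).
case Ew : (g (P u + t *: w)) (gNy (P u + t *: w)) => [b| |] // _; last first.
  by move=> _; rewrite (sdq_pinfty (u - P u) t0 Ea Ew) leey.
rewrite (sdqE _ Ea Ew) {1}Eb -EFinD !lee_fin /c.
have -> : u + t *: v - P (u + t *: v) = (u - P u) + t *: (v - p).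
  by rewrite -tp; move: (P u) (p) => X Y; apply/rowP => i; rewrite !mxE; ring.
have -> : P u + t *: w - P (u + t *: v) = t *: (w - p).
  by rewrite -tp; move: (P u) (p) => X Y; apply/rowP => i; rewrite !mxE; ring.
rewrite dotZr dotDl dotZl [dot (u - P u) (w - p)]dotBr.
move: (fine (g (P (u + t *: v)))) (fine (g (P u))) (dot (u - P u) p) (dot (u - P u) w) (dot (v - p) (w - p)).
move: t0; move: (t) => r r0; clear -r0 => A B C D E H.
have -> : (A - B - r * C) * (2 / r ^+ 2) + 2 * E = (A - B - r * C + r ^+ 2 * E) * (2 / r ^+ 2).
  by field; rewrite gt_eqF.
apply: ler_wpM2r; first by rewrite divr_ge0// exprn_ge0// ltW.
by rewrite expr2; lra.
Qed.

Lemma econvex_scale (R : realType) k (f : 'rV[R]_k -> \bar R) (c : R) :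
  0 <= c -> (forall x, 0 <= f x)%E -> econvex f -> econvex (fun x => (c%:E * f x)%E).
Proof.
move=> c0 f0 fc x y t t01; have [t0 t1] := andP t01.
apply: le_trans (lee_wpmul2l _ (fc x y t t01)) _; first by rewrite lee_fin.
rewrite ge0_muleDr ?mule_ge0 ?lee_fin ?(ltW t0) ?subr_ge0 ?(ltW t1)//.
by rewrite !(muleCA c%:E).
Qed.

(** Since [vs] is a subgradient of [q] at 0, the proximal point of [vs] for [q] is 0. Difference
    quotients of [P] in the direction [vs] are proximal points of the approximating functions, so
    suitable ones tend to 0. *)
Lemma strict_derivative_of_quad (R : realType) m (g : 'rV[R]_m -> \bar R) P yb ysb q vs :
  (forall y, g y != -oo%E) -> econvex g -> resolvent (csubdiff g) P ->
  quad_bundle g yb ysb q -> limiting_subdiff q 0 vs ->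
  strict_derivative (csubdiff g) yb ysb 0 vs.
Proof.
move=> gNy gc HP [[q0 _] [y_ [ys_ [h_ [Sj [yl [ysl [Htw Hepi]]]]]]]] Hvs.
have [HP1 HP2 HP3] := HP.
pose u_ k := y_ k + ys_ k.
have Pu k : P (u_ k) = y_ k by exact: HP2.
have uP k : u_ k - P (u_ k) = ys_ k by rewrite Pu /u_ addrC addKr.
pose w_ k t := t^-1 *: (P (u_ k + t *: vs) - P (u_ k)).
have w_le k t : 0 < t -> `|w_ k t| <= m%:R * `|vs|.
  move=> t0; rewrite /w_ normrZ normfV (gtr0_norm t0) ler_pdivrMl//.
  apply: le_trans (resolvent_lipschitz_norm HP _ _) _.
  by rewrite [_ + _ - _]addrC addKr normrZ (gtr0_norm t0) mulrCA.
have sdq0 k t x : 0 < t -> (0 <= sdq g (y_ k) (ys_ k) t x)%E.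
  by move=> t0; exact: sdq_ge0.
have h0 k x : (0 <= h_ k x)%E.
  have [_ H] := Htw k; have [tp _] := @to0p_inv_nat R.
  by apply: epi_cvg_ge0 (H _ (@to0p_inv_nat R)) _ => j z; exact: sdq0.
have hc k : econvex (h_ k).
  have [_ H] := Htw k; have [tp _] := @to0p_inv_nat R.
  apply: econvex_epi (H _ (@to0p_inv_nat R)) => [j z|j]; first exact: sdq0.
  exact: sdq_econvex.
have hh0 k x : (0 <= (2^-1)%:E * h_ k x)%E by rewrite mule_ge0// lee_fin.
have qc : econvex q.
  by apply: econvex_epi Hepi => // k; apply: econvex_scale.
have qge0 := epi_cvg_ge0 hh0 Hepi.
have qvs w : ((dot vs w)%:E <= q w)%E.
  have := limiting_subdiff_convex qc _ Hvs w.
  rewrite q0 add0e subr0; apply => z.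
  by apply/eqP => E; have := qge0 z; rewrite E.
(* the minimizers w_ k t of the proximal regularizations converge to 0 *)
have key (e : R) N : 0 < e -> exists k t, [/\ (N <= k)%N, 0 < t, t < e & `|w_ k t| < e].
  move=> e0; apply: contrapT => Hno.
  have Hge k t : (N <= k)%N -> 0 < t -> t < e -> e <= `|w_ k t|.
    by move=> Nk t0 te; rewrite leNgt; apply/negP => H; apply: Hno; exists k, t.
  pose t j : R := e / 2 * j.+1%:R^-1.
  have t0 j : 0 < t j by rewrite mulr_gt0 ?divr_gt0 ?invr_gt0.
  have te j : t j < e.
    apply: (@le_lt_trans _ _ (e / 2)); last by rewrite ltr_pdivrMr// ltr_pMr// ltr1n.
    by rewrite ler_piMr ?divr_ge0 ?(ltW e0)// invf_le1// ler1n.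
  have tl : t @ \oo --> (0 : R) by apply: cvg_mulr0; exact: cvg_inv_nat.
  have /choice[p Hp] : forall k, exists p, (N <= k)%N -> [/\ e <= `|p|, `|p| <= m%:R * `|vs| &
      forall x, (h_ k p + (1 * dot (p - vs) (p - vs))%:E <= h_ k x + (1 * dot (x - vs) (x - vs))%:E)%E].
    move=> k; have [Nk|] := leqP N k; last by exists 0.
    have [s [p [sj Hp]]] := bounded_rV_subseq (fun j => w_le k _ (t0 j)).
    exists p => _; split.
    - have := cvg_seq_ler (cvg_const e) (cvg_norm_seq Hp); apply => j /=.
      exact: Hge.
    - have := cvg_seq_ler (cvg_norm_seq Hp) (cvg_const (m%:R * `|vs|)); apply => j /=.
      exact: w_le.
    have ts : to0p (t \o s) by split => [j|]; [exact: t0|exact: cvg_subseq].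
    have [_ /(_ _ ts) Hep] := Htw k.
    apply: (epi_minimizer _ Hep Hp) => [j x|j x]; first exact/sdq0/t0.
    rewrite !mul1r.
    have [Ec Hc] := sdq_prox (u_ k) vs gNy HP (t0 (s j)).
    rewrite -/(w_ k (t (s j))) uP Pu in Ec Hc.
    set W := w_ k (t (s j)) in Ec Hc *; set c := (_ * (2 / _)) in Ec Hc.
    have := Hc x; rewrite /= Ec; case: (sdq _ _ _ _ x) => [b| |] //; last by move=> _; rewrite leey.
    rewrite -!EFinD !lee_fin.
    have -> : dot (x - vs) (x - vs) = dot (x - W) (x - W) - 2 * dot (vs - W) (x - W) + dot (W - vs) (W - vs).
      have -> : x - vs = (x - W) - (vs - W) by rewrite opprB addrA subrK.
      have -> : W - vs = - (vs - W) by rewrite opprB.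
      by move: (x - W) (vs - W) => X V; rewrite !dotD (dotC V X); ring.
    have := dot_ge0 (x - W); move: (dot _ _) (dot _ _) (dot _ _) => X Y Z.
    by clear => *; lra.
  have pb k : `|p (k + N)%N| <= m%:R * `|vs| by have [] := Hp (k + N)%N (leq_addl _ _).
  have [s [l [sj Hl]]] := bounded_rV_subseq pb.
  have sN j : (j <= s j + N)%N by apply: leq_trans (sj j) (leq_addr _ _).
  (* The bundle is made of halves of second subderivatives, so the penalty is halved as well.
     Comparing [l] with 0 and using [<vs, l> <= q l] leaves [|l|^2 <= 0]. *)
  have := epi_minimizer _ (epi_cvg_subseq sN Hepi) Hl (v := vs) (c := 2^-1) _ 0.
  rewrite q0 add0e sub0r dotNl dotNr opprK => H.
  have {}H : (q l + (2^-1 * dot (l - vs) (l - vs))%:E <= (2^-1 * dot vs vs)%:E)%E.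
    apply: H => j x; first exact: hh0.
    have [_ _ Hm] := Hp (s j + N)%N (leq_addl _ _).
    have := lee_wpmul2l _ (Hm x); move=> /(_ (2^-1)%:E); rewrite lee_fin invr_ge0 ler0n => /(_ isT).
    by rewrite !muleDr ?ge0_adde_def ?inE ?lee_fin ?mul1r ?dot_ge0// -!EFinM.
  have := le_trans (leeD2r _ (qvs l)) H; rewrite -EFinD lee_fin => H1.
  have l0 : l = 0.
    apply: dot_eq0; apply/eqP; rewrite eq_le dot_ge0 andbT.
    move: H1; rewrite dotBl !dotBr (dotC l vs); move: (dot _ _) (dot _ _) (dot _ _) => X Y Z.
    by clear => *; lra.
  have : e <= `|l|.
    have := cvg_seq_ler (cvg_const e) (cvg_norm_seq Hl); apply => j /=.
    by have [] := Hp (s j + N)%N (leq_addl _ _).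
  by rewrite l0 normr0 leNgt e0.
have /choice[kt Hkt] : forall n : nat, exists kt : nat * R,
    [/\ (n <= kt.1)%N, 0 < kt.2, kt.2 < n.+1%:R^-1 & `|w_ kt.1 kt.2| < n.+1%:R^-1].
  move=> n; have n0 : (0 : R) < n.+1%:R^-1 by rewrite invr_gt0.
  by have [k [t H]] := key _ n n0; exists (k, t).
have kl n : (n <= (kt n).1)%N by have [] := Hkt n.
have wl : (fun n => w_ (kt n).1 (kt n).2) @ \oo --> (0 : 'rV[R]_m).
  apply: (cvg_seq_le (C := 1) (@cvg_inv_nat R)) => n.
  by rewrite subr0 mul1r; have [_ _ _ /ltW] := Hkt n.
exists (fun n => row_mx (y_ (kt n).1) (ys_ (kt n).1)), (fun n => (kt n).2),
  (fun n => row_mx (w_ (kt n).1 (kt n).2) (vs - w_ (kt n).1 (kt n).2)).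
split; first by move=> n; rewrite /gph /= row_mxKl row_mxKr.
split; first by apply: cvg_row_mx; [exact: (cvg_subseq kl yl)|exact: (cvg_subseq kl ysl)].
split.
  split; first by move=> n; have [] := Hkt n.
  apply: (cvg_seq_le (C := 1) (@cvg_inv_nat R)) => n.
  by rewrite subr0 mul1r; have [_ h1 h2 _] := Hkt n; rewrite gtr0_norm// ltW.
split.
  apply: cvg_row_mx => //; rewrite -[X in _ --> X]subr0; apply: cvgB => //; exact: cvg_const.
move=> n; have [_ t0 _ _] := Hkt n; move: ((kt n).1) ((kt n).2) t0 => k t t0.
rewrite /gph /= scale_row_mx add_row_mx row_mxKl row_mxKr.
have -> : y_ k + t *: w_ k t = P (u_ k + t *: vs).
  by rewrite /w_ scalerA mulfV ?gt_eqF// scale1r Pu addrC subrK.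
have -> : ys_ k + t *: (vs - w_ k t) = (u_ k + t *: vs) - P (u_ k + t *: vs).
  rewrite scalerBr /w_ scalerA mulfV ?gt_eqF// scale1r Pu /u_.
  by apply/rowP => i; rewrite !mxE; ring.
exact: HP1.
Qed.

(** * Second-order expansion of the Moreau envelope *)

(** If [b] is a subgradient of [a], increments of [a] lie below right-endpoint sums of [b]. Summing
    the affine model of [b] over a grid gives [k + c / 2], up to a term vanishing with the mesh. *)
Lemma riemann_upper (R : realType) (a b : R -> R) (k c E : R) :
  (forall s s', 0 <= s <= 1 -> 0 <= s' <= 1 -> b s' * (s - s') <= a s - a s') ->
  (forall s, 0 <= s <= 1 -> `|b s - k - c * s| <= E) ->
  a 1 - a 0 <= k + c / 2 + E.
Proof.
move=> Hab Hb.
have step (N i : nat) : (i <= N.+1)%N ->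
    a (i%:R / N.+1%:R) - a 0 <= i%:R / N.+1%:R * (k + E) + c * (i%:R * i.+1%:R) / (2 * N.+1%:R ^+ 2).
  have N0 : (0 : R) < N.+1%:R by [].
  elim: i => [_|i IH iN].
    by rewrite !mul0r mulr0 subrr mul0r addr0.
  have in01 (j : nat) : (j <= N.+1)%N -> 0 <= (j%:R / N.+1%:R : R) <= 1.
    by move=> jN; rewrite divr_ge0//= ler_pdivrMr// mul1r ler_nat.
  have H1 := Hab _ _ (in01 _ (ltnW iN)) (in01 _ iN).
  have := Hb _ (in01 _ iN); rewrite ler_norml => /andP[_ H2].
  have {}IH := IH (ltnW iN).
  have E1 : i%:R / N.+1%:R - i.+1%:R / N.+1%:R = - (N.+1%:R^-1) :> R.
    by rewrite -[i.+1]addn1 natrD; field; rewrite gt_eqF.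
  rewrite E1 mulrN in H1.
  have H3 : b (i.+1%:R / N.+1%:R) * N.+1%:R^-1 <= (k + c * (i.+1%:R / N.+1%:R) + E) * N.+1%:R^-1.
    rewrite ler_wpM2r ?invr_ge0//; move: H2.
    by rewrite -addrA -opprD lerBlDl addrC.
  have -> : i.+1%:R / N.+1%:R * (k + E) + c * (i.+1%:R * i.+2%:R) / (2 * N.+1%:R ^+ 2) =
     i%:R / N.+1%:R * (k + E) + c * (i%:R * i.+1%:R) / (2 * N.+1%:R ^+ 2) +
     (k + c * (i.+1%:R / N.+1%:R) + E) * N.+1%:R^-1.
    rewrite -[i.+2]addn1 -[i.+1]addn1 !natrD; move: N0; move: (N.+1%:R) (i%:R) => M I; clear => M0.
    by field; rewrite gt_eqF.
  rewrite lerNl opprB in H1.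
  have -> : a (i.+1%:R / N.+1%:R) - a 0 = (a (i%:R / N.+1%:R) - a 0) +
      (a (i.+1%:R / N.+1%:R) - a (i%:R / N.+1%:R)) by rewrite [RHS]addrC subrKA.
  exact: lerD IH (le_trans H1 H3).
have H : (fun N : nat => k + c / 2 + E + c / 2 * N.+1%:R^-1) @ \oo --> k + c / 2 + E.
  rewrite -[X in _ --> X]addr0; apply: cvgD; first exact: cvg_const.
  by apply: cvg_mulr0; exact: cvg_inv_nat.
have := cvg_seq_ler (cvg_const (a 1 - a 0)) H; apply => N.
have N0 : (0 : R) < N.+1%:R by [].
have := step N N.+1 (leqnn _); rewrite divff ?gt_eqF// mul1r.
move/le_trans; apply; rewrite le_eqVlt; apply/orP; left; apply/eqP.
rewrite -[N.+2]addn1 natrD; move: N0; move: (N.+1%:R) => M; clear => M0.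
by field; rewrite gt_eqF.
Qed.

(** The lower bound is the upper bound for the reversed function [s |-> a (1 - s)]. *)
Lemma riemann_estimate (R : realType) (a b : R -> R) (k c E : R) :
  (forall s s', 0 <= s <= 1 -> 0 <= s' <= 1 -> b s' * (s - s') <= a s - a s') ->
  (forall s, 0 <= s <= 1 -> `|b s - k - c * s| <= E) ->
  `|a 1 - a 0 - k - c / 2| <= E.
Proof.
move=> Hab Hb; have H1 := riemann_upper Hab Hb.
have H2 := @riemann_upper R (fun s => a (1 - s)) (fun s => - b (1 - s)) (- k - c) c E.
have rev (s : R) : 0 <= s <= 1 -> 0 <= 1 - s <= 1 by clear => *; lra.
have {}H2 : a (1 - 1) - a (1 - 0) <= - k - c + c / 2 + E.
  apply: H2 => [s s' s01 s'01|s s01].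
    have := Hab _ _ (rev _ s01) (rev _ s'01).
    by move: (a _) (a _) (b _) => p q r; clear => *; lra.
  have := Hb _ (rev _ s01); rewrite -normrN; congr (`|_| <= _).
  by move: (b _) => r; clear; ring.
rewrite subrr subr0 in H2.
rewrite ler_norml; move: H1 H2; move: (a 1) (a 0) => p q; clear => *; lra.
Qed.

Section SecondOrder.
Context (R : realType) (m : nat) (g : 'rV[R]_m -> \bar R) (P : 'rV[R]_m -> 'rV[R]_m).
Context (HP : resolvent (csubdiff g) P).

Definition moreau (u : 'rV[R]_m) := fine (g (P u)) + 2^-1 * dot (u - P u) (u - P u).

(** The subgradient inequality of [g] at [P u] leaves as gap half the squared distance between
    [u' - P u'] and [u - P u]. *)
Lemma moreau_subgradient u u' : dot (u - P u) (u' - u) <= moreau u' - moreau u.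
Proof.
have [HP1 _ _] := HP; have [gu Hu] := HP1 u; have [gu' _] := HP1 u'.
have := Hu (P u'); rewrite -{1}(fineK gu) -{1}(fineK gu') -EFinD lee_fin => H.
rewrite /moreau; have := dot_ge0 ((u' - P u') - (u - P u)).
have -> : u' - u = (P u' - P u) + ((u' - P u') - (u - P u)).
  by apply/rowP => i; rewrite !mxE; ring.
move: H; move: (fine _) (fine _) (P u' - P u) (u - P u) (u' - P u') => A B X Y Z.
rewrite !dotD (dotC Z Y); move: (dot _ _) (dot _ _) (dot _ _) (dot _ _) => p q r s.
move=> *; lra.
Qed.

(** Along the segment from [u] to [u + t v] the gradient is affine up to [o(t)], by
    differentiability of [P] at the single point [u]; the Riemann sum estimate integrates it. *)
Lemma moreau_cvg u B v (t : nat -> R) : frechet P u B -> to0p t ->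
  (fun j => (moreau (u + t j *: v) - moreau u - t j * dot (u - P u) v) * (t j ^+ 2)^-1) @ \oo -->
    2^-1 * dot (v - v *m B) v.
Proof.
move=> HB [t0 tl]; apply/cvg_seqP => e e0.
pose M := m%:R * `|v| * `|v| + 1.
have M0 : 0 < M by rewrite ltr_wpDl// !mulr_ge0.
pose eta := e / (2 * M).
have eta0 : 0 < eta by rewrite divr_gt0// mulr_gt0.
have [d d0 Hd] := HB _ eta0.
have v1 : 0 < `|v| + 1 by rewrite ltr_wpDl.
move/cvg_seqP : tl => /(_ (d / (`|v| + 1)) (divr_gt0 d0 v1))[N HN].
exists N => j /HN; rewrite subr0 (gtr0_norm (t0 j)) => tj.
have T0 := t0 j; move: (t j) T0 tj => T T0 tj.
pose h := T *: v.
have hd : `|h| <= d.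
  rewrite normrZ (gtr0_norm T0); apply: (@le_trans _ _ (T * (`|v| + 1))).
    by rewrite ler_wpM2l ?(ltW T0)// lerDl.
  by rewrite -ler_pdivlMr// ltW.
have H := @riemann_estimate R (fun s => moreau (u + s *: h))
  (fun s => dot (u + s *: h - P (u + s *: h)) h) (dot (u - P u) h) (dot (h - h *m B) h)
  (m%:R * (eta * `|h|) * `|h|).
have {H} : `|moreau (u + 1 *: h) - moreau (u + 0 *: h) - dot (u - P u) h - dot (h - h *m B) h / 2| <=
    m%:R * (eta * `|h|) * `|h|.
  apply: H => [s s' _ _|s s01].
    have := moreau_subgradient (u + s' *: h) (u + s *: h).
    by rewrite opprD addrACA subrr add0r -scalerBl dotZr mulrC.
  pose r := P (u + s *: h) - P u - (s *: h) *m B.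
  have rE : dot (u + s *: h - P (u + s *: h)) h - dot (u - P u) h - dot (h - h *m B) h * s = - dot r h.
    rewrite [_ * s]mulrC -dotZl -!dotBl -dotNl; congr (dot _ h).
    rewrite /r -[(s *: h) *m B]scalemxAl; move: (h) (P _) (P u) (h *m B) => W X Y Z.
    apply/rowP => i; rewrite !mxE; ring.
  have [s0 s1] := andP s01.
  have sh : `|s *: h| <= `|h| by rewrite normrZ ger0_norm// ler_piMl.
  rewrite rE normrN; apply: le_trans (norm_dot_le _ _) _; rewrite ler_wpM2r// ler_wpM2l//.
  apply: le_trans (Hd _ (le_trans sh hd)) _.
  by rewrite ler_pM2l.
rewrite scale1r scale0r addr0 /h.
have hE : dot (T *: v - (T *: v) *m B) (T *: v) = T ^+ 2 * dot (v - v *m B) v.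
  by rewrite -scalemxAl -scalerBr dotZl dotZr mulrA expr2.
rewrite hE dotZr normrZ (gtr0_norm T0) => H.
have T20 : 0 < T ^+ 2 by rewrite exprn_gt0.
set A := moreau _ - _ - _ in H *.
have -> : A * (T ^+ 2)^-1 - 2^-1 * dot (v - v *m B) v =
   (A - T ^+ 2 * dot (v - v *m B) v / 2) * (T ^+ 2)^-1.
  by move: (A) (dot _ v) => p q; field; rewrite gt_eqF.
rewrite normrM [`|(T ^+ 2)^-1|]gtr0_norm ?invr_gt0// ltr_pdivrMr//.
apply: le_lt_trans H _.
have -> : m%:R * (eta * (T * `|v|)) * (T * `|v|) = (eta * (m%:R * `|v| * `|v|)) * T ^+ 2 by ring.
rewrite ltr_pM2r//; apply: (@le_lt_trans _ _ (eta * M)).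
  by rewrite ler_pM2l// /M lerDl.
rewrite /eta invfM mulrA -mulrA mulVf ?gt_eqF// mulr1.
by rewrite ltr_pdivrMr// ltr_pMr// ltr1n.
Qed.

(** In the limit, [v - v *m B] is a subgradient at [v] of the form [2^-1 <v - v *m B, v>]. A
    subgradient of a quadratic form equals its symmetrized gradient, hence [B] is symmetric. *)
Lemma frechet_symmetric u B : frechet P u B -> forall v d, dot (v *m B) d = dot (d *m B) v.
Proof.
move=> HB v d; have t0 := @to0p_inv_nat R.
apply/eqP; rewrite -subr_eq0; apply/eqP.
apply: (@linear_coef_eq0 R _ (dot (d - d *m B) d)) => s.
pose v' := v + s *: d.
have H1 := moreau_cvg (v := v) HB t0; have H2 := moreau_cvg (v := v') HB t0.
have HQ : (fun j : nat => dot (v - (j.+1%:R^-1)^-1 *: (P (u + j.+1%:R^-1 *: v) - P u)) (v' - v)) @ \oo -->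
    dot (v - v *m B) (v' - v).
  apply: cvg_dot; last exact: cvg_const.
  apply: cvgB; first exact: cvg_const.
  exact: frechet_cvg HB t0 (cvg_const v).
have key : 2^-1 * dot (v - v *m B) v + dot (v - v *m B) (v' - v) <= 2^-1 * dot (v' - v' *m B) v'.
  have HS := cvgD H1 HQ _.
  have := cvg_seq_ler (HS _) H2; apply => j.
  rewrite !fctE; set T : R := j.+1%:R^-1; have T0 : 0 < T by rewrite invr_gt0.
  have T20 : 0 < T ^+ 2 by rewrite exprn_gt0.
  have := moreau_subgradient (u + T *: v) (u + T *: v').
  have -> : u + T *: v' - (u + T *: v) = T *: (v' - v).
    by rewrite opprD addrACA subrr add0r scalerBr.
  have -> : u + T *: v - P (u + T *: v) = (u - P u) + T *: (v - T^-1 *: (P (u + T *: v) - P u)).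
    rewrite scalerBr scalerA mulfV ?gt_eqF// scale1r.
    by apply/rowP => i; rewrite !mxE; ring.
  set w := v - T^-1 *: _.
  rewrite dotZr [dot (u - P u + _) _]dotDl dotZl [dot (u - P u) (v' - v)]dotBr => H.
  rewrite -(ler_pM2r T20) mulrDl !mulfVK ?gt_eqF// expr2.
  move: H; move: (moreau _) (moreau _) (moreau _) (dot (u - P u) v) (dot (u - P u) v') (dot w _).
  move=> *; lra.
move: key; rewrite /v' mulmxDl -scalemxAl [v + _ - v]addrC addKr.
rewrite !dotD (dotC d v); move: (dot (v *m B) v) (dot (d *m B) d) (dot (v *m B) d) (dot (d *m B) v).
move: (dot v v) (dot d d) (dot v d) => *; lra.
Qed.

End SecondOrder.

(** * Quadratic forms attached to Jacobians of the resolvent *)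

Definition firm_symmetric (R : realType) m (B : 'M[R]_m) :=
  (forall v d : 'rV[R]_m, dot (v *m B) d = dot (d *m B) v) /\
  (forall v : 'rV[R]_m, dot (v *m B) (v *m B) <= dot (v *m B) v).

(* The quadratic form <(B^-1 - 1) w, w> on the range of B: for a = 1 and B the Jacobian
   of the resolvent P at u, it is the second subderivative of g at (P u, u - P u). *)
Definition quadB (R : realType) m (B : 'M[R]_m) (a : R) (w : 'rV[R]_m) : \bar R :=
  if (w <= B)%MS then (a * dot (w *m pinvmx B - w) w)%:E else +oo%E.

(** Symmetry makes the value independent of the preimage, so the one chosen by [pinvmx] may be
    replaced by [v]. *)
Lemma quadB_image (R : realType) m (B : 'M[R]_m) a v : firm_symmetric B ->
  quadB B a (v *m B) = (a * dot (v - v *m B) (v *m B))%:E.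
Proof.
move=> [sB _]; have vB : (v *m B <= B)%MS by exact: submxMl.
rewrite /quadB vB; congr (a * _)%:E; rewrite !dotBl; congr (_ - _).
by rewrite dotC sB (mulmxKpV vB) dotC.
Qed.

Lemma quadB_finP (R : realType) m (B : 'M[R]_m) a w : quadB B a w \is a fin_num -> exists v, w = v *m B.
Proof. by rewrite /quadB; case: ifP => // /submxP[v ->] _; exists v. Qed.

Lemma quadB_neq_ninfty (R : realType) m (B : 'M[R]_m) a w : quadB B a w != -oo%E.
Proof. by rewrite /quadB; case: ifP. Qed.

Lemma quadB_tangent (R : realType) m (B : 'M[R]_m) a v d : firm_symmetric B ->
  a * dot (v + d - (v + d) *m B) ((v + d) *m B) =
  a * dot (v - v *m B) (v *m B) + 2 * a * dot (v - v *m B) (d *m B) + a * dot (d - d *m B) (d *m B).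
Proof.
move=> [sB _]; have := sB v d; have := dotC (v *m B) (d *m B).
rewrite mulmxDl !dotD (dotC d (v *m B)) (dotC v (d *m B)) => -> ->; ring.
Qed.

Lemma quadB_subgradient (R : realType) m (B : 'M[R]_m) a v x :
  firm_symmetric B -> 0 <= a ->
  ((a * dot (v - v *m B) (v *m B) + dot ((2 * a) *: (v - v *m B)) (x - v *m B))%:E <= quadB B a x)%E.
Proof.
move=> HB a0; have [xB|] := boolP (x <= B)%MS; last by rewrite /quadB => /negbTE ->; rewrite leey.
have /submxP[w ->] := xB; rewrite quadB_image// lee_fin.
have [d ->] : exists d, w = v + d by exists (w - v); rewrite addrC subrK.
rewrite quadB_tangent// [(v + d) *m B]mulmxDl [v *m B + _]addrC addrK dotZl lerDl mulr_ge0//.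
by rewrite dotBl subr_ge0 [dot d _]dotC; apply: HB.2.
Qed.

Lemma submx_separation (R : realType) m (B : 'M[R]_m) w :
  (forall v d : 'rV[R]_m, dot (v *m B) d = dot (d *m B) v) ->
  ~~ (w <= B)%MS -> exists2 k, k *m B = 0 & dot k w != 0.
Proof.
move=> sB; rewrite submxE => /rV0Pn[j wj].
have kE u : dot u (col j (cokermx B))^T = (u *m cokermx B) 0 j.
  by rewrite /dot trmxK colE mulmxA -colE mxE.
exists (col j (cokermx B))^T; last by rewrite dotC kE.
by apply: dot_eq0; rewrite sB kE -mulmxA mulmx_coker mulmx0 mxE.
Qed.

Lemma cvg_seq_gt (R : realType) (a_ : nat -> R) (l a : R) : a_ @ \oo --> l -> a < l ->
  exists N, forall j, (N <= j)%N -> a < a_ j.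
Proof.
move=> /cvg_seqP H al; have la : 0 < l - a by rewrite subr_gt0.
have [N HN] := H _ la; exists N => j /HN; rewrite ltr_norml => /andP[+ _].
by rewrite opprB ltrD2r.
Qed.

(** Convergent affine minorants give the lower half of epi-convergence and their contact points the
    recovery sequences. *)
Lemma epi_quad (R : realType) m (f_ : nat -> 'rV[R]_m -> \bar R) (B : 'M[R]_m) (a : R) :
  firm_symmetric B -> 0 < a ->
  (forall v, exists (p_ s_ : nat -> 'rV[R]_m) (c_ : nat -> R),
    [/\ p_ @ \oo --> v *m B, s_ @ \oo --> (2 * a) *: (v - v *m B),
        c_ @ \oo --> a * dot (v - v *m B) (v *m B),
        forall j, f_ j (p_ j) = (c_ j)%:E &
        forall j x, ((c_ j + dot (s_ j) (x - p_ j))%:E <= f_ j x)%E]) ->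
  epi_cvg f_ (quadB B a).
Proof.
move=> HB a0 Hf x; split=> [x_ xl b bx|].
  have liminf v : b < a * dot (v - v *m B) (v *m B) + dot ((2 * a) *: (v - v *m B)) (x - v *m B) ->
      exists N, forall j, (N <= j)%N -> (b%:E < f_ j (x_ j))%E.
    move=> bv; have [p_ [s_ [c_ [pl sl cl _ Hge]]]] := Hf v.
    have H : (fun j => c_ j + dot (s_ j) (x_ j - p_ j)) @ \oo -->
       a * dot (v - v *m B) (v *m B) + dot ((2 * a) *: (v - v *m B)) (x - v *m B).
      by apply: cvgD => //; apply: cvg_dot => //; apply: cvgB.
    have [N HN] := cvg_seq_gt H bv; exists N => j /HN bj.
    by apply: lt_le_trans (Hge j _); rewrite lte_fin.
  have [xB|xB] := boolP (x <= B)%MS.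
    have /submxP[v xv] := xB; apply: (liminf v).
    by move: bx; rewrite xv quadB_image// lte_fin subrr dot0r addr0.
  have [k kB kx] := submx_separation HB.1 xB.
  (* Off the range of [B] the limit is infinite. A kernel vector [k] not orthogonal to [x] gives
     minorants of value 0 at 0, scaled here to reach [b + 1] at [x]. *)
  apply: (liminf (((b + 1) / (2 * a * dot k x)) *: k)).
  rewrite -scalemxAl kB scaler0 !subr0 dot0r mulr0 add0r !dotZl mulrCA mulfVK.
    by rewrite ltrDl.
  by rewrite !mulf_neq0// gt_eqF.
have [xB|xB] := boolP (x <= B)%MS; last first.
  exists (fun _ => x); split; first exact: cvg_const.
  by move=> b; rewrite /quadB (negbTE xB).
have /submxP[v xv] := xB; have [p_ [s_ [c_ [pl sl cl Hp _]]]] := Hf v.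
exists p_; split; first by rewrite xv.
move=> b; rewrite xv quadB_image// lte_fin => bv.
have [N HN] := cvg_seq_gt (cvgN cl) (a := - b) ltac:(by rewrite ltrN2).
by exists N => j /HN; rewrite Hp lte_fin ltrN2.
Qed.

Lemma quadB_econvex (R : realType) m (B : 'M[R]_m) (a : R) :
  firm_symmetric B -> 0 <= a -> econvex (quadB B a).
Proof.
move=> HB a0; apply: econvex_fin => [x|x y t p q t01 xp yq]; first exact: quadB_neq_ninfty.
have [v xv] : exists v, x = v *m B by apply: (quadB_finP (a := a)); rewrite xp.
have [w yw] : exists v, y = v *m B by apply: (quadB_finP (a := a)); rewrite yq.
pose u := t *: v + (1 - t) *: w.
have -> : t *: x + (1 - t) *: y = u *m B by rewrite mulmxDl -!scalemxAl -xv -yw.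
have := quadB_subgradient u x HB a0; have := quadB_subgradient u y HB a0.
rewrite xp yq quadB_image// !lee_fin.
have -> : y - u *m B = t *: (y - x) by rewrite mulmxDl -!scalemxAl -xv -yw; apply/rowP => i; rewrite !mxE; ring.
have -> : x - u *m B = - (1 - t) *: (y - x).
  by rewrite mulmxDl -!scalemxAl -xv -yw; apply/rowP => i; rewrite !mxE; ring.
rewrite !dotZr; move: (dot _ (y - x)) (a * dot _ _) => D Q H1 H2.
have [t0 t1] := andP t01; have t1' : 0 <= 1 - t by rewrite subr_ge0 ltW.
by have := lerD (ler_wpM2l (ltW t0) H2) (ler_wpM2l t1' H1); clear => *; lra.
Qed.

Lemma subdiff_quadB (R : realType) m (B : 'M[R]_m) (a : R) x s : firm_symmetric B -> 0 < a ->
  limiting_subdiff (quadB B a) x s <-> exists2 v, x = v *m B & s = (2 * a) *: (v - v *m B).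
Proof.
move=> HB a0; split=> [Hs|[v -> ->]].
  have H := limiting_subdiff_convex (quadB_econvex HB (ltW a0)) (@quadB_neq_ninfty _ _ _ _) Hs.
  have [v xv] := quadB_finP Hs.1; pose r := s - (2 * a) *: (v - v *m B).
  have rd d : dot r (d *m B) = 0.
    apply/eqP; rewrite -oppr_eq0; apply/eqP.
    apply: (@linear_coef_eq0 _ _ (a * dot (d - d *m B) (d *m B))) => t.
    have := H ((v + t *: d) *m B).
    rewrite xv !quadB_image// quadB_tangent// -EFinD lee_fin mulmxDl addrAC subrr add0r -!scalemxAl.
    have -> : dot r (d *m B) = dot s (d *m B) - 2 * a * dot (v - v *m B) (d *m B).
      by rewrite /r dotBl dotZl.
    rewrite -scalerBr !dotZr !dotZl.
    move: (dot s _) (dot (v - _) (d *m B)) (dot (d - _) _) (dot _ _); move=> *; lra.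
  have rB : r *m B = 0 by apply: dot_eq0; rewrite HB.1 dotC rd.
  have a20 : 2 * a != 0 by rewrite mulf_neq0// gt_eqF.
  (* The discrepancy [r] lies in the kernel of [B], so it can be absorbed into the preimage without
     changing [x]. *)
  exists (v + (2 * a)^-1 *: r); rewrite mulmxDl -scalemxAl rB scaler0 addr0//.
  by rewrite addrAC scalerDr scalerA mulfV// scale1r /r [RHS]addrC subrK.
have vfin : quadB B a (v *m B) \is a fin_num by rewrite quadB_image.
split=> //; exists (fun _ => v *m B), (fun _ => (2 * a) *: (v - v *m B)).
split; first exact: cvg_const.
split; first exact: cvg_const.
split; last exact: cvg_const.
move=> _; split=> // e e0; exists 1; split => // x' _.
apply: le_trans (quadB_subgradient v x' HB (ltW a0)).
rewrite quadB_image// -EFinD lee_fin lerD2l gerBl mulr_ge0 ?enorm_ge0//; exact: ltW.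
Qed.

Lemma gen_quad_form_quadB (R : realType) m (B : 'M[R]_m) (a : R) : firm_symmetric B -> 0 < a ->
  gen_quad_form (quadB B a).
Proof.
move=> HB a0; split; first by rewrite -{1}(mul0mx _ B) quadB_image// mul0mx dot0r mulr0.
exists <<row_mx B ((2 * a) *: (1%:M - B))>>%MS => z; rewrite genmxE /gph /= subdiff_quadB//.
have E v : v *m row_mx B ((2 * a) *: (1%:M - B)) = row_mx (v *m B) ((2 * a) *: (v - v *m B)).
  by rewrite mul_mx_row -scalemxAr mulmxBr mulmx1.
split=> [[v zl zr]|/submxP[v ->]].
  by rewrite -(hsubmxK z) zl zr -E submxMl.
by exists v; rewrite E ?row_mxKl ?row_mxKr.
Qed.

(** The minorants required by [epi_quad] are those of [sdq_prox]; their slopes converge by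
    differentiability of [P] and their values by the expansion of the envelope. *)
Lemma twice_epi_diff_frechet (R : realType) m (g : 'rV[R]_m -> \bar R) P u B :
  (forall y, g y != -oo%E) -> resolvent (csubdiff g) P -> frechet P u B ->
  firm_symmetric B /\ twice_epi_diff_gqf g (P u) (u - P u) (quadB B 1).
Proof.
move=> gNy HP HB.
have fB : firm_symmetric B.
  by split; [exact: (frechet_symmetric HP HB)|exact: (frechet_firm HP HB)].
split=> //; split; first exact: gen_quad_form_quadB.
move=> t Ht; have [t0 _] := Ht; apply: epi_quad => // v.
pose p_ j := (t j)^-1 *: (P (u + t j *: v) - P u).
have pl : p_ @ \oo --> v *m B by exact: frechet_cvg HB Ht (cvg_const v).
have vpl : (fun j => v - p_ j) @ \oo --> v - v *m B.
  by apply: cvgB => //; exact: cvg_const.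
pose c_ j := (fine (g (P (u + t j *: v))) - fine (g (P u)) - t j * dot (u - P u) (p_ j)) * (2 / t j ^+ 2).
exists p_, (fun j => (2 * 1) *: (v - p_ j)), c_; split=> //.
- by apply: cvgZ => //; exact: cvg_const.
(* Values of [g] at proximal points are traded for increments of the Moreau envelope, whose
   second-order behaviour is known. *)
- have cE j : c_ j = 2 * ((moreau g P (u + t j *: v) - moreau g P u - t j * dot (u - P u) v) * (t j ^+ 2)^-1
      - 2^-1 * dot (v - p_ j) (v - p_ j)).
    rewrite /c_ /moreau.
    have -> : u + t j *: v - P (u + t j *: v) = (u - P u) + t j *: (v - p_ j).
      rewrite scalerBr /p_ scalerA mulfV ?gt_eqF// scale1r.
      by apply/rowP => i; rewrite !mxE; ring.
    rewrite [dot (u - P u) v](_ : _ = dot (u - P u) (v - p_ j) + dot (u - P u) (p_ j)); last first.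
      by rewrite -dotDr subrK.
    move: (t j) (p_ j) (v - p_ j) (u - P u) (fine (g (P (u + _)))) (fine (g (P u))) (t0 j) => T p q w X Y T0.
    rewrite dotDl !(dotDr w) !(dotZl, dotDr, dotZr) (dotC q w).
    move: (dot _ _) (dot _ _) (dot _ _) (dot _ _) => *.
    by field; rewrite gt_eqF.
  rewrite (_ : 1 * _ = 2 * (2^-1 * dot (v - v *m B) v - 2^-1 * dot (v - v *m B) (v - v *m B))).
    rewrite (funext cE).
    apply: cvgM; first exact: cvg_const.
    apply: cvgB; first exact: (moreau_cvg HP HB Ht).
    by apply: cvgM; [exact: cvg_const|exact: cvg_dot].
  rewrite [dot _ (v - _)]dotBr; by move: (dot _ _) (dot _ _) => X Y; field.
- by move=> j; have [E _] := sdq_prox u v gNy HP (t0 j); exact: E.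
- move=> j x; have [_ E] := sdq_prox u v gNy HP (t0 j); rewrite mulr1 dotZl; exact: E.
Qed.

Lemma firm_symmetric_limit (R : realType) m (B_ : nat -> 'M[R]_m) (B : 'M[R]_m) :
  (forall j, firm_symmetric (B_ j)) -> B_ @ \oo --> B -> firm_symmetric B.
Proof.
move=> HB Bl; have Hl (v : 'rV[R]_m) : (fun j => v *m B_ j) @ \oo --> v *m B.
  by apply: cvg_mulmx => //; exact: cvg_const.
have Hd (v d : 'rV[R]_m) : (fun j => dot (v *m B_ j) d) @ \oo --> dot (v *m B) d.
  by apply: cvg_dot => //; exact: cvg_const.
split=> [v d|v].
  apply: (cvg_seq_unique (Hd v d)); under eq_fun do rewrite (HB _).1; exact: Hd.
have Hvv : (fun j => dot (v *m B_ j) (v *m B_ j)) @ \oo --> dot (v *m B) (v *m B) by exact: cvg_dot.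
by have := cvg_seq_ler Hvv (Hd v v); apply => j; exact: (HB j).2.
Qed.

(** The form of the limit Jacobian, with coefficient [2^-1] as the bundle prescribes. Since
    [vs *m B = 0], the parameter [vs] exhibits [vs] itself as a subgradient at 0. *)
Lemma quad_of_strict_derivative (R : realType) m (g : 'rV[R]_m -> \bar R) P y ys vs :
  (forall y, g y != -oo%E) -> resolvent (csubdiff g) P -> csubdiff g y ys ->
  strict_derivative (csubdiff g) y ys 0 vs ->
  exists2 q, quad_bundle g y ys q & limiting_subdiff q 0 vs.
Proof.
move=> gNy HP Hy Hvs; have [HP1 HP2 _] := HP.
have [u_ [B_ [B [ul Bl HB vB]]]] := differentiability_sequence HP Hy Hvs.
have Htw j := twice_epi_diff_frechet gNy HP (HB j).
have fB : firm_symmetric B by apply: firm_symmetric_limit Bl => j; have [] := Htw j.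
have i2 : (0 : R) < 2^-1 by rewrite invr_gt0.
have PuE : (P \o u_) @ \oo --> y by rewrite -(HP2 _ _ Hy); exact: resolvent_cvg HP ul.
exists (quadB B 2^-1); last first.
  apply/(subdiff_quadB _ _ fB i2); exists vs => //.
  by rewrite vB subr0 mulfV// scale1r.
split; first exact: gen_quad_form_quadB.
exists (P \o u_), (fun j => u_ j - P (u_ j)), (fun j => quadB (B_ j) 1).
split; first by move=> j; exact: HP1.
split=> //; split.
  have -> : ys = y + ys - y by rewrite addrC addKr.
  exact: cvgB.
split; first by move=> j; have [] := Htw j.
apply: epi_quad => // v.
have vl : (fun j => v *m B_ j) @ \oo --> v *m B by apply: cvg_mulmx => //; exact: cvg_const.
have vvl : (fun j => v - v *m B_ j) @ \oo --> v - v *m B by apply: cvgB => //; exact: cvg_const.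
have dl : (fun j => 2^-1 * dot (v - v *m B_ j) (v *m B_ j)) @ \oo --> 2^-1 * dot (v - v *m B) (v *m B).
  by apply: cvgM; [exact: cvg_const|exact: cvg_dot].
exists (fun j => v *m B_ j), (fun j => v - v *m B_ j), (fun j => 2^-1 * dot (v - v *m B_ j) (v *m B_ j)).
rewrite mulfV// scale1r; split=> // j; have [fBj _] := Htw j.
  by rewrite quadB_image// mul1r -EFinM.
move=> x; apply: le_trans (lee_wpmul2l _ (quadB_subgradient v x fBj ler01)).
  by rewrite -EFinM lee_fin mul1r mulr1 dotZl mulrDr mulKf.
by rewrite lee_fin ltW.
Qed.

(** * Derivatives of the inner map and the equivalences *)

Lemma frechet_of_differentiable (R : realType) n m (F : 'rV[R]_n -> 'rV[R]_m) x :
  differentiable F x -> frechet F x (jacobian F x).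
Proof.
move=> dF e e0; have := diff_locally dF => /eqaddoP /(_ e e0) /near_norm[d d0 Hd].
exists (d / 2); first by rewrite divr_gt0.
move=> h hd; have := Hd h; rewrite sub0r normrN => H.
have {}H := H (le_lt_trans hd _); rewrite ltr_pdivrMr// ltr_pMr// ltr1n in H.
have := H isT; rewrite !fctE /= /jacobian mul_rV_lin1 opprD addrA.
by rewrite [h + x]addrC.
Qed.

Lemma C1_at_jacobian (R : realType) n m (F : 'rV[R]_n -> 'rV[R]_m) xb :
  (\forall x \near xb, differentiable F x) -> {for xb, continuous (fun z => jacobian F z)} ->
  C1_at F (jacobian F) xb.
Proof.
move=> /near_norm[d1 d10 H1] /cvgrPdist_le Jc e e0.
have /near_norm[d2 d20 H2] := Jc e e0.
exists (Order.min d1 d2) => [|x]; first by rewrite lt_min d10.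
rewrite distrC lt_min => /andP[x1 x2]; split; last by rewrite distrC; exact: H2.
exact/frechet_of_differentiable/H1.
Qed.
(* 'J F x : 'M_(n,m) with  'd F x u = u *m 'J F x ; hence, on row vectors,
   grad F(xb)^T vs is  vs *m ('J F xb)^T . *)
Theorem theorem3p2 (R : realType) (n m : nat)
  (F : 'rV[R]_n -> 'rV[R]_m) (g : 'rV[R]_m -> \bar R) (xb : 'rV[R]_n) (ysb : 'rV[R]_m) :
  (\forall x \near xb, differentiable F x) ->
  (\forall x \near xb, {for x, continuous (fun z => jacobian F z)}) ->
  lower_semicontinuous g -> econvex g -> (forall y, g y != -oo%E) ->
  g (F xb) \is a fin_num ->
  csubdiff g (F xb) ysb ->
  let yb := F xb in
  let GT := fun vs : 'rV[R]_m => vs *m (jacobian F xb)^T in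
  let xsb := GT ysb in
  [<->
   (* (i) *)
   forall L, SC_derivative (csubdiff g) yb ysb L ->
     forall vs, GT vs = 0 -> L (row_mx 0 vs) -> vs = 0;
   (* (ii) *)
   forall q, quad_bundle g yb ysb q ->
     forall vs, GT vs = 0 -> limiting_subdiff q 0 vs -> vs = 0;
   (* (iii) *)
   forall vs, GT vs = 0 -> coderivative (csubdiff g) yb ysb 0 vs -> vs = 0;
   (* (iv) *)
   forall vs, GT vs = 0 -> strict_derivative (csubdiff g) yb ysb 0 vs -> vs = 0;
   (* (v) *)
   metric_regular
     (fun z : 'rV[R]_(n + m) =>
        [set w | exists y, csubdiff g y (rsubmx z) /\ w = y - F (lsubmx z)])
     (row_mx xb ysb) 0;
   (* (vi) *)
   sv_lip_localization
     (fun p : 'rV[R]_(n + m) =>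
        [set ys | csubdiff g (yb + rsubmx p) ys /\ GT ys = lsubmx p])
     (row_mx xsb 0) ysb ].
Proof.
move=> dF cJ gl gc gNy _ Hys yb GT xsb.
have [P HP] := prox_resolvent gl gc gNy Hys.
have mono : monotone_map (csubdiff g) := fun _ _ _ _ => @csubdiff_monotone _ _ _ _ _ _ _.
have HC := C1_at_jacobian dF (nbhs_singleton cJ).
have fF := frechet_of_differentiable (nbhs_singleton dF).
pose sv := strict_derivative (csubdiff g) yb ysb 0.
have i_iv : (forall L, SC_derivative (csubdiff g) yb ysb L ->
    forall vs, GT vs = 0 -> L (row_mx 0 vs) -> vs = 0) -> forall vs, GT vs = 0 -> sv vs -> vs = 0.
  move=> Hi vs vsK Hvs; have [L HL Lvs] := SC_of_strict_derivative HP Hys Hvs.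
  exact: Hi HL _ vsK Lvs.
have v_iii : metric_regular _ _ _ -> forall vs, GT vs = 0 -> coderivative (csubdiff g) yb ysb 0 vs -> vs = 0 :=
  fun Hv vs => coderivative_of_metric_regular fF Hv.
have iii_i : (forall vs, GT vs = 0 -> coderivative (csubdiff g) yb ysb 0 vs -> vs = 0) ->
    forall L, SC_derivative (csubdiff g) yb ysb L -> forall vs, GT vs = 0 -> L (row_mx 0 vs) -> vs = 0.
  by move=> Hiii L HL vs vsK Lvs; apply: Hiii vsK _; exact: coderivative_of_SC mono HL Lvs.
have iv_v H := metric_regular_of_local_solution HP Hys HC (local_estimate_of_strict H).
(* The cycle follows the order of the statement, but most arrows pass through (iv): those out of
   (i), (iii) and (v) reach it by way of (i), and (ii) reaches (iii) through (iv) and (v). *)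
tfae.
- move=> Hi q Hq vs vsK Hvs; apply: i_iv Hi _ vsK _.
  exact: strict_derivative_of_quad gNy gc HP Hq Hvs.
- move=> Hii; apply/v_iii/iv_v => vs vsK Hvs.
  by have [q Hq qvs] := quad_of_strict_derivative gNy HP Hys Hvs; exact: Hii Hq _ vsK qvs.
- by move=> /iii_i /i_iv.
- exact: iv_v.
- by move=> /v_iii /iii_i /i_iv Hiv; exact/localization_of_local_estimate/local_estimate_of_strict.
- move=> /local_estimate_of_localization /strict_of_local_estimate Hiv L HL vs vsK Lvs.
  by apply: Hiv vsK _; exact: strict_derivative_of_SC HL Lvs.
Qed.
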